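(* Let $U$ be a finite-dimensional quasitriangular Hopf algebra with universal $R$-matrix $\mathcal R$, containing $A=\mathrm{Map}(\mathbb T,k)$ as a Hopf subalgebra for a finite Abelian group $\mathbb T$, and let $J(\lambda)$ be a dynamical twist for $U$. Let $\mathcal R^J(\lambda)=J_{21}^{-1}(\lambda)\,\mathcal R\,J(\lambda)=\mathcal R^{J(1)}(\lambda)\otimes\mathcal R^{J(2)}(\lambda)$ and let $\rho:D_J=(H_J^* )^{op}\to H_J$ be the homomorphism of weak Hopf algebras defined by the quasitriangular structure of $H_J$. Then $\rho$ is an isomorphism if and only if the element $$\mathcal R^J_{\mu\nu}(\lambda)=P_\mu\,\mathcal R^{J(1)}(\lambda)\otimes\mathcal R^{J(2)}(\lambda)\,P_\nu\in U\otimes U$$ has the maximal possible rank, equal to $\dim U/|\mathbb T|$, for all fixed $\lambda,\mu,\nu\in\mathbb T$.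
   Context: $k$ is an algebraically closed field. $\mathbb T$ is written additively; $P_\mu$ ($\mu\in\mathbb T$) are the minimal idempotents (delta functions) of $A$. An element of $U^{\otimes n}$ has zero weight if it commutes with the iterated coproduct $\Delta^n(a)\in A^{\otimes n}$ for all $a\in A$. A dynamical twist is a function $J:\mathbb T\to U\otimes U$ with invertible zero weight values such that $(\Delta\otimes\mathrm{id})J(\lambda)\,(J(\lambda+h^{(3)})\otimes1)=(\mathrm{id}\otimes\Delta)J(\lambda)\,(1\otimes J(\lambda))$ and $(\varepsilon\otimes\mathrm{id})J(\lambda)=(\mathrm{id}\otimes\varepsilon)J(\lambda)=1$, where $J(\lambda+h^{(3)})\otimes1$ means $\sum_\mu J(\lambda+\mu)\otimes P_\mu$. A weak bialgebra is an algebra and coalgebra $H$ with $\Delta$ multiplicative (not necessarily unital), $\varepsilon(hgf)=\varepsilon(hg_{(1)})\varepsilon(g_{(2)}f)=\varepsilon(hg_{(2)})\varepsilon(g_{(1)}f)$ and $(\Delta\otimes\mathrm{id})\Delta(1)=(\Delta(1)\otimes1)(1\otimes\Delta(1))=(1\otimes\Delta(1))(\Delta(1)\otimes1)$; a weak Hopf algebra has in addition a linear $S$ with $m(\mathrm{id}\otimes S)\Delta(h)=(\varepsilon\otimes\mathrm{id})(\Delta(1)(h\otimes1))$, $m(S\otimes\mathrm{id})\Delta(h)=(\mathrm{id}\otimes\varepsilon)((1\otimes h)\Delta(1))$, $S(h_{(1)})h_{(2)}S(h_{(3)})=S(h)$. Morphisms are algebra and coalgebra maps commuting with antipodes. For finite-dimensional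 $H$, $H^*$ is a weak Hopf algebra with transposed operations, and $H^{op}$ (opposite multiplication, same coalgebra, antipode $S^{-1}$) is a weak Hopf algebra. The weak Hopf algebra $H_J$: $\mathrm{End}_k(A)$ has matrix units $E_{\lambda\mu}$ ($\lambda,\mu\in\mathbb T$) and is a weak Hopf algebra with $\Delta(E_{\lambda\mu})=E_{\lambda\mu}\otimes E_{\lambda\mu}$, $\varepsilon(E_{\lambda\mu})=1$, $S(E_{\lambda\mu})=E_{\mu\lambda}$. Let $H=\mathrm{End}_k(A)\otimes U$, write $E_{\lambda\mu}u=E_{\lambda\mu}\otimes u$, and put $F=\sum_{\lambda,\mu}E_{\lambda,\lambda+\mu}J^{(1)}(\lambda)\otimes E_{\lambda\lambda}J^{(2)}(\lambda)P_\mu$, $\bar F=\sum_{\lambda,\mu}E_{\lambda+\mu,\lambda}\bar J^{(1)}(\lambda)\otimes E_{\lambda\lambda}P_\mu\bar J^{(2)}(\lambda)$, where $J=J^{(1)}\otimes J^{(2)}$, $J^{-1}=\bar J^{(1)}\otimes\bar J^{(2)}$. $H_J$ is $H$ with the same algebra structure and counit, comultiplication $\Delta_J(h)=\bar F\Delta(h)F$ and antipode $S_J(h)=v^{-1}S(h)v$, $v=m(S\otimes\mathrm{id})F$. It is quasitriangular with $R$-matrix $$\mathcal R(\lambda)=\sum_{\lambda,\mu,\nu\in\mathbb T}E_{\lambda,\lambda+\nu}P_\mu\mathcal R^{J(1)}(\lambda)\otimes E_{\lambda+\mu,\lambda}\mathcal R^{J(2)}(\lambda)P_\nu\in H_J\otimes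 H_J .$$ $D_J$ is the weak Hopf algebra $(H_J^* )^{op}$ and $\rho(\phi)=(\mathrm{id}\otimes\phi)(\mathcal R(\lambda))$ for $\phi\in H_J^*$. The rank of an element of $U\otimes U$ is its rank as a tensor (equivalently the dimension of $\{(\mathrm{id}\otimes\phi)(x):\phi\in U^*\}$). By freeness of $U$ over $A$, $\dim P_\mu U=\dim UP_\nu=\dim U/|\mathbb T|$. *)

(* Defs.v *)
From HB Require Import structures.
From mathcomp Require Import all_boot all_order all_algebra all_field.

Set Implicit Arguments.
Unset Strict Implicit.
Unset Printing Implicit Defensive.

Import GRing.Theory.
Local Open Scope ring_scope.

Reserved Notation "u \ox v" (at level 40, left associativity).

(* U (x) V is encoded by matrices of coordinates in the bases vbasis fullv.   *)
(* tlift b is the linear map on U (x) V induced by a bilinear b; it satisfies *)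
(* tlift b (u \ox v) = b u v, and "tlift (fun a b => ...) x" plays the role   *)
(* of the notation x = x^(1) (x) x^(2).                                       *)
Section Tensor.
Variable k : fieldType.

Definition tens (U V : vectType k) : Type := 'M[k]_(\dim {:U}, \dim {:V}).

HB.instance Definition _ (U V : vectType k) :=
  Vector.copy (tens U V) 'M[k]_(\dim {:U}, \dim {:V}).

Definition tpure (U V : vectType k) (u : U) (v : V) : tens U V :=
  \matrix_(i, j) (coord (vbasis {:U}) i u * coord (vbasis {:V}) j v).

Local Notation "u \ox v" := (tpure u v) : ring_scope.

Definition tlift (U V W : vectType k) (b : U -> V -> W) (x : tens U V) : W :=
  \sum_i \sum_j x i j *: b (vbasis {:U})`_i (vbasis {:V})`_j.

Fact tlift_linear (U V W : vectType k) (b : U -> V -> W) : linear (tlift b).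
Proof.
move=> a x y; rewrite /tlift scaler_sumr -big_split; apply: eq_bigr => i _ /=.
rewrite scaler_sumr -big_split; apply: eq_bigr => j _ /=.
by rewrite !mxE scalerDl scalerA.
Qed.
HB.instance Definition _ (U V W : vectType k) (b : U -> V -> W) :=
  GRing.isLinear.Build k (tens U V) W _ (tlift b) (tlift_linear b).

Lemma tpurePl (U V : vectType k) (v : V) : linear (fun u : U => u \ox v).
Proof. by move=> a x y; apply/matrixP=> i j; rewrite !mxE linearP mulrDl mulrA. Qed.

Lemma tpurePr (U V : vectType k) (u : U) : linear (fun v : V => u \ox v).
Proof. by move=> a x y; apply/matrixP=> i j; rewrite !mxE linearP mulrDr mulrCA. Qed.

Lemma tlift_tpure (U V W : vectType k) (b : U -> V -> W) u v :
    (forall y, linear (b^~ y)) -> (forall x, linear (b x)) ->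
  tlift b (u \ox v) = b u v.
Proof.
move=> bl br.
pose Bl y := GRing.isLinear.Build k U W _ (b^~ y) (bl y).
pose Br x := GRing.isLinear.Build k V W _ (b x) (br x).
pose fl y : {linear U -> W} := HB.pack (b^~ y) (Bl y).
pose fr x : {linear V -> W} := HB.pack (b x) (Br x).
rewrite {2}(coord_vbasis (memvf u)) -[RHS]/(fl v _) linear_sum.
apply: eq_bigr => i _; rewrite linearZ /= {2}(coord_vbasis (memvf v)).
rewrite -[b _ _]/(fr _ _) linear_sum scaler_sumr; apply: eq_bigr => j _.
by rewrite linearZ /= !mxE scalerA.
Qed.

Lemma tensor_span (U V : vectType k) (x : tens U V) :
  x = \sum_i \sum_j x i j *: ((vbasis {:U})`_i \ox (vbasis {:V})`_j).
Proof.
have fr (W : vectType k) : free (vbasis {:W}) := basis_free (vbasisP _).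
apply/matrixP=> i j; rewrite summxE (bigD1 i) //= summxE (bigD1 j) //=.
rewrite !big1 ?addr0 => [|a ai|b bj].
- by rewrite !mxE !coord_free ?fr // !eqxx !mulr1.
- rewrite summxE big1 // => b _; rewrite !mxE !coord_free ?fr //.
  by rewrite (negPf ai) mul0r mulr0.
- rewrite !mxE !coord_free ?fr //.
  by rewrite (negPf bj) !mulr0.
Qed.

Definition tswap (U V : vectType k) : tens U V -> tens V U :=
  tlift (fun u v => v \ox u).

Definition tmap (U V U' V' : vectType k) (f : U -> U') (g : V -> V') :
  tens U V -> tens U' V' := tlift (fun u v => f u \ox g v).

HB.instance Definition _ (U V U' V' : vectType k) (f : U -> U') (g : V -> V') :=
  GRing.Linear.copy (tmap f g) (tlift _).

Definition tassoc (U V W : vectType k) :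
  tens (tens U V) W -> tens U (tens V W) :=
  tlift (fun x w => tlift (fun u v => u \ox (v \ox w)) x).

(* (f (x) id) and (id (x) f) for a functional f, with k (x) U = U = U (x) k *)
Definition slicel (U V : vectType k) (f : U -> k^o) : tens U V -> V :=
  tlift (fun u v => (f u : k) *: v).
Definition slicer (U V : vectType k) (f : V -> k^o) : tens U V -> U :=
  tlift (fun u v => (f v : k) *: u).

(* m (f (x) g) *)
Definition tconv (U V : vectType k) (A : falgType k) (f : U -> A) (g : V -> A) :
  tens U V -> A := tlift (fun u v => f u * g v).

Definition tensor_rank_le (U V : vectType k) (x : tens U V) (r : nat) : Prop :=
  exists (a : 'I_r -> U) (b : 'I_r -> V), x = \sum_i a i \ox b i.

Definition tensor_rank (U V : vectType k) (x : tens U V) (r : nat) : Prop :=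
  tensor_rank_le x r /\ forall s, tensor_rank_le x s -> (r <= s)%N.

End Tensor.

Notation "u \ox v" := (tpure u v) : ring_scope.

Section TensorAlgebra.
Variables (k : fieldType) (U V : falgType k).
Implicit Types x y z : tens U V.

Definition tmul x y : tens U V :=
  tlift (fun u v => tlift (fun u' v' => (u * u') \ox (v * v')) y) x.

Lemma tmul_linearr x : linear (tmul x).
Proof.
move=> a y z; pose m (u : U) (v : V) := tlift (fun u' v' => (u * u') \ox (v * v')).
have E w : tmul x w =
  \sum_i \sum_j x i j *: m (vbasis {:U})`_i (vbasis {:V})`_j w by [].
rewrite !E scaler_sumr -big_split; apply: eq_bigr => i _ /=.
rewrite scaler_sumr -big_split; apply: eq_bigr => j _ /=.
by rewrite /m linearP scalerDr !scalerA mulrC.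
Qed.

Lemma tmul_linearl y : linear (tmul^~ y).
Proof. by move=> a x z; rewrite /tmul linearP. Qed.

Lemma tmul_tpure u v u' v' :
  tmul (u \ox v) (u' \ox v') = (u * u') \ox (v * v').
Proof.
have E w w' : tlift (fun a b => (w * a) \ox (w' * b)) (u' \ox v')
               = (w * u') \ox (w' * v').
  apply: tlift_tpure => [z|z] a s t /=.
    by rewrite mulrDr -scalerAr tpurePl.
  by rewrite mulrDr -scalerAr tpurePr.
rewrite /tmul tlift_tpure // => [z|z] a s t; rewrite !E.
  by rewrite mulrDl -scalerAl tpurePl.
by rewrite mulrDl -scalerAl tpurePr.
Qed.

Lemma tensor_ind (P : tens U V -> Prop) :
  (forall a x y, P x -> P y -> P (a *: x + y)) ->
  (forall u v, P (u \ox v)) -> forall x, P x.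
Proof.
move=> PZD Pp x; rewrite (tensor_span x).
have P0 : P 0 by rewrite -(addNr (0 \ox 0)) -scaleN1r; apply: PZD.
have PD y z : P y -> P z -> P (y + z).
  by move=> Py Pz; rewrite -[y]scale1r; apply: PZD.
apply: (big_ind P) => // i _; apply: (big_ind P) => // j _.
by rewrite -[_ *: _]addr0; apply: PZD.
Qed.

Fact tmulA : associative tmul.
Proof.
have L := tmul_linearl; have R := tmul_linearr.
move=> x y z.
elim/tensor_ind: x => [a x x' Hx Hx'|u v]; first by rewrite !L Hx Hx'.
elim/tensor_ind: y => [a y y' Hy Hy'|u' v']; first by rewrite !(L, R) Hy Hy'.
elim/tensor_ind: z => [a z z' Hz Hz'|u'' v'']; first by rewrite !R Hz Hz'.
by rewrite !tmul_tpure !mulrA.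
Qed.

Fact tmul1l : left_id (1 \ox 1) tmul.
Proof.
move=> x; elim/tensor_ind: x => [a x y Hx Hy|u v].
  by rewrite tmul_linearr Hx Hy.
by rewrite tmul_tpure !mul1r.
Qed.

Fact tmul1r : right_id (1 \ox 1) tmul.
Proof.
move=> x; elim/tensor_ind: x => [a x y Hx Hy|u v].
  by rewrite tmul_linearl Hx Hy.
by rewrite tmul_tpure !mulr1.
Qed.

Fact tmulDl : left_distributive tmul +%R.
Proof. by move=> x y z; rewrite -[x]scale1r tmul_linearl !scale1r. Qed.

Fact tmulDr : right_distributive tmul +%R.
Proof. by move=> x y z; rewrite -[y]scale1r tmul_linearr !scale1r. Qed.

Fact tone_neq0 : (1 : U) \ox (1 : V) != 0.
Proof.
have ex (W : falgType k) : exists i, coord (vbasis {:W}) i 1 != 0.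
  apply/existsP; apply: contraT; rewrite negb_exists => /forallP c0.
  rewrite -(oner_eq0 W) (coord_vbasis (memvf (1 : W))); apply/eqP.
  by apply: big1 => i _; rewrite (eqP (negPn (c0 i))) scale0r.
have [i ci] := ex U; have [j cj] := ex V.
apply/eqP => /matrixP/(_ i j); rewrite !mxE => /eqP.
by rewrite mulf_eq0 (negPf ci) (negPf cj).
Qed.

HB.instance Definition _ := GRing.Zmodule_isNzRing.Build (tens U V)
  tmulA tmul1l tmul1r tmulDl tmulDr tone_neq0.

Fact tscalerAl a x y : a *: (x * y) = (a *: x) * y.
Proof.
have := tmul_linearl y a x 0; rewrite /= addr0 => E.
by rewrite [RHS]E [tmul 0 y](mul0r (y : tens U V)) addr0.
Qed.
HB.instance Definition _ := GRing.Lmodule_isLalgebra.Build k (tens U V) tscalerAl.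

Fact tscalerAr a x y : a *: (x * y) = x * (a *: y).
Proof.
have := tmul_linearr x a y 0; rewrite addr0 => E.
by rewrite [RHS]E [tmul x 0](mulr0 (x : tens U V)) addr0.
Qed.
HB.instance Definition _ := GRing.Lalgebra_isAlgebra.Build k (tens U V) tscalerAr.

HB.instance Definition _ := Algebra_isFalgebra.Build k (tens U V).

End TensorAlgebra.

Section HopfAlgebra.
Variable k : fieldType.

(* hopfData and weakHopfData carry the operations without the axioms.         *)
Record hopfData (V : vectType k) := HopfData {
  comul : {linear V -> tens V V};
  counit : {linear V -> k^o};
  antipode : {linear V -> V} }.

(* In a weakHopfData the product and unit are explicit, since the dual of a   *)
(* weak Hopf algebra has no canonical falgType structure.                     *)
Record weakHopfData (V : vectType k) := WeakHopfData {
  wmul : V -> V -> V;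
  wone : V;
  wcoalg :> hopfData V }.

Definition falg_weakHopf (A : falgType k) (c : hopfData A) : weakHopfData A :=
  WeakHopfData (fun x y => x * y) 1 c.

Record weak_hopf_morphism (V W : vectType k)
    (c : weakHopfData V) (d : weakHopfData W) (f : {linear V -> W}) : Prop := {
  morph_mul : forall x y, f (wmul c x y) = wmul d (f x) (f y);
  morph_one : f (wone c) = wone d;
  morph_comul : forall x, comul d (f x) = tmap f f (comul c x);
  morph_counit : forall x, counit d (f x) = counit c x;
  morph_antipode : forall x, antipode d (f x) = f (antipode c x) }.

Definition weak_hopf_isomorphism (V W : vectType k)
    (c : weakHopfData V) (d : weakHopfData W) (f : {linear V -> W}) : Prop :=
  weak_hopf_morphism c d f /\
  exists g : {linear W -> V},
    [/\ weak_hopf_morphism d c g, cancel f g & cancel g f].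

Record is_hopf (A : falgType k) (c : hopfData A) : Prop := {
  hopf_coassoc : forall x,
    tassoc (tmap (comul c) id (comul c x)) = tmap id (comul c) (comul c x);
  hopf_counitl : forall x, slicel (counit c) (comul c x) = x;
  hopf_counitr : forall x, slicer (counit c) (comul c x) = x;
  hopf_comulM : forall x y, comul c (x * y) = comul c x * comul c y;
  hopf_comul1 : comul c 1 = 1;
  hopf_counitM : forall x y,
    counit c (x * y) = (counit c x : k) * (counit c y : k);
  hopf_counit1 : counit c 1 = (1 : k);
  hopf_antipodel : forall x,
    tconv (antipode c) id (comul c x) = (counit c x : k) *: 1;
  hopf_antipoder : forall x,
    tconv id (antipode c) (comul c x) = (counit c x : k) *: 1 }.

Record is_quasitriangular (A : falgType k) (c : hopfData A) (R : tens A A) :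
    Prop := {
  rmx_unit : R \is a GRing.unit;
  rmx_comul : forall x, R * comul c x = tswap (comul c x) * R;
  (* (Delta (x) id) R = R_13 R_23 in (A (x) A) (x) A *)
  rmx_hexl : tmap (comul c) id R =
    tlift (fun a b => (a \ox (1 : A)) \ox b) R *
    tlift (fun a b => ((1 : A) \ox a) \ox b) R;
  (* (id (x) Delta) R = R_13 R_12 in A (x) (A (x) A) *)
  rmx_hexr : tmap id (comul c) R =
    tlift (fun a b => a \ox ((1 : A) \ox b)) R *
    tlift (fun a b => a \ox (b \ox (1 : A))) R }.

Section TensorHopf.
Variables (A B : falgType k) (c : hopfData A) (d : hopfData B).

Definition tens_comul : tens A B -> tens (tens A B) (tens A B) :=
  tlift (fun a b =>
    tlift (fun a1 a2 =>
      tlift (fun b1 b2 => (a1 \ox b1) \ox (a2 \ox b2)) (comul d b))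
    (comul c a)).
HB.instance Definition _ := GRing.Linear.copy tens_comul (tlift _).

Definition tens_counit : tens A B -> k^o :=
  tlift (fun a b => (counit c a : k) * (counit d b : k) : k^o).
HB.instance Definition _ := GRing.Linear.copy tens_counit (tlift _).

Definition tens_hopf : hopfData (tens A B) :=
  HopfData tens_comul tens_counit (tmap (antipode c) (antipode d)).
End TensorHopf.

Section DualOp.
Variables (V : vectType k) (c : weakHopfData V).

Definition dual := 'Hom(V, k^o).

Definition dual_mul (f g : dual) : dual :=
  linfun (tlift (fun a b => (f a : k) * (g b : k) : k^o) \o comul c).

Definition dual_vbasis (i : 'I_(\dim {:V})) : dual :=
  linfun (coord (vbasis {:V}) i : V -> k^o).

(* the f_1 (x) f_2 such that f (x y) = f_1 x f_2 y *)
Definition dual_comul (f : dual) : tens dual dual :=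
  \sum_(i < \dim {:V}) \sum_(j < \dim {:V}) (f (wmul c (vbasis {:V})`_i (vbasis {:V})`_j) : k) *:
    (dual_vbasis i \ox dual_vbasis j).
Fact dual_comul_linear : linear dual_comul.
Proof.
move=> a f g; rewrite /dual_comul scaler_sumr -big_split; apply: eq_bigr => i _ /=.
rewrite scaler_sumr -big_split; apply: eq_bigr => j _ /=.
by rewrite add_lfunE scale_lfunE scalerDl scalerA.
Qed.
HB.instance Definition _ :=
  GRing.isLinear.Build k dual (tens dual dual) _ dual_comul dual_comul_linear.

Definition dual_counit (f : dual) : k^o := f (wone c).
Fact dual_counit_linear : linear dual_counit.
Proof. by move=> a f g; rewrite /dual_counit add_lfunE scale_lfunE. Qed.
HB.instance Definition _ :=
  GRing.isLinear.Build k dual k^o _ dual_counit dual_counit_linear.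

Definition dual_antipode (f : dual) : dual := (f \o linfun (antipode c))%VF.
Fact dual_antipode_linear : linear dual_antipode.
Proof. by move=> a f g; rewrite /dual_antipode comp_lfunDl comp_lfunZl. Qed.
HB.instance Definition _ :=
  GRing.isLinear.Build k dual dual _ dual_antipode dual_antipode_linear.

Definition dual_weakHopf : weakHopfData dual :=
  WeakHopfData dual_mul (linfun (counit c))
    (HopfData dual_comul dual_counit dual_antipode).

(* The inverse (_^-1)%VF of a linear map is its two-sided inverse when it is  *)
(* bijective, as the antipode of a finite-dimensional weak Hopf algebra is.   *)
Definition op_weakHopf : weakHopfData V :=
  WeakHopfData (fun x y => wmul c y x) (wone c)
    (HopfData (comul c) (counit c) (linfun (antipode c))^-1%VF).
End DualOp.

End HopfAlgebra.

Section MapAlgebra.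
Variables (k : fieldType) (T : finZmodType).

Definition Map := {ffun T -> k^o}.
HB.instance Definition _ := Vector.copy Map {ffun T -> k^o}.

Definition delta (m : T) : Map := [ffun t => (t == m)%:R : k^o].

Definition map_comul (f : Map) : tens Map Map :=
  \sum_a \sum_b (f (a + b) : k) *: (delta a \ox delta b).
Fact map_comul_linear : linear map_comul.
Proof.
move=> a f g; rewrite /map_comul scaler_sumr -big_split; apply: eq_bigr => s _ /=.
rewrite scaler_sumr -big_split; apply: eq_bigr => t _ /=.
by rewrite !ffunE scalerDl scalerA.
Qed.
HB.instance Definition _ :=
  GRing.isLinear.Build k Map (tens Map Map) _ map_comul map_comul_linear.

Definition map_counit (f : Map) : k^o := f 0.
Fact map_counit_linear : linear map_counit.
Proof. by move=> a f g; rewrite /map_counit !ffunE. Qed.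
HB.instance Definition _ :=
  GRing.isLinear.Build k Map k^o _ map_counit map_counit_linear.

Definition map_antipode (f : Map) : Map := [ffun t => f (- t)].
Fact map_antipode_linear : linear map_antipode.
Proof. by move=> a f g; apply/ffunP=> t; rewrite !ffunE. Qed.
HB.instance Definition _ :=
  GRing.isLinear.Build k Map Map _ map_antipode map_antipode_linear.

Definition map_hopf : weakHopfData Map :=
  WeakHopfData (fun f g : Map => [ffun t => (f t : k) * (g t : k) : k^o] : Map)
    ([ffun=> 1 : k^o] : Map) (HopfData map_comul map_counit map_antipode).

(* End_k(Map), as matrices in the basis of delta functions. The size is #|T|, *)
(* written so as to be visibly positive.                                      *)
Definition EndMap := 'M[k]_(#|T|.-1.+1).
HB.instance Definition _ := Falgebra.copy EndMap 'M[k]_(#|T|.-1.+1).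

Definition row_of (l : T) : 'I_(#|T|.-1.+1) := inord (enum_rank l).

Definition munit (l m : T) : EndMap := delta_mx (row_of l) (row_of m).

Definition end_comul (M : EndMap) : tens EndMap EndMap :=
  \sum_l \sum_m M (row_of l) (row_of m) *: (munit l m \ox munit l m).
Fact end_comul_linear : linear end_comul.
Proof.
move=> a f g; rewrite /end_comul scaler_sumr -big_split; apply: eq_bigr => s _ /=.
rewrite scaler_sumr -big_split; apply: eq_bigr => t _ /=.
by rewrite !mxE scalerDl scalerA.
Qed.
HB.instance Definition _ :=
  GRing.isLinear.Build k EndMap (tens EndMap EndMap) _ end_comul end_comul_linear.

Definition end_counit (M : EndMap) : k^o :=
  \sum_l \sum_m M (row_of l) (row_of m).
Fact end_counit_linear : linear end_counit.
Proof.
move=> a f g; rewrite /end_counit scaler_sumr -big_split; apply: eq_bigr => s _ /=.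
by rewrite scaler_sumr -big_split; apply: eq_bigr => t _ /=; rewrite !mxE.
Qed.
HB.instance Definition _ :=
  GRing.isLinear.Build k EndMap k^o _ end_counit end_counit_linear.

Definition end_antipode (M : EndMap) : EndMap := M^T.
Fact end_antipode_linear : linear end_antipode.
Proof. by move=> a f g; rewrite /end_antipode linearP. Qed.
HB.instance Definition _ :=
  GRing.isLinear.Build k EndMap EndMap _ end_antipode end_antipode_linear.

Definition end_hopf : hopfData EndMap :=
  HopfData end_comul end_counit end_antipode.

End MapAlgebra.

Arguments Map k T : clear implicits.
Arguments EndMap k T : clear implicits.
Arguments munit k {T} l m.
Arguments delta k {T} m.
Arguments map_hopf k T : clear implicits.
Arguments end_hopf k T : clear implicits.

Section DynamicalTwist.
Variables (k : fieldType) (T : finZmodType) (U : falgType k).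
Variables (c : hopfData U) (iota : {linear Map k T -> U}).

Definition is_hopf_embedding : Prop :=
  injective iota /\ weak_hopf_morphism (map_hopf k T) (falg_weakHopf c) iota.

Definition idem (m : T) : U := iota (delta k m).

Definition zero_weight (x : tens U U) : Prop :=
  forall a : Map k T, x * comul c (iota a) = comul c (iota a) * x.

Record is_dynamical_twist (J : T -> tens U U) : Prop := {
  twist_unit : forall l, J l \is a GRing.unit;
  twist_zero_weight : forall l, zero_weight (J l);
  twist_cocycle : forall l,
    tassoc (tmap (comul c) id (J l) * \sum_m (J (l + m) \ox idem m)) =
    tmap id (comul c) (J l) * ((1 : U) \ox J l);
  twist_counitl : forall l, slicel (counit c) (J l) = 1;
  twist_counitr : forall l, slicer (counit c) (J l) = 1 }.

(* corner m n (a (x) b) = P_m a (x) b P_n, so when x ranges over U (x) U,     *)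
(* corner m n x ranges over P_m U (x) U P_n.                                  *)
Definition corner (m n : T) (x : tens U U) : tens U U :=
  tlift (fun a b => (idem m * a) \ox (b * idem n)) x.

Definition max_corner_rank (m n : T) (d : nat) : Prop :=
  (exists x, tensor_rank (corner m n x) d) /\
  forall x r, tensor_rank (corner m n x) r -> (r <= d)%N.

Variable J : T -> tens U U.

Definition dynH := tens (EndMap k T) U.
HB.instance Definition _ := Falgebra.copy dynH (tens (EndMap k T) U).

Local Notation E l m u := (munit k l m \ox (u : U) : dynH).

Definition dynF : tens dynH dynH :=
  \sum_l \sum_m
    tlift (fun a b => E l (l + m) a \ox E l l (b * idem m)) (J l).

Definition dynFbar : tens dynH dynH :=
  \sum_l \sum_m
    tlift (fun a b => E (l + m) l a \ox E l l (idem m * b)) (J l)^-1.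

Definition dynH_hopf : hopfData dynH := tens_hopf (end_hopf k T) c.

Definition dyn_comul (h : dynH) : tens dynH dynH :=
  dynFbar * comul dynH_hopf h * dynF.
Fact dyn_comul_linear : linear dyn_comul.
Proof.
by move=> a x y; rewrite /dyn_comul linearP mulrDr mulrDl -scalerAr -scalerAl.
Qed.
HB.instance Definition _ :=
  GRing.isLinear.Build k dynH (tens dynH dynH) _ dyn_comul dyn_comul_linear.

Definition dyn_v : dynH := tconv (antipode dynH_hopf) id dynF.

Definition dyn_antipode (h : dynH) : dynH :=
  dyn_v^-1 * antipode dynH_hopf h * dyn_v.
Fact dyn_antipode_linear : linear dyn_antipode.
Proof.
by move=> a x y; rewrite /dyn_antipode linearP mulrDr mulrDl -scalerAr -scalerAl.
Qed.
HB.instance Definition _ :=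
  GRing.isLinear.Build k dynH dynH _ dyn_antipode dyn_antipode_linear.

Definition H_J : weakHopfData dynH :=
  falg_weakHopf (HopfData dyn_comul (counit dynH_hopf) dyn_antipode).

Definition D_J : weakHopfData (dual dynH) := op_weakHopf (dual_weakHopf H_J).

Variable R : tens U U.

Definition dynR (l : T) : tens U U := (tswap (J l))^-1 * R * J l.

Definition dyn_rmatrix : tens dynH dynH :=
  \sum_l \sum_m \sum_n
    tlift (fun a b => E l (l + n) (idem m * a) \ox E (l + m) l (b * idem n))
      (dynR l).

Definition rho (f : dual dynH) : dynH := slicer f dyn_rmatrix.
Fact rho_linear : linear rho.
Proof.
move=> a f g; rewrite /rho /slicer /tlift scaler_sumr -big_split.
apply: eq_bigr => i _ /=; rewrite scaler_sumr -big_split; apply: eq_bigr => j _ /=.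
rewrite add_lfunE scale_lfunE scalerDl scalerDr !scalerA.
by rewrite [a * _]mulrC -mulrA [_ * a]mulrC.
Qed.
HB.instance Definition _ :=
  GRing.isLinear.Build k (dual dynH) dynH _ rho rho_linear.

End DynamicalTwist.

(* Main.v *)
From HB Require Import structures.
Require Import Defs.
From mathcomp Require Import all_boot all_order all_algebra all_field.

Set Implicit Arguments.
Unset Strict Implicit.
Unset Printing Implicit Defensive.

Import GRing.Theory.
Local Open Scope ring_scope.

(** The R-matrix of H_J is the sum over l, a, b in T of the tensors
    E_(l,a) (x) E_(b,l) times the corner of weights b - l and a - l of R^J(l).
    Its left legs lie in the spaces E_(l,a) P_(b-l) U and its right legs in the
    spaces E_(b,l) U P_(a-l); indexed by (l, a, b), each family of spaces is a
    direct sum decomposition of H, so the R-matrix is block diagonal.  Hence rho,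
    which slices the second leg, is injective exactly when no nonzero functional
    on some U P_n is annihilated by a corner ([rho_blocks],
    [rho_injective_of_nondegenerate], [nondegenerate_of_rho_injective]).  As
    dim P_n U = dim U P_n = dim U / |T|, this says that every corner has the
    maximal rank ([corner_rankP]).

    The weight spaces have equal dimensions for the following reason.  The bijection
    x (x) y |-> x_1 (x) x_2 y of U (x) U turns multiplication by P_n on the first
    factor into multiplication by Delta(P_n), the sum of the P_a (x) P_(n-a).  So
    d(a) = dim P_a U satisfies (dim U) d(n) <= sum_a d(a) d(n - a), where the d(a)
    are positive with sum dim U; at a maximum of d this forces d to be constant
    ([constant_of_convolution], [weight_rank]).

    It remains that rho is a morphism of weak Hopf algebras when it is bijective.
    Compatibility with products and coproducts is the pair of hexagon identities
    of the R-matrix ([dyn_hexl], [dyn_hexr]).  In matrix units they are the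
    dynamical hexagons of R^J(l) ([dynR_hexl], [dynR_hexr]), up to moving weights
    across R^J, which commutes with the coproduct of A; and these follow from the
    hexagons of R and three instances of the cocycle identity of J.  Tensor legs
    are handled through commuting homomorphisms f, g : U -> W, writing tconv f g x
    for the image of x in W: a permutation of a commuting triple is again one, so
    permuted identities are instances of the same lemma.

    For the antipode, (S (x) S)(R) = R is deduced from R sigma = e' and
    sigma tau = e, where sigma = (S (x) id)(R) and tau = (S (x) S)(R)
    ([antipode_rmatrix]).  This uses of S only that it reverses products and the
    value of x_1 S(x_2) ([dyn_target]); both rest on v^-1 = m (id (x) S)(Fbar),
    which is the identity [twistQ'_Q] obtained by contracting the middle leg of
    the cocycle identity.  Thus S o rho o S^* = rho, where S^* is the transpose.
    If rho is onto, then so is S; hence S is invertible, and rho intertwines S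
    with the antipode of D_J, the inverse of S^* ([rho_morphism]). *)

(** * Linear algebra and tensors *)

Lemma mulr_reorder (V : pzRingType) (a a' b b' x y : V) :
    GRing.comm a' b -> GRing.comm a' x -> GRing.comm b' x ->
  a * b * x * (a' * b' * y) = a * a' * (b * b') * (x * y).
Proof.
move=> a'b a'x b'x; rewrite -!mulrA; congr (_ * _).
rewrite [x * _]mulrA -a'x -!mulrA [b * _]mulrA -a'b -!mulrA; congr (_ * (_ * _)).
by rewrite !mulrA b'x.
Qed.

Lemma exchange_big3 (V : nmodType) (I1 I2 I3 : finType) (f : I1 -> I2 -> I3 -> V) :
  \sum_a \sum_x \sum_d f a x d = \sum_d \sum_x \sum_a f a x d.
Proof.
rewrite exchange_big [RHS]exchange_big; apply: eq_bigr => x _.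
by rewrite exchange_big.
Qed.

Lemma exchange_big22 (V : nmodType) (I1 I2 I3 I4 : finType)
    (f : I1 -> I2 -> I3 -> I4 -> V) :
  \sum_a \sum_b \sum_x \sum_d f a b x d = \sum_x \sum_d \sum_a \sum_b f a b x d.
Proof.
under eq_bigr do rewrite exchange_big; rewrite exchange_big; apply: eq_bigr => x _.
by under eq_bigr do rewrite exchange_big; rewrite exchange_big.
Qed.

Lemma linear_injective (k : fieldType) (V W : vectType k) (f : {linear V -> W}) :
  (forall x, f x = 0 -> x = 0) -> injective f.
Proof.
by move=> f0 x y fxy; apply/subr0_eq/f0; rewrite linearB fxy subrr.
Qed.

(** Left multiplication by y is injective, hence onto by finiteness of dimension. *)
Lemma falg_left_inverse (k : fieldType) (A : falgType k) (x y : A) :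
  x * y = 1 -> y \is a GRing.unit /\ y^-1 = x.
Proof.
move=> xy; have inj z : y * z = 0 -> z = 0.
  by move=> yz; rewrite -[z]mul1r -xy -mulrA yz mulr0.
pose f : 'End(A) := linfun (GRing.mull_fun y idfun : {linear A -> A}).
have kf : lker f == 0%VS.
  by apply/lker0P; apply: linear_injective => a /=; rewrite lfunE; apply: inj.
have [z yz] : exists z, y * z = 1.
  by exists ((f^-1)%VF 1); have := lker0_lfunVK kf 1; rewrite lfunE.
have zx : z = x by rewrite -[z]mul1r -xy -mulrA yz mulr1.
have yx : y * x = 1 by rewrite -zx.
have yu : y \is a GRing.unit by apply/unitrP; exists x.
by split=> //; apply: (mulrI yu); rewrite mulrV.
Qed.

Section TensorCalculus.
Variable k : fieldType.

Lemma tensor_linear_ext (U V W : vectType k) (f g : {linear tens U V -> W}) :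
  (forall u v, f (u \ox v) = g (u \ox v)) -> f =1 g.
Proof.
move=> fg x; rewrite (tensor_span x) !linear_sum; apply: eq_bigr => i _.
by rewrite !linear_sum; apply: eq_bigr => j _; rewrite !linearZ /= fg.
Qed.

Lemma eq_tlift (U V W : vectType k) (b b' : U -> V -> W) :
  (forall u v, b u v = b' u v) -> tlift b =1 tlift b'.
Proof.
by move=> bb x; apply: eq_bigr => i _; apply: eq_bigr => j _; rewrite bb.
Qed.

Lemma tlift_lin (U V W : vectType k) a (b b' : U -> V -> W) x :
  tlift (fun u v => a *: b u v + b' u v) x = a *: tlift b x + tlift b' x.
Proof.
rewrite /tlift scaler_sumr -big_split; apply: eq_bigr => i _ /=.
rewrite scaler_sumr -big_split; apply: eq_bigr => j _ /=.
by rewrite scalerDr !scalerA mulrC.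
Qed.

Lemma tlift0 (U U' V : vectType k) (z : tens U U') : tlift (fun _ _ => 0 : V) z = 0.
Proof. by rewrite /tlift big1 // => i _; rewrite big1 // => j _; rewrite scaler0. Qed.

Lemma tlift_sum (I : finType) (A B V : vectType k)
    (b : I -> A -> B -> V) x :
  tlift (fun u v => \sum_i b i u v) x = \sum_i tlift (b i) x.
Proof.
rewrite /tlift [RHS]exchange_big; apply: eq_bigr => i _ /=.
rewrite [RHS]exchange_big; apply: eq_bigr => j _ /=.
by rewrite scaler_sumr.
Qed.

Lemma linear_tlift (U V W W' : vectType k) (f : {linear W -> W'})
    (b : U -> V -> W) x : f (tlift b x) = tlift (fun u v => f (b u v)) x.
Proof.
rewrite /tlift linear_sum; apply: eq_bigr => i _.
by rewrite linear_sum; apply: eq_bigr => j _; rewrite linearZ.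
Qed.

Lemma tpureZ (V W : vectType k) a b (u : V) (w : W) :
  (a *: u) \ox (b *: w) = (a * b) *: (u \ox w).
Proof. by apply/matrixP=> i j; rewrite !mxE !linearZ /= mulrACA. Qed.

HB.instance Definition _ (U V : vectType k) (A : falgType k) (f : U -> A)
  (g : V -> A) := GRing.Linear.copy (tconv f g) (tlift _).

HB.instance Definition _ (U V : vectType k) :=
  GRing.Linear.copy (@tswap k U V) (tlift _).

HB.instance Definition _ (U V W : vectType k) :=
  GRing.Linear.copy (@tassoc k U V W) (tlift _).

HB.instance Definition _ (U V : vectType k) (f : U -> k^o) :=
  GRing.Linear.copy (@slicel k U V f) (tlift _).

HB.instance Definition _ (U V : vectType k) (f : V -> k^o) :=
  GRing.Linear.copy (@slicer k U V f) (tlift _).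

Lemma tswapE (U V : vectType k) (u : U) (v : V) : tswap (u \ox v) = v \ox u.
Proof.
by rewrite /tswap tlift_tpure // => [y|x]; [exact: tpurePr|exact: tpurePl].
Qed.

Lemma tmapE (U V U' V' : vectType k) (f : {linear U -> U'})
  (g : {linear V -> V'}) u v : tmap f g (u \ox v) = f u \ox g v.
Proof.
rewrite /tmap tlift_tpure // => [y|x] a s t; rewrite !linearP.
  exact: tpurePl.
exact: tpurePr.
Qed.

Lemma tassocE (U V W : vectType k) (u : U) (v : V) (w : W) :
  tassoc ((u \ox v) \ox w) = u \ox (v \ox w).
Proof.
have E w' x' y' :
    tlift (fun (u : U) (v : V) => u \ox (v \ox w')) (x' \ox y') = x' \ox (y' \ox w').
  rewrite tlift_tpure // => [y|x] a s t; first exact: tpurePl.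
  by rewrite tpurePl tpurePr.
rewrite /tassoc tlift_tpure ?E // => [y|x] a s t; first exact: linearP.
rewrite -tlift_lin; apply: eq_tlift => u' v'.
by rewrite !tpurePr.
Qed.

Lemma slicelE (U V : vectType k) (f : {linear U -> k^o}) (u : U) (v : V) :
  slicel f (u \ox v) = (f u : k) *: v.
Proof.
rewrite /slicel tlift_tpure // => [y|x] a s t.
  by rewrite linearP scalerDl scalerA.
by rewrite scalerDr !scalerA mulrC.
Qed.

Lemma slicerE (U V : vectType k) (f : {linear V -> k^o}) (u : U) (v : V) :
  slicer f (u \ox v) = (f v : k) *: u.
Proof.
rewrite /slicer tlift_tpure // => [y|x] a s t.
  by rewrite scalerDr !scalerA mulrC.
by rewrite linearP scalerDl scalerA.
Qed.

Lemma tconvE (U V : vectType k) (A : falgType k) (f : {linear U -> A})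
  (g : {linear V -> A}) u v : tconv f g (u \ox v) = f u * g v.
Proof.
rewrite /tconv tlift_tpure // => [y|x] a s t; rewrite linearP.
  by rewrite mulrDl -scalerAl.
by rewrite mulrDr -scalerAr.
Qed.

Lemma slicer_tmap (V : vectType k) (p q : {linear V -> V})
    (f g : {linear V -> k^o}) x : (forall v, g v = f (q v)) ->
  p (slicer g x) = slicer f (tmap p q x).
Proof.
move=> gE; rewrite /tmap [RHS]linear_tlift [slicer g x]/slicer linear_tlift.
by apply: eq_tlift => u v; rewrite /= slicerE linearZ gE.
Qed.

Lemma tmap_sum (V W : vectType k) (r : {linear V -> W}) (n : nat)
    (a : 'I_n -> 'I_n -> k) (u : 'I_n -> V) (w : 'I_n -> W) :
    (forall i, r (u i) = w i) ->
  tmap r r (\sum_i \sum_j a i j *: (u i \ox u j)) =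
  \sum_i \sum_j a i j *: (w i \ox w j).
Proof.
move=> ruw; rewrite linear_sum; apply: eq_bigr => i _.
rewrite linear_sum; apply: eq_bigr => j _.
by rewrite linearZ /= tmapE !ruw.
Qed.

Lemma tconv_tswap (U V : vectType k) (A : falgType k) (f : {linear U -> A})
    (g : {linear V -> A}) x :
  (forall u v, GRing.comm (f u) (g v)) -> tconv g f (tswap x) = tconv f g x.
Proof.
move=> fg; pose L : {linear tens U V -> A} := tconv g f \o @tswap k U V.
apply: (@tensor_linear_ext _ _ _ L (tconv f g)) => u v.
by rewrite /L /= tswapE !tconvE fg.
Qed.

Lemma tconv_tmap (U V U' V' : vectType k) (A : falgType k)
    (p : {linear U -> U'}) (q : {linear V -> V'}) (f : {linear U' -> A})
    (g : {linear V' -> A}) x :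
  tconv f g (tmap p q x) = tconv (f \o p) (g \o q) x.
Proof.
pose L : {linear tens U V -> A} := tconv f g \o tmap p q.
apply: (@tensor_linear_ext _ _ _ L (tconv (f \o p) (g \o q))) => u v.
by rewrite /L /= tmapE !tconvE.
Qed.

Lemma tconv_tassoc (U V W : vectType k) (A : falgType k)
    (f : {linear U -> A}) (g : {linear V -> A}) (h : {linear W -> A}) x :
  tconv f (tconv g h) (tassoc x) = tconv (tconv f g) h x.
Proof.
pose L : {linear tens (tens U V) W -> A} := tconv f (tconv g h) \o @tassoc k U V W.
apply: (@tensor_linear_ext _ _ _ L (tconv (tconv f g) h)) => uv w; rewrite /L /=.
pose Rw := GRing.mulr_fun (h w) (tconv f g).
rewrite tconvE.
pose iw : {linear tens U V -> tens (tens U V) W} := HB.pack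
  (fun x : tens U V => x \ox w) (GRing.isLinear.Build k _ _ *:%R _ (tpurePl w)).
apply: (@tensor_linear_ext _ _ _ (L \o iw) Rw) => u v.
by rewrite /L /Rw /= tassocE !tconvE /= tconvE mulrA.
Qed.

Section Inclusions.
Variables A B : falgType k.

Definition inl_tens (a : A) : tens A B := a \ox 1.
Definition inr_tens (b : B) : tens A B := 1 \ox b.

HB.instance Definition _ := GRing.isLinear.Build k A (tens A B) *:%R inl_tens
  (tpurePl 1).
HB.instance Definition _ := GRing.isLinear.Build k B (tens A B) *:%R inr_tens
  (tpurePr 1).

Lemma tpureM (a a' : A) (b b' : B) :
  (a \ox b) * (a' \ox b') = (a * a') \ox (b * b').
Proof. exact: tmul_tpure. Qed.

Lemma tens1E : (1 : tens A B) = 1 \ox 1. Proof. by []. Qed.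

Lemma inl_tens_monoid : GRing.monoid_morphism inl_tens.
Proof. by split=> // x y; rewrite /inl_tens tpureM mulr1. Qed.

Lemma inr_tens_monoid : GRing.monoid_morphism inr_tens.
Proof. by split=> // x y; rewrite /inr_tens tpureM mulr1. Qed.

Lemma inl_inr_comm a b : GRing.comm (inl_tens a) (inr_tens b).
Proof. by rewrite /GRing.comm !tpureM !mul1r !mulr1. Qed.

Lemma tpure_inl_inr a b : a \ox b = inl_tens a * inr_tens b.
Proof. by rewrite tpureM mul1r mulr1. Qed.

Lemma tconv_inl_inr x : tconv inl_tens inr_tens x = x.
Proof.
apply: (@tensor_linear_ext _ _ _ (tconv inl_tens inr_tens) idfun) => u v.
by rewrite /= tconvE /= -tpure_inl_inr.
Qed.

End Inclusions.

Lemma tmap_legs (B B' : falgType k) (V V' : vectType k) (p : {linear V -> B})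
    (q : {linear V' -> B'}) x :
  tmap p q x = tconv (@inl_tens B B' \o p) (@inr_tens B B' \o q) x.
Proof. by apply: eq_tlift => u v; rewrite tpure_inl_inr. Qed.

End TensorCalculus.

(** * Commuting legs and convolution *)

Section Legs.
Variables (k : fieldType) (U W : falgType k).
Implicit Types f g h : {linear U -> W}.

Definition commuting (U V : Type) (f : U -> W) (g : V -> W) :=
  forall x y, GRing.comm (f x) (g y).

Lemma commuting_sym (V V' : Type) (f : V -> W) (g : V' -> W) :
  commuting f g -> commuting g f.
Proof. by move=> fg x y; apply/commr_sym. Qed.

Lemma tconv_commuting (U' : falgType k) (V : Type) (f : {linear U -> W})
    (g : {linear U' -> W}) (h : V -> W) :
  commuting f h -> commuting g h -> commuting (tconv f g) h.
Proof.
move=> fh gh x y; elim/tensor_ind: x => [a x x' Hx Hx'|u v].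
  by rewrite /GRing.comm linearP mulrDl mulrDr -scalerAl -scalerAr Hx Hx'.
by rewrite tconvE; apply/commr_sym/commrM; apply/commr_sym.
Qed.

Lemma tconvM (U' : falgType k) (f : {linear U -> W}) (g : {linear U' -> W}) x y :
    {morph f : x y / x * y} -> {morph g : x y / x * y} -> commuting f g ->
  tconv f g (x * y) = tconv f g x * tconv f g y.
Proof.
move=> fM gM fg; elim/tensor_ind: x => [a x x' Hx Hx'|u v].
  by rewrite mulrDl linearD -scalerAl linearZ /= Hx Hx' linearP mulrDl scalerAl.
elim/tensor_ind: y => [a y y' Hy Hy'|u' v'].
  by rewrite mulrDr linearD -scalerAr linearZ /= Hy Hy' linearP mulrDr scalerAr.
rewrite tpureM !tconvE fM gM -!mulrA; congr (_ * _).
by rewrite !mulrA; congr (_ * _); apply: fg.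
Qed.

Lemma tconv_monoid (U' : falgType k) (f : {linear U -> W}) (g : {linear U' -> W}) :
    GRing.monoid_morphism f -> GRing.monoid_morphism g -> commuting f g ->
  GRing.monoid_morphism (tconv f g).
Proof.
move=> [f1 fM] [g1 gM] fg; split; first by rewrite tens1E tconvE f1 g1 mulr1.
by move=> x y; apply: tconvM.
Qed.

Lemma monoid_mulV (V : unitRingType) (f : V -> W) x :
  GRing.monoid_morphism f -> x \is a GRing.unit -> f x^-1 * f x = 1.
Proof. by move=> [f1 fM] xu; rewrite -fM mulVr. Qed.

Lemma monoid_lcancel (V : unitRingType) (f : V -> W) x y z :
    GRing.monoid_morphism f -> x \is a GRing.unit ->
  f x * y = f x * z -> y = z.
Proof.
move=> fM xu e; rewrite -[y]mul1r -[z]mul1r -(monoid_mulV fM xu) -!mulrA.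
by rewrite e.
Qed.

(** Three commuting copies of U inside W.  Any permutation of such a triple is
    again one, so an identity proved for all triples holds with its tensor legs
    permuted. *)
Definition legs3 f g h : Prop :=
  [/\ GRing.monoid_morphism f, GRing.monoid_morphism g & GRing.monoid_morphism h] /\
  [/\ commuting f g, commuting f h & commuting g h].

Lemma legs3_rot f g h : legs3 f g h -> legs3 g h f.
Proof. by case=> -[? ? ?] [? ? ?]; split; split=> //; apply: commuting_sym. Qed.

End Legs.

Section Convolution.
Variables (k : fieldType) (U W : falgType k) (c : hopfData U).
Implicit Types f g h : {linear U -> W}.

(** For commuting homomorphisms f and g this is the leg on which the coproduct
    of an element acts. *)
Definition conv (f g : U -> W) : U -> W := fun x => tconv f g (comul c x).
HB.instance Definition _ f g := GRing.Linear.copy (conv f g) (tconv f g \o comul c).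

Definition conv_one (x : U) : W := (counit c x : k) *: 1.
Fact conv_one_linear : linear conv_one.
Proof. by move=> a x y; rewrite /conv_one linearP scalerDl scalerA. Qed.
HB.instance Definition _ :=
  GRing.isLinear.Build k U W _ conv_one conv_one_linear.

Hypothesis cH : is_hopf c.

Lemma eq_conv (f f' g g' : U -> W) : f =1 f' -> g =1 g' -> conv f g =1 conv f' g'.
Proof. by move=> ff gg x; apply: eq_tlift => u v; rewrite ff gg. Qed.

Lemma convA f g h : conv (conv f g) h =1 conv f (conv g h).
Proof.
move=> x.
have := congr1 (tconv f (tconv g h)) (hopf_coassoc cH x).
rewrite tconv_tassoc.
rewrite -[tmap (comul c) _ _]/(tmap (comul c) idfun _) tconv_tmap => E.
rewrite /conv [RHS]/=.
transitivity (tconv f (tconv g h) (tmap idfun (comul c) (comul c x))) => //.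
by rewrite tconv_tmap.
Qed.

Lemma conv1r f : conv f conv_one =1 f.
Proof.
move=> x; rewrite -[in RHS](hopf_counitr cH x) /conv.
rewrite /slicer linear_tlift; apply: eq_tlift => u v.
by rewrite linearZ /= /conv_one -scalerAr mulr1.
Qed.

Lemma conv1l f : conv conv_one f =1 f.
Proof.
move=> x; rewrite -[in RHS](hopf_counitl cH x) /conv.
rewrite /slicel linear_tlift; apply: eq_tlift => u v.
by rewrite linearZ /= /conv_one -scalerAl mul1r.
Qed.

Lemma conv_monoid f g :
    GRing.monoid_morphism f -> GRing.monoid_morphism g -> commuting f g ->
  GRing.monoid_morphism (conv f g).
Proof.
move=> fM gM fg; have [m1 mM] := tconv_monoid fM gM fg.
split=> [|x y]; first by rewrite /conv hopf_comul1.
by rewrite /conv hopf_comulM // mM.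
Qed.

Lemma conv_commuting (V : Type) f g (h : V -> W) :
  commuting f h -> commuting g h -> commuting (conv f g) h.
Proof. by move=> fh gh x y; apply: tconv_commuting. Qed.

Lemma comul_swapE f g x : commuting f g ->
  tconv f g (tswap (comul c x)) = conv g f x.
Proof. by move=> fg; rewrite tconv_tswap // => u v; apply/commr_sym/fg. Qed.

End Convolution.

Section AntipodeAntimultiplicative.
Variables (k : fieldType) (U : falgType k) (c : hopfData U).
Hypothesis cH : is_hopf c.
Local Notation S := (antipode c).

Lemma antipode1 : S 1 = 1.
Proof.
have := hopf_antipodel cH 1; rewrite hopf_comul1 // hopf_counit1 // tens1E.
by rewrite -[tconv _ id]/(tconv S idfun) tconvE /= mulr1 scale1r.
Qed.

(** Convolving on the right with the identity is injective, as S is its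
    convolution inverse.  Cancelling it first in the variable y and then in the
    variable x turns S(x_1 y_1) x_2 y_2 = eps(x) eps(y) into the claim. *)
Lemma antipodeM x y : S (x * y) = S y * S x.
Proof.
have cancel_id (f g : {linear U -> U}) : conv c f idfun =1 conv c g idfun -> f =1 g.
  move=> fg z; rewrite -(conv1r cH f) -(conv1r cH g).
  rewrite -!(eq_conv c (frefl _) (hopf_antipoder cH)).
  rewrite -(convA cH f idfun S) -(convA cH g idfun S).
  exact: eq_conv.
pose hy (y : U) : {linear U -> U} := S \o (GRing.mulr_fun y idfun).
(* S(x_1 y) x_2 = eps(x) S(y), because both sides, as functions of y, have the
   same convolution with the identity: S(x_1 y_1) x_2 y_2 = eps(x) eps(y). *)
have main z y' : conv c (hy y') idfun z = (counit c z : k) *: S y'.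
  pose gz : {linear U -> U} := (counit c z : k) \*: S.
  have lin : linear (fun y' => conv c (hy y') idfun z).
    move=> a u v; rewrite -tlift_lin; apply: eq_tlift => p q.
    by rewrite /hy /= mulrDr linearD -scalerAr linearZ /= mulrDl scalerAl.
  pose L : {linear U -> U} := HB.pack (fun y' => conv c (hy y') idfun z)
    (GRing.isLinear.Build k U U *:%R _ lin).
  apply: (cancel_id L gz) => {}y'; rewrite /L /gz /conv /=.
  have E (p q : tens U U) : tlift (fun a b => tlift (fun a' b' =>
      S (a' * a) * b' * b) p) q = tconv S idfun (p * q).
    elim/tensor_ind: p => [a p p' Hp Hp'|u v].
      rewrite mulrDl linearD -scalerAl linearZ /= -Hp -Hp' -tlift_lin.
      by apply: eq_tlift => r s; rewrite linearP.
    elim/tensor_ind: q => [a q q' Hq Hq'|u' v'].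
      by rewrite mulrDr -scalerAr !linearP /= Hq Hq'.
    have B a b : tlift (fun a' b' => S (a' * a) * b' * b) (u \ox v)
        = S (u * a) * v * b.
      rewrite tlift_tpure // => [r|r] s w w'.
        by rewrite mulrDl linearD -scalerAl linearZ /= !mulrDl !scalerAl.
      by rewrite mulrDr mulrDl -scalerAr -scalerAl.
    rewrite (eq_tlift B) tpureM tconvE /= tlift_tpure ?mulrA // => [r|r] s w w'.
      by rewrite mulrDr linearD -scalerAr linearZ /= !mulrDl !scalerAl.
    by rewrite mulrDr -scalerAr.
  transitivity (tlift (fun a b => tlift (fun a' b' => S (a' * a) * b' * b)
      (comul c z)) (comul c y')).
    apply: eq_tlift => a b; rewrite /tconv.
    exact: (linear_tlift (GRing.mulr_fun b idfun)).
  rewrite E -hopf_comulM // (hopf_antipodel cH) hopf_counitM // -scalerA.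
  rewrite -(hopf_antipodel cH y') /tconv.
  rewrite -[LHS]/((GRing.scale_fun (counit c z : k) idfun : {linear U -> U}) _) linear_tlift.
  by apply: eq_tlift => a b; rewrite /= scalerAl.
rewrite -[LHS]/(hy y x) -(conv1r cH (hy y)).
rewrite -(eq_conv c (frefl _) (hopf_antipoder cH)) -(convA cH (hy y) idfun S).
rewrite -[in RHS](conv1l cH S x).
rewrite -[RHS]/(GRing.mull_fun (S y) idfun _) linear_tlift.
by apply: eq_tlift => u v; rewrite main /= /conv_one -!scalerAl mul1r scalerAr.
Qed.

End AntipodeAntimultiplicative.

(** * Idempotents and weights *)

Section Idempotents.
Variables (k : fieldType) (T : finZmodType) (U : falgType k).
Variables (c : hopfData U) (iota : {linear Map k T -> U}).
Hypothesis iotaH : is_hopf_embedding c iota.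
Local Notation P := (idem iota).

Lemma idemM m n : P m * P n = if m == n then P m else 0.
Proof.
have [_ [iM _ _ _ _]] := iotaH.
have := iM (delta k m) (delta k n); rewrite /= -/(P m) -/(P n) => <-.
have [<-|mn] := eqVneq; first by congr (iota _); apply/ffunP=> t; rewrite !ffunE -natrM mulnb andbb.
rewrite -(linear0 iota); congr (iota _); apply/ffunP=> t; rewrite !ffunE -natrM mulnb.
by have [->|] := eqVneq t m; rewrite ?(negPf mn).
Qed.

Lemma idem_id m : P m * P m = P m. Proof. by rewrite idemM eqxx. Qed.

Lemma sum_idem : \sum_m P m = 1.
Proof.
have [_ [_ i1 _ _ _]] := iotaH; rewrite -linear_sum; move: i1 => /= <-.
congr (iota _); apply/ffunP=> t; rewrite sum_ffunE ffunE (bigD1 t) //= ffunE eqxx.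
by rewrite big1 ?addr0 // => s /negPf st; rewrite ffunE eq_sym st.
Qed.

Lemma idem_neq0 m : P m != 0.
Proof.
have [iI _] := iotaH; apply/eqP => Pm0.
have /ffunP/(_ m) : delta k m = 0 by apply: iI; rewrite linear0.
by rewrite !ffunE eqxx; apply/eqP; rewrite oner_eq0.
Qed.

Lemma comul_idem n : comul c (P n) = \sum_a P a \ox P (n - a).
Proof.
have [_ [_ _ iD _ _]] := iotaH; rewrite iD /= /map_comul linear_sum.
apply: eq_bigr => a _; rewrite linear_sum (bigD1 (n - a)) //= big1 ?addr0 => [|b bn].
  by rewrite linearZ /= ffunE addrC subrK eqxx scale1r tmapE.
rewrite linearZ /= ffunE; case: eqP => [abn|_]; last by rewrite scale0r.
by case/eqP: bn; rewrite -abn [a + b]addrC addrK.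
Qed.

Lemma counit_idem n : counit c (P n) = (n == 0)%:R.
Proof.
have [_ [_ _ _ iE _]] := iotaH.
by rewrite iE /= /map_counit ffunE eq_sym.
Qed.

Lemma antipode_idem n : antipode c (P n) = P (- n).
Proof.
have [_ [_ _ _ _ iS]] := iotaH; rewrite iS /=; congr (iota _).
by apply/ffunP=> t; rewrite !ffunE eqr_oppLR.
Qed.

Section Legs.
Variables (W : falgType k) (f g : {linear U -> W}).
Hypotheses (fM : GRing.monoid_morphism f) (gM : GRing.monoid_morphism g).
Hypothesis fg : commuting f g.

Lemma idem_legM m n : f (P m) * f (P n) = if m == n then f (P m) else 0.
Proof. by rewrite -fM.2 idemM; case: ifP => // _; rewrite linear0. Qed.

Lemma idem_leg_id m : f (P m) * f (P m) = f (P m).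
Proof. by rewrite idem_legM eqxx. Qed.

Lemma conv_idem n : conv c f g (P n) = \sum_a f (P a) * g (P (n - a)).
Proof. by rewrite /conv comul_idem linear_sum; apply: eq_bigr => a _; rewrite /= tconvE. Qed.

Lemma conv_idem_l n a : conv c f g (P n) * f (P a) = f (P a) * g (P (n - a)).
Proof.
rewrite conv_idem mulr_suml (bigD1 a) //= big1 ?addr0 => [|b /negPf ba].
  by rewrite -mulrA -[g _ * _]fg mulrA idem_leg_id.
by rewrite -mulrA -[g _ * _]fg mulrA idem_legM ba mul0r.
Qed.

Lemma idem_conv_l n a : f (P a) * conv c f g (P n) = f (P a) * g (P (n - a)).
Proof.
rewrite conv_idem mulr_sumr (bigD1 a) //= big1 ?addr0 => [|b /negPf ba].
  by rewrite mulrA idem_leg_id.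
by rewrite mulrA idem_legM eq_sym ba mul0r.
Qed.

End Legs.

Lemma conv_idemC (W : falgType k) (f g : {linear U -> W}) n :
  commuting f g -> conv c f g (P n) = conv c g f (P n).
Proof.
move=> fg; rewrite !conv_idem (reindex_inj (inv_inj (subKr n))).
by apply: eq_bigr => a _ /=; rewrite subKr fg.
Qed.

(** Elements commuting with the coproduct of A move weight between their two
    legs: fixing the total weight, either side determines the other. *)
Lemma weight_transfer (W : falgType k) (f g : {linear U -> W}) z a b d e :
    GRing.monoid_morphism f -> GRing.monoid_morphism g -> commuting f g ->
    (forall n, z * conv c f g (P n) = conv c f g (P n) * z) ->
    a + b = d + e ->
  f (P a) * g (P b) * z * g (P e) = f (P a) * z * f (P d) * g (P e).
Proof.
move=> fM gM fg zw abde; have gf := commuting_sym fg.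
have -> : b = (d + e) - a by rewrite -abde [a + b]addrC addrK.
rewrite -(@idem_conv_l W f g fM) -!mulrA; congr (_ * _).
rewrite mulrA -zw -mulrA; congr (_ * _).
by rewrite (conv_idemC _ fg) conv_idem_l // addrK fg.
Qed.

End Idempotents.

(** * The hexagons of the dynamical R-matrix *)

Section DynamicalYangBaxter.
Variables (k : fieldType) (T : finZmodType) (U : falgType k).
Variables (c : hopfData U) (R : tens U U) (iota : {linear Map k T -> U}).
Variable J : T -> tens U U.
Hypotheses (cH : is_hopf c) (RH : is_quasitriangular c R).
Hypotheses (iotaH : is_hopf_embedding c iota).
Hypothesis JH : is_dynamical_twist c iota J.
Local Notation P := (idem iota).
Local Notation "f ** g" := (conv c f g) (at level 40).

Lemma tswap_comul_idem n : tswap (comul c (P n)) = comul c (P n).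
Proof.
rewrite comul_idem // linear_sum (reindex_inj (inv_inj (subKr n))).
by apply: eq_bigr => a _; rewrite /= tswapE subKr.
Qed.

Lemma tswap_monoid : GRing.monoid_morphism (@tswap k U U).
Proof.
split; first by rewrite tens1E tswapE.
move=> x y; elim/tensor_ind: x => [a x x' Hx Hx'|u v].
  by rewrite mulrDl -scalerAl !linearP /= Hx Hx' mulrDl scalerAl.
elim/tensor_ind: y => [a y y' Hy Hy'|u' v'].
  by rewrite mulrDr -scalerAr !linearP /= Hy Hy' mulrDr scalerAr.
by rewrite tpureM !tswapE tpureM.
Qed.

Lemma tswap_dynR l : tswap (J l) * dynR J R l = R * J l.
Proof.
rewrite /dynR -!mulrA mulVKr //; have [t1 tM] := tswap_monoid.
by apply/unitrP; exists (tswap (J l)^-1); rewrite -!tM mulVr ?mulrV ?t1 ?(twist_unit JH).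
Qed.

(** D(l) stands for the dynamical R-matrix J_21^-1(l) R J(l), given by the relation
    J_21(l) D(l) = R J(l). *)
Variable D : T -> tens U U.
Hypothesis DE : forall l, tswap (J l) * D l = R * J l.

(** A is commutative and cocommutative, so that R commutes with its coproduct. *)
Lemma dynR_zero_weight l n :
  D l * comul c (P n) = comul c (P n) * D l.
Proof.
have [t1 tM] := tswap_monoid.
have Ju : tswap (J l) \is a GRing.unit.
  by apply/unitrP; exists (tswap (J l)^-1); rewrite -!tM mulVr ?mulrV ?t1 ?(twist_unit JH).
apply: (mulrI Ju); rewrite !mulrA DE.
have Jn : tswap (J l) * comul c (P n) = comul c (P n) * tswap (J l).
  by rewrite -tswap_comul_idem -!tM (twist_zero_weight JH).
rewrite Jn -[RHS]mulrA DE -mulrA (twist_zero_weight JH) !mulrA.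
by rewrite (rmx_comul RH) tswap_comul_idem.
Qed.

Section Legs.
Variable W : falgType k.
Implicit Types f g h : {linear U -> W}.

Lemma leg_hexl f g h : legs3 f g h ->
  tconv (f ** g) h R = tconv f h R * tconv g h R.
Proof.
move=> [[fM gM hM] [fg fh gh]].
have := congr1 (tconv (tconv f g) h) (rmx_hexl RH).
rewrite -[tmap _ id]/(tmap (comul c) idfun) tconv_tmap => E.
rewrite [LHS]E tconvM; first last.
- exact: tconv_commuting.
- exact: hM.2.
- exact: (tconv_monoid fM gM fg).2.
congr (_ * _); rewrite linear_tlift; apply: eq_tlift => a b /=.
  by rewrite tconvE /= tconvE gM.1 mulr1.
by rewrite tconvE /= tconvE fM.1 mul1r.
Qed.

Lemma leg_hexr f g h : legs3 f g h ->
  tconv f (g ** h) R = tconv f h R * tconv f g R.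
Proof.
move=> [[fM gM hM] [fg fh gh]].
have := congr1 (tconv f (tconv g h)) (rmx_hexr RH).
rewrite -[tmap id _]/(tmap idfun (comul c)) tconv_tmap => E.
rewrite [LHS]E tconvM; first last.
- by apply: commuting_sym; apply: tconv_commuting; apply: commuting_sym.
- exact: (tconv_monoid gM hM gh).2.
- exact: fM.2.
congr (_ * _); rewrite linear_tlift; apply: eq_tlift => a b /=.
  by rewrite tconvE /= tconvE gM.1 mul1r.
by rewrite tconvE /= tconvE hM.1 mulr1.
Qed.

Lemma leg_braid f g x :
    GRing.monoid_morphism f -> GRing.monoid_morphism g -> commuting f g ->
  tconv f g R * (f ** g) x = (g ** f) x * tconv f g R.
Proof.
move=> fM gM fg; have [_ tM] := tconv_monoid fM gM fg.
by rewrite -tM (rmx_comul RH) tM comul_swapE.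
Qed.

Lemma leg_braidl f g h x : legs3 f g h ->
  tconv f g R * tconv (f ** g) h x = tconv (g ** f) h x * tconv f g R.
Proof.
move=> [[fM gM hM] [fg fh gh]].
elim/tensor_ind: x => [a x x' Hx Hx'|u v].
  by rewrite !linearP mulrDl mulrDr -scalerAl -scalerAr /= Hx Hx'.
rewrite !tconvE /= mulrA leg_braid // -!mulrA; congr (_ * _).
exact: tconv_commuting.
Qed.

Lemma leg_braidr f g h x : legs3 f g h ->
  tconv f g R * tconv h (f ** g) x = tconv h (g ** f) x * tconv f g R.
Proof.
move=> L; have [[fM gM hM] [fg fh gh]] := L.
have hS (f' g' : {linear U -> W}) : commuting f' h -> commuting g' h ->
    tconv h (f' ** g') x = tconv (f' ** g') h (tswap x).
  by move=> fh' gh'; rewrite tconv_tswap //; apply/commuting_sym/conv_commuting.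
by rewrite !hS // leg_braidl.
Qed.

Lemma leg_cocycle f g h l : legs3 f g h ->
  tconv (f ** g) h (J l) * (\sum_m tconv f g (J (l + m)) * h (P m)) =
  tconv f (g ** h) (J l) * tconv g h (J l).
Proof.
move=> [[fM gM hM] [fg fh gh]].
have := congr1 (tconv f (tconv g h)) (twist_cocycle JH l).
rewrite tconv_tassoc => E.
have fgM := tconv_monoid fM gM fg; have ghM := tconv_monoid gM hM gh.
have fg_h : commuting (tconv f g) h by apply: tconv_commuting.
have f_gh : commuting f (tconv g h).
  by apply: commuting_sym; apply: tconv_commuting; apply: commuting_sym.
move: E; rewrite tconvM; [|exact: fgM.2|exact: hM.2|by[]].
rewrite [in RHS]tconvM; [|exact: fM.2|exact: ghM.2|by[]].
rewrite -[tmap _ id]/(tmap (comul c) idfun) -[tmap id _]/(tmap idfun (comul c)).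
rewrite !tconv_tmap tconvE fM.1 mul1r linear_sum => E.
rewrite -[RHS]E; congr (_ * _).
by apply: eq_bigr => m _; rewrite /= tconvE.
Qed.

Lemma weighted_sum_idem h (x : T -> W) n : GRing.monoid_morphism h ->
  (\sum_m x m * h (P m)) * h (P n) = x n * h (P n).
Proof.
move=> hM; rewrite mulr_suml (bigD1 n) //= big1 ?addr0 => [|m /negPf mn].
  by rewrite -mulrA (idem_leg_id iotaH).
by rewrite -mulrA (idem_legM iotaH) // mn mulr0.
Qed.

(** Multiplying by an idempotent of the third leg selects one term of the
    dynamical shift. *)
Lemma leg_cocycle_idem f g h l n : legs3 f g h ->
  tconv (f ** g) h (J l) * tconv f g (J (l + n)) * h (P n) =
  tconv f (g ** h) (J l) * tconv g h (J l) * h (P n).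
Proof.
move=> L; have [[fM gM hM] [fg fh gh]] := L.
by rewrite -leg_cocycle // -!mulrA weighted_sum_idem.
Qed.

Lemma dynR_leg f g l :
    GRing.monoid_morphism f -> GRing.monoid_morphism g -> commuting f g ->
  tconv g f (J l) * tconv f g (D l) = tconv f g R * tconv f g (J l).
Proof.
move=> fM gM fg; have [_ tM] := tconv_monoid fM gM fg.
rewrite -tM -DE tM; congr (_ * _).
by rewrite tconv_tswap //; apply: commuting_sym.
Qed.

Lemma dynR_leg_zw f g l n :
    GRing.monoid_morphism f -> GRing.monoid_morphism g -> commuting f g ->
  tconv f g (D l) * (f ** g) (P n) = (f ** g) (P n) * tconv f g (D l).
Proof.
move=> fM gM fg; have [_ tM] := tconv_monoid fM gM fg.
by rewrite -!tM dynR_zero_weight.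
Qed.

Lemma J_leg_zw f g l n :
    GRing.monoid_morphism f -> GRing.monoid_morphism g -> commuting f g ->
  tconv f g (J l) * (f ** g) (P n) = (f ** g) (P n) * tconv f g (J l).
Proof.
move=> fM gM fg; have [_ tM] := tconv_monoid fM gM fg.
by rewrite -!tM (twist_zero_weight JH).
Qed.

(** The right hexagon for the dynamical R-matrix.  Multiplied on the left by
    (id (x) Delta)(J_21), both sides become R_13 R_12 (id (x) Delta)(J) J_23:
    the cocycle identity is used for the orders (g, h, f), (g, f, h) and
    (f, g, h) of the legs, and R braids the coproducts in between. *)
Lemma dynR_hexr f g h l n : legs3 f g h ->
  tconv f (g ** h) (D l) * tconv g h (J l) * h (P n) =
  (\sum_m tconv g h (J (l + m)) * f (P m)) *
  (tconv f h (D l) * tconv f g (D (l + n)) * h (P n)).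
Proof.
move=> L; have [[fM gM hM] [fg fh gh]] := L.
have gf := commuting_sym fg; have hf := commuting_sym fh.
have hg := commuting_sym gh.
have L132 : legs3 f h g by split; split.
have ghM := conv_monoid cH gM hM gh.
have gh_f : commuting (g ** h) f by apply: conv_commuting.
apply: (monoid_lcancel (tconv_monoid ghM fM gh_f) (twist_unit JH l)).
have f12_h : GRing.comm (tconv f g (D (l + n))) (h (P n)).
  exact: tconv_commuting.
transitivity (tconv f h R * tconv (g ** f) h (J l) *
              (tconv f g R * tconv f g (J (l + n))) * h (P n)).
  rewrite !mulrA (dynR_leg l fM ghM (commuting_sym gh_f)) leg_hexr //.
  rewrite -[LHS]mulrA -[_ * _ * tconv f (g ** h) _]mulrA -[LHS]mulrA -[X in _ * X]mulrA.
  rewrite [tconv f (g ** h) _ * _]mulrA -leg_cocycle_idem // !mulrA.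
  by rewrite -[tconv f h R * _ * _]mulrA leg_braidl // !mulrA.
rewrite [RHS]mulrA leg_cocycle // -(dynR_leg _ fM gM fg).
rewrite !mulrA -[_ * tconv f h (D _)]mulrA (dynR_leg l fM hM fh) !mulrA.
rewrite -(leg_braidr _ L132) -!mulrA; congr (_ * _).
by rewrite f12_h !mulrA -leg_cocycle_idem // -!mulrA.
Qed.

(** Dynamical shifts by one leg multiply termwise, the idempotents being
    orthogonal. *)
Lemma weighted_sumM g (x y : T -> W) :
    GRing.monoid_morphism g -> (forall m n, GRing.comm (y m) (g (P n))) ->
  (\sum_m x m * g (P m)) * (\sum_m y m * g (P m)) = \sum_m x m * y m * g (P m).
Proof.
move=> gM yg; rewrite mulr_sumr; apply: eq_bigr => m _.
by rewrite yg mulrA weighted_sum_idem // -!mulrA yg.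
Qed.

(** Multiplied on the left by the coproduct (Delta (x) id)(J_21), both sides become
    R_13 R_23 (Delta (x) id)(J) J_12(l + h_3); the cocycle identity is used for the
    orders (h, f, g), (f, h, g) and (f, g, h) of the legs. *)
Lemma dynR_hexl f g h l : legs3 f g h ->
  tconv (f ** g) h (D l) * (\sum_n tconv f g (J (l + n)) * h (P n)) =
  tconv f g (J l) * ((\sum_m tconv f h (D (l + m)) * g (P m)) *
  tconv g h (D l)).
Proof.
move=> L; have [[fM gM hM] [fg fh gh]] := L.
have gf := commuting_sym fg; have hf := commuting_sym fh.
have hg := commuting_sym gh.
have L132 : legs3 f h g by split; split.
have L312 := legs3_rot (legs3_rot L).
have fgM := conv_monoid cH fM gM fg.
have fg_h : commuting (f ** g) h by apply: conv_commuting.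
have h_fg := commuting_sym fg_h.
apply: (monoid_lcancel (tconv_monoid hM fgM h_fg) (twist_unit JH l)).
have fhg y m n : GRing.comm (tconv f h (y m)) (g (P n)).
  exact: tconv_commuting.
transitivity (tconv f h R * tconv f (h ** g) (J l) * tconv g h R * tconv g h (J l)).
  rewrite mulrA (dynR_leg l fgM hM fg_h) leg_hexl // -mulrA leg_cocycle //.
  rewrite -!mulrA; congr (_ * _); rewrite !mulrA.
  by rewrite (leg_braidr _ (legs3_rot L)).
rewrite [RHS]mulrA -(leg_cocycle _ L312) -!mulrA [X in _ = _ * X]mulrA.
rewrite weighted_sumM; [|by []|by move=> m n; apply: fhg].
have -> : \sum_m tconv h f (J (l + m)) * tconv f h (D (l + m)) * g (P m) =
    tconv f h R * \sum_m tconv f h (J (l + m)) * g (P m).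
  rewrite mulr_sumr; apply: eq_bigr => m _.
  by rewrite (dynR_leg _ fM hM fh) mulrA.
rewrite -!mulrA [in RHS]mulrA -(leg_braidl _ L132) -!mulrA; congr (_ * _).
rewrite [in RHS]mulrA leg_cocycle // -!mulrA; congr (_ * _).
by rewrite (dynR_leg _ gM hM gh).
Qed.

End Legs.
End DynamicalYangBaxter.

(** * The counit on R-matrices, and matrix units *)

Section CounitOfRMatrix.
Variables (k : fieldType) (T : finZmodType) (U W : falgType k).
Variables (c : hopfData U) (R : tens U U) (iota : {linear Map k T -> U}).
Variables (J D : T -> tens U U).
Hypotheses (cH : is_hopf c) (RH : is_quasitriangular c R).
Hypothesis JH : is_dynamical_twist c iota J.
Hypothesis DE : forall l, tswap (J l) * D l = R * J l.
Local Notation eps := (conv_one W c).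

(** The counit followed by the unit is a homomorphism commuting with everything:
    it can serve as a leg, which is how the counit is applied to a tensor factor. *)
Lemma conv_one_monoid (V : falgType k) : GRing.monoid_morphism (conv_one V c).
Proof.
split=> [|x y]; first by rewrite /conv_one hopf_counit1 // scale1r.
by rewrite /conv_one hopf_counitM // -scalerAl mul1r scalerA.
Qed.

Lemma conv_one_commuting (V : falgType k) (X : Type) (h : X -> V) :
  commuting (conv_one V c) h.
Proof.
by move=> x y; rewrite /conv_one /GRing.comm -scalerAl -scalerAr mulr1 mul1r.
Qed.

Lemma tconv_counitl (V : falgType k) (h : {linear U -> V}) x :
  tconv (conv_one V c) h x = h (slicel (counit c) x).
Proof.
rewrite /slicel linear_tlift; apply: eq_tlift => u v.
by rewrite linearZ /= /conv_one -scalerAl mul1r.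
Qed.

Lemma tconv_counitr (V : falgType k) (h : {linear U -> V}) x :
  tconv h (conv_one V c) x = h (slicer (counit c) x).
Proof.
rewrite /slicer linear_tlift; apply: eq_tlift => u v.
by rewrite linearZ /= /conv_one -scalerAr mulr1.
Qed.

(** In the hexagon with the counit as first leg, R = (1 (x) r) R with r the slice. *)
Lemma slicel_rmx : slicel (counit c) R = 1.
Proof.
pose inl := @inl_tens k U U : {linear _ -> _}; pose inr := @inr_tens k U U : {linear _ -> _}.
have L : legs3 (conv_one (tens U U) c) inl inr.
  split; split; [exact: conv_one_monoid|exact: inl_tens_monoid|exact: inr_tens_monoid| | |].
  - exact: conv_one_commuting.
  - exact: conv_one_commuting.
  - exact: inl_inr_comm.
have E : tconv (conv c (conv_one (tens U U) c) inl) inr R = R.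
  by rewrite -[RHS]tconv_inl_inr; apply: eq_tlift => u v; rewrite (conv1l cH).
have := leg_hexl RH L; rewrite E tconv_counitl tconv_inl_inr => RR.
have i1 : inr (slicel (counit c) R) = 1.
  by apply: (mulIr (rmx_unit RH)); rewrite -RR mul1r.
have := congr1 (slicel (counit c)) i1; rewrite tens1E /inr /= /inr_tens !slicelE.
by rewrite hopf_counit1 // !scale1r.
Qed.

Lemma slicer_rmx : slicer (counit c) R = 1.
Proof.
pose inl := @inl_tens k U U : {linear _ -> _}; pose inr := @inr_tens k U U : {linear _ -> _}.
have L : legs3 inl inr (conv_one (tens U U) c).
  split; split; [exact: inl_tens_monoid|exact: inr_tens_monoid|exact: conv_one_monoid| | |].
  - exact: inl_inr_comm.
  - by apply: commuting_sym; apply: conv_one_commuting.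
  - by apply: commuting_sym; apply: conv_one_commuting.
have E : tconv inl (conv c inr (conv_one (tens U U) c)) R = R.
  by rewrite -[RHS]tconv_inl_inr; apply: eq_tlift => u v; rewrite (conv1r cH).
have := leg_hexr RH L; rewrite E tconv_counitr tconv_inl_inr => RR.
have i1 : inl (slicer (counit c) R) = 1.
  by apply: (mulIr (rmx_unit RH)); rewrite -RR mul1r.
have := congr1 (slicer (counit c)) i1; rewrite tens1E /inl /= /inl_tens !slicerE.
by rewrite hopf_counit1 // !scale1r.
Qed.

Lemma dynR_counitl (h : {linear U -> W}) l : GRing.monoid_morphism h ->
  tconv eps h (D l) = 1.
Proof.
move=> hM.
have := dynR_leg DE l (conv_one_monoid W) hM (conv_one_commuting h).
rewrite tconv_counitr (twist_counitr JH) !tconv_counitl slicel_rmx (twist_counitl JH).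
by rewrite hM.1 !mul1r.
Qed.

Lemma dynR_counitr (h : {linear U -> W}) l : GRing.monoid_morphism h ->
  tconv h eps (D l) = 1.
Proof.
move=> hM.
have := dynR_leg DE l hM (conv_one_monoid W) (commuting_sym (conv_one_commuting h)).
rewrite tconv_counitl (twist_counitl JH) !tconv_counitr slicer_rmx (twist_counitr JH).
by rewrite hM.1 !mul1r.
Qed.

End CounitOfRMatrix.

Section MatrixUnits.
Variables (k : fieldType) (T : finZmodType).

Lemma row_of_inj : injective (@row_of T).
Proof.
have cT : #|T|.-1.+1 = #|T| by rewrite prednK //; apply/card_gt0P; exists 0.
have v (l : T) : row_of l = enum_rank l :> nat by rewrite inordK // cT.
by move=> l m /(congr1 val); rewrite /= !v => /val_inj /enum_rank_inj.
Qed.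

Lemma row_of_surj i : exists l, i = @row_of T l.
Proof.
have cT : #|T|.-1.+1 = #|T| by rewrite prednK //; apply/card_gt0P; exists 0.
exists (enum_val (cast_ord cT i)); apply: val_inj.
by rewrite /= inordK enum_valK //=.
Qed.

Lemma sum_row_of (V : nmodType) (F : 'I_(#|T|.-1.+1) -> V) :
  \sum_i F i = \sum_(l : T) F (row_of l).
Proof.
rewrite (reindex (@row_of T)) //.
have /fin_all_exists [g gK] := row_of_surj.
by exists g => [l _|i _]; [apply: row_of_inj; rewrite -gK | rewrite -gK].
Qed.

Lemma munitE (l m a b : T) :
  munit k l m (row_of a) (row_of b) = ((a == l) && (b == m))%:R.
Proof. by rewrite mxE !(inj_eq row_of_inj). Qed.

Lemma munitM (l m m' n : T) :
  munit k l m * munit k m' n = if m == m' then munit k l n else 0 :> EndMap k T.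
Proof.
rewrite /munit -[_ * _]/(delta_mx _ _ *m delta_mx _ _).
by case: eqP => [->|/eqP mm']; [rewrite mul_delta_mx
    | rewrite mul_delta_mx_0 // (inj_eq row_of_inj)].
Qed.

Lemma sum_munit : \sum_(l : T) munit k l l = 1 :> EndMap k T.
Proof.
apply/matrixP=> i j; have [a ->] := row_of_surj i; have [b ->] := row_of_surj j.
rewrite summxE (bigD1 a) //= munitE eqxx big1 ?addr0 => [|l /negPf la].
  by rewrite -[RHS]/((1%:M : 'M[k]_(#|T|.-1.+1)) _ _) mxE (inj_eq row_of_inj) eq_sym.
by rewrite munitE eq_sym la.
Qed.

Lemma EndMap_span (M : EndMap k T) :
  M = \sum_l \sum_m M (row_of l) (row_of m) *: munit k l m.
Proof.
by rewrite {1}[M]matrix_sum_delta sum_row_of; apply: eq_bigr => l _; rewrite sum_row_of.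
Qed.

Lemma end_comul_munit (l m : T) : end_comul (munit k l m) = munit k l m \ox munit k l m.
Proof.
rewrite /end_comul (bigD1 l) //= (bigD1 m) //= munitE !eqxx scale1r.
rewrite big1 ?addr0 => [|b /negPf bm]; last by rewrite munitE bm andbF scale0r.
rewrite big1 ?addr0 // => a /negPf al; rewrite big1 // => b _.
by rewrite munitE al scale0r.
Qed.

Lemma end_counit_munit (l m : T) : end_counit (munit k l m) = 1.
Proof.
rewrite /end_counit (bigD1 l) //= (bigD1 m) //= munitE !eqxx.
rewrite big1 ?addr0 => [|b /negPf bm]; last by rewrite munitE bm andbF.
rewrite big1 ?addr0 // => a /negPf al; rewrite big1 // => b _.
by rewrite munitE al.
Qed.

Lemma end_antipode_munit (l m : T) : end_antipode (munit k l m) = munit k m l.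
Proof. exact: trmx_delta. Qed.

End MatrixUnits.

(** * Generators of the weak Hopf algebra *)

(** A leg F of End(A) (x) U is determined by the images of the matrix units and of
    U, which commute with each other. *)
HB.lock Definition eleg (k : fieldType) (T : finZmodType) (U W : falgType k)
  (F : dynH T U -> W) (l m : T) : W := F (munit k l m \ox (1 : U) : dynH T U).
HB.lock Definition uleg (k : fieldType) (T : finZmodType) (U W : falgType k)
  (F : dynH T U -> W) (u : U) : W := F ((1 : EndMap k T) \ox u : dynH T U).
Arguments eleg {k T U W}.
Arguments uleg {k T U W}.

Section MatrixLegs.
Variables (k : fieldType) (T : finZmodType) (U W : falgType k).
Local Notation H := (dynH T U).
Local Notation E l m u := (munit k l m \ox (u : U) : H).

Lemma dynH_ind (p : H -> Prop) :
    (forall a x y, p x -> p y -> p (a *: x + y)) ->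
  (forall l m u, p (E l m u)) -> forall x, p x.
Proof.
move=> pZD pE; apply: tensor_ind => // M u.
have p0 : p 0.
  by rewrite -(addNr (E 0 0 0)) -scaleN1r; apply: pZD.
rewrite (EndMap_span M).
have pS (I : finType) (x : I -> EndMap k T) (a : I -> k) :
    (forall i, p (x i \ox u)) -> p ((\sum_i a i *: x i) \ox u).
  move=> px; elim/big_ind: _ => [|y z py pz|i _].
  - rewrite (_ : 0 \ox u = 0) //.
    by apply/matrixP=> i j; rewrite !mxE linear0 mul0r.
  - by rewrite -[y]scale1r tpurePl; apply: pZD.
  - by rewrite -[a i *: x i]addr0 tpurePl; apply: pZD => //;
      rewrite (_ : 0 \ox u = 0) //; apply/matrixP=> ? ?; rewrite !mxE linear0 mul0r.
rewrite (eq_bigr (fun l => 1 *: \sum_m M (row_of l) (row_of m) *: munit k l m)).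
  by apply: (pS) => l; apply: (pS) => m.
by move=> l _; rewrite scale1r.
Qed.

Lemma munit_tpureM l m m' n u v :
  E l m u * E m' n v = if m == m' then E l n (u * v) else 0 :> H.
Proof.
rewrite -[LHS]/((munit k l m \ox u : tens (EndMap k T) U) * (munit k m' n \ox v)).
rewrite tpureM munitM; case: ifP => // _.
by apply/matrixP=> ? ?; rewrite !mxE linear0 mul0r.
Qed.

Lemma one_dynH : 1 = \sum_l E l l 1 :> H.
Proof.
transitivity ((\sum_l munit k l l) \ox (1 : U) : tens (EndMap k T) U).
  by rewrite sum_munit.
exact: (linear_sum (inl_tens U : {linear EndMap k T -> _})).
Qed.

Variables (F : {linear H -> W}).
Hypothesis FM : GRing.monoid_morphism F.

Fact uleg_linear (G : {linear H -> W}) : linear (uleg G).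
Proof. by move=> a u v; rewrite uleg.unlock tpurePr linearP. Qed.
HB.instance Definition _ (G : {linear H -> W}) :=
  GRing.isLinear.Build k U W *:%R (uleg G) (uleg_linear G).

Lemma uleg_monoid : GRing.monoid_morphism (uleg F).
Proof.
split; first by rewrite uleg.unlock; exact: FM.1.
move=> x y; rewrite uleg.unlock -FM.2.
rewrite -[X in _ = F X]/((1 \ox x : tens (EndMap k T) U) * (1 \ox y)).
by rewrite tpureM mulr1.
Qed.

Lemma elegM l m m' n : eleg F l m * eleg F m' n = if m == m' then eleg F l n else 0.
Proof. by rewrite eleg.unlock -FM.2 munit_tpureM mulr1; case: ifP => // _; rewrite linear0. Qed.

Lemma legE l m u : F (E l m u) = eleg F l m * uleg F u.
Proof.
rewrite eleg.unlock uleg.unlock -FM.2; congr (F _).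
rewrite -[RHS]/((munit k l m \ox 1 : tens (EndMap k T) U) * (1 \ox u)).
by rewrite tpureM mul1r mulr1.
Qed.

Lemma eleg_uleg l m u : GRing.comm (eleg F l m) (uleg F u).
Proof.
rewrite /GRing.comm eleg.unlock uleg.unlock -!FM.2; congr (F _).
rewrite -[LHS]/((munit k l m \ox 1 : tens (EndMap k T) U) * (1 \ox u)).
rewrite -[RHS]/((1 \ox u : tens (EndMap k T) U) * (munit k l m \ox 1)).
by rewrite !tpureM !mul1r !mulr1.
Qed.

End MatrixLegs.

Section TwistedCoproduct.
Variables (k : fieldType) (T : finZmodType) (U W : falgType k).
Variables (c : hopfData U) (iota : {linear Map k T -> U}) (J : T -> tens U U).
Hypothesis cH : is_hopf c.
Local Notation P := (idem iota).
Local Notation H := (dynH T U).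
Local Notation E l m u := (munit k l m \ox (u : U) : H).

Lemma comul_dynH l m u : comul (dynH_hopf T c) (E l m u) =
  tlift (fun u1 u2 => E l m u1 \ox E l m u2) (comul c u).
Proof.
rewrite /= /tens_comul tlift_tpure => [|v|M] /=; first 1 last.
- by move=> a M N; rewrite !linearP.
- move=> a x y; rewrite -tlift_lin; apply: eq_tlift => a1 a2.
  by rewrite !linearP.
rewrite end_comul_munit tlift_tpure // => [M|M] a x y; rewrite -tlift_lin.
  by apply: eq_tlift => u1 u2; rewrite !tpurePl.
by apply: eq_tlift => u1 u2; rewrite tpurePl tpurePr.
Qed.

Lemma counit_dynH l m u : counit (dynH_hopf T c) (E l m u) = counit c u.
Proof.
rewrite /= /tens_counit tlift_tpure => [|v|M] /=; first 1 last.
- by move=> a M N; rewrite !linearP /= mulrDl; congr (_ + _); apply/esym/mulrA.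
- by move=> a x y; rewrite !linearP /= mulrDr; congr (_ + _); apply: mulrCA.
by rewrite end_counit_munit mul1r.
Qed.

Lemma antipode_dynH l m u : antipode (dynH_hopf T c) (E l m u) = E m l (antipode c u).
Proof.
rewrite /= -[LHS]/(tmap (antipode (end_hopf k T)) (antipode c) (munit k l m \ox u)).
by rewrite tmapE /= end_antipode_munit.
Qed.

(** Indexing by the second matrix index s = l + m instead of the weight m makes
    products of such sums collapse without reindexing. *)
Lemma dynF_map (V : vectType k) (L : {linear tens H H -> V}) :
  L (dynF iota J) = \sum_l \sum_s
    tlift (fun a b => L (E l s a \ox E l l (b * P (s - l)))) (J l).
Proof.
rewrite /dynF linear_sum; apply: eq_bigr => l _.
rewrite linear_sum (reindex_inj (addIr (- l))); apply: eq_bigr => s _ /=.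
by rewrite addrCA subrr addr0 linear_tlift.
Qed.

Lemma dynFbar_map (V : vectType k) (L : {linear tens H H -> V}) :
  L (dynFbar iota J) = \sum_l \sum_s
    tlift (fun a b => L (E s l a \ox E l l (P (s - l) * b))) (J l)^-1.
Proof.
rewrite /dynFbar linear_sum; apply: eq_bigr => l _.
rewrite linear_sum (reindex_inj (addIr (- l))); apply: eq_bigr => s _ /=.
by rewrite addrCA subrr addr0 linear_tlift.
Qed.

Lemma rmatrix_map R (D : T -> tens U U) (V : vectType k) (L : {linear tens H H -> V}) :
    (forall l, dynR J R l = D l) ->
  L (dyn_rmatrix iota J R) = \sum_l \sum_b \sum_a
    tlift (fun x y => L (E l a (P (b - l) * x) \ox E b l (y * P (a - l)))) (D l).
Proof.
move=> DE; rewrite /dyn_rmatrix linear_sum; apply: eq_bigr => l _.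
rewrite DE linear_sum (reindex_inj (addIr (- l))); apply: eq_bigr => b _ /=.
rewrite linear_sum (reindex_inj (addIr (- l))); apply: eq_bigr => a _ /=.
by rewrite addrCA subrr addr0 [l + _]addrC subrK linear_tlift.
Qed.

Variables F G : {linear H -> W}.
Hypotheses (FM : GRing.monoid_morphism F) (GM : GRing.monoid_morphism G).
Hypothesis FG : commuting F G.
Local Notation f := (uleg F).
Local Notation g := (uleg G).

Let fM := uleg_monoid FM.
Let gM := uleg_monoid GM.
Let fg : commuting f g. Proof. by move=> x y; rewrite uleg.unlock; apply: FG. Qed.

Lemma tconv_EE l m l' m' (f' g' : {linear U -> U}) x :
  tconv F G (tlift (fun a b => E l m (f' a) \ox E l' m' (g' b)) x) =
  eleg F l m * eleg G l' m' * tconv (f \o f') (g \o g') x.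
Proof.
rewrite linear_tlift.
rewrite -[RHS]/(GRing.mull_fun (eleg F l m * eleg G l' m') idfun _) linear_tlift.
apply: eq_tlift => a b; rewrite /= tconvE !legE //.
rewrite -!mulrA; congr (_ * _); rewrite !mulrA; congr (_ * _).
by rewrite eleg.unlock uleg.unlock; apply: FG.
Qed.

Lemma dynF_leg : tconv F G (dynF iota J) =
  \sum_l \sum_s eleg F l s * eleg G l l * (tconv f g (J l) * g (P (s - l))).
Proof.
rewrite /dynF linear_sum; apply: eq_bigr => l _.
rewrite linear_sum (reindex_inj (addIr (- l))); apply: eq_bigr => s _ /=.
rewrite (tconv_EE _ _ _ _ idfun (GRing.mulr_fun (P (s - l)) idfun)).
rewrite addrCA subrr addr0; congr (_ * _).
rewrite -[RHS]/(GRing.mulr_fun (g (P (s - l))) idfun _) linear_tlift.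
by apply: eq_tlift => a b /=; rewrite gM.2 mulrA.
Qed.

Lemma dynFbar_leg : tconv F G (dynFbar iota J) =
  \sum_l \sum_s eleg F s l * eleg G l l * (g (P (s - l)) * tconv f g (J l)^-1).
Proof.
rewrite /dynFbar linear_sum; apply: eq_bigr => l _.
rewrite linear_sum (reindex_inj (addIr (- l))); apply: eq_bigr => s _ /=.
rewrite (tconv_EE _ _ _ _ idfun (GRing.mull_fun (P (s - l)) idfun)).
rewrite addrCA subrr addr0; congr (_ * _).
rewrite -[RHS]/(GRing.mull_fun (g (P (s - l))) idfun _) linear_tlift.
by apply: eq_tlift => a b /=; rewrite gM.2 !mulrA fg.
Qed.

Lemma comul_leg l m u : tconv F G (comul (dynH_hopf T c) (E l m u)) =
  eleg F l m * eleg G l m * conv c f g u.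
Proof. by rewrite comul_dynH (tconv_EE _ _ _ _ idfun idfun). Qed.

Lemma rmatrix_leg R (D : T -> tens U U) : (forall l, dynR J R l = D l) ->
  tconv F G (dyn_rmatrix iota J R) =
  \sum_l \sum_b \sum_a eleg F l a * eleg G b l *
    (f (P (b - l)) * tconv f g (D l) * g (P (a - l))).
Proof.
move=> DE; rewrite /dyn_rmatrix linear_sum; apply: eq_bigr => l _.
rewrite DE linear_sum (reindex_inj (addIr (- l))); apply: eq_bigr => b _ /=.
rewrite linear_sum (reindex_inj (addIr (- l))); apply: eq_bigr => a _ /=.
rewrite (tconv_EE _ _ _ _ (GRing.mull_fun (P (b - l)) idfun)
  (GRing.mulr_fun (P (a - l)) idfun)).
rewrite addrCA subrr addr0 [l + _]addrC subrK; congr (_ * _).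
pose L : {linear W -> W} := GRing.mulr_fun (g (P (a - l)))
  (GRing.mull_fun (f (P (b - l))) idfun).
rewrite -[RHS]/(L _) /tconv linear_tlift.
by apply: eq_tlift => x y /=; rewrite gM.2 fM.2 !mulrA.
Qed.

End TwistedCoproduct.

(** * Weight components of the dynamical hexagons *)

Section WeightComponents.
Variables (k : fieldType) (T : finZmodType) (U W : falgType k).
Variables (c : hopfData U) (R : tens U U) (iota : {linear Map k T -> U}).
Variables (J D : T -> tens U U).
Hypotheses (cH : is_hopf c) (RH : is_quasitriangular c R).
Hypotheses (iotaH : is_hopf_embedding c iota).
Hypothesis JH : is_dynamical_twist c iota J.
Hypothesis DE : forall l, tswap (J l) * D l = R * J l.
Local Notation P := (idem iota).
Local Notation "f ** g" := (conv c f g) (at level 40).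
Implicit Types f g h : {linear U -> W}.

Lemma twist_legV f g l :
    GRing.monoid_morphism f -> GRing.monoid_morphism g -> commuting f g ->
  tconv f g (J l)^-1 * tconv f g (J l) = 1.
Proof.
by move=> fM gM fg; apply: monoid_mulV (twist_unit JH l); apply: tconv_monoid.
Qed.

Lemma twistV_leg_zw f g l n :
    GRing.monoid_morphism f -> GRing.monoid_morphism g -> commuting f g ->
  tconv f g (J l)^-1 * (f ** g) (P n) = (f ** g) (P n) * tconv f g (J l)^-1.
Proof.
move=> fM gM fg; have [_ tM] := tconv_monoid fM gM fg.
rewrite -!tM; congr (tconv f g _); apply: (mulrI (twist_unit JH l)).
rewrite mulVKr ?(twist_unit JH) // mulrA (twist_zero_weight JH).
by rewrite mulrK ?(twist_unit JH).
Qed.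

(** The weights move from the shifts J_23(l + h_1) and D_12(l + h_3) to the
    idempotents around them; the last step moves weight across D_13. *)
Lemma dynR_hexr_coef f g h x l a b d : legs3 f g h ->
  h (P (x - b)) * tconv g h (J b)^-1 * f (P (b - l)) *
    tconv f (g ** h) (D l) * (g ** h) (P (a - l)) * tconv g h (J l) * h (P (d - l)) =
  f (P (b - l)) * tconv f h (D l) * h (P (d - l)) *
    (f (P (x - d)) * tconv f g (D d) * g (P (a - d))).
Proof.
move=> L; have [[fM gM hM] [fg fh gh]] := L.
have hexr := dynR_hexr cH RH iotaH JH DE l (d - l) L.
have gh_f : commuting f (tconv g h).
  by apply: commuting_sym; apply: tconv_commuting; apply: commuting_sym.
rewrite -!mulrA [(g ** h) _ * _]mulrA -(J_leg_zw JH) // -!mulrA.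
have -> : (g ** h) (P (a - l)) * h (P (d - l)) = h (P (d - l)) * g (P (a - d)).
  rewrite (conv_idemC iotaH _ gh) (conv_idem_l iotaH) //; last exact: commuting_sym.
  by rewrite opprB addrA subrK.
rewrite [X in f _ * X]mulrA [X in f _ * X]mulrA hexr.
have fsum : f (P (b - l)) * (\sum_m tconv g h (J (l + m)) * f (P m)) =
    tconv g h (J b) * f (P (b - l)).
  rewrite mulr_sumr (bigD1 (b - l)) //= big1 ?addr0 => [|m mn].
    rewrite mulrA gh_f -mulrA (idem_leg_id iotaH) //.
    by rewrite addrC subrK.
  by rewrite mulrA gh_f -mulrA (idem_legM iotaH) // eq_sym (negPf mn) mulr0.
rewrite !mulrA -[_ * f _ * \sum_m _]mulrA fsum !mulrA.
rewrite -[_ * tconv g h _ * tconv g h _]mulrA twist_legV // mulr1.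
have d12h z w : GRing.comm (tconv f g z) (h w) by apply: tconv_commuting.
rewrite -fh -[_ * tconv f g _ * h _]mulrA d12h !mulrA; congr (_ * _ * _).
rewrite (weight_transfer (d := x - d) iotaH fM hM fh) //; last first.
- by rewrite addrC !subrKA.
- move=> n; exact: (dynR_leg_zw RH iotaH JH DE).
  by rewrite -!mulrA fh.
by rewrite [l + _]addrC subrK.
Qed.

(** As for the right hexagon, the last step moves weight across D_23. *)
Lemma dynR_hexl_coef f g h x l a b d : legs3 f g h ->
  g (P (x - l)) * tconv f g (J l)^-1 * (f ** g) (P (b - l)) *
    tconv (f ** g) h (D l) * h (P (a - l)) * tconv f g (J a) * g (P (d - a)) =
  f (P (b - x)) * tconv f h (D x) * h (P (d - x)) *
    (g (P (x - l)) * tconv g h (D l) * h (P (a - l))).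
Proof.
move=> L; have [[fM gM hM] [fg fh gh]] := L.
have gf := commuting_sym fg; have hg := commuting_sym gh.
have hexl := congr1 (fun z => z * h (P (a - l))) (dynR_hexl cH RH iotaH JH DE l L).
have fg_h z w : GRing.comm (tconv f g z) (h w) by apply: tconv_commuting.
have fh_g z w : GRing.comm (tconv f h z) (g w) by apply: tconv_commuting.
have -> : g (P (x - l)) * tconv f g (J l)^-1 * (f ** g) (P (b - l)) =
    f (P (b - x)) * g (P (x - l)) * tconv f g (J l)^-1.
  rewrite -mulrA twistV_leg_zw // mulrA (conv_idemC iotaH _ fg).
  by rewrite (idem_conv_l iotaH) // opprB addrA subrK gf.
rewrite -!mulrA [X in _ * (_ * (_ * (_ * X)))]mulrA -fg_h.
rewrite !mulrA.
move: hexl; rewrite -!mulrA (weighted_sum_idem iotaH) // [l + _]addrC subrK.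
rewrite !mulrA => hexl.
have -> z : z * tconv (f ** g) h (D l) * tconv f g (J a) * h (P (a - l)) =
    z * (tconv (f ** g) h (D l) * tconv f g (J a) * h (P (a - l))).
  by rewrite !mulrA.
rewrite hexl !mulrA -[_ * tconv f g _^-1 * _]mulrA twist_legV // mulr1.
have gsum : g (P (x - l)) * (\sum_m tconv f h (D (l + m)) * g (P m)) =
    tconv f h (D x) * g (P (x - l)).
  rewrite mulr_sumr (bigD1 (x - l)) //= big1 ?addr0 => [|m mn].
    rewrite mulrA -fh_g -mulrA (idem_leg_id iotaH) //.
    by rewrite addrC subrK.
  by rewrite mulrA -fh_g -mulrA (idem_legM iotaH) // eq_sym (negPf mn) mulr0.
rewrite -[_ * g _ * \sum_m _]mulrA gsum -!mulrA; congr (_ * (_ * _)).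
rewrite hg !mulrA hg (weight_transfer (d := d - a) iotaH gM hM gh) //.
  by move=> n; exact: (dynR_leg_zw RH iotaH JH DE).
by rewrite addrC !subrKA.
Qed.

End WeightComponents.

(** * The hexagons of the weak Hopf algebra *)

Section CommutingLegs.
Variables (k : fieldType) (T : finZmodType) (U W : falgType k).
Variables F G : dynH T U -> W.
Hypothesis FG : commuting F G.

Lemma eleg_commuting l m l' m' : GRing.comm (eleg F l m) (eleg G l' m').
Proof. by rewrite eleg.unlock; apply: FG. Qed.

Lemma eleg_uleg_commuting l m : commuting (fun _ : unit => eleg F l m) (uleg G).
Proof. by move=> _ u; rewrite eleg.unlock uleg.unlock; apply: FG. Qed.

Lemma uleg_commuting : commuting (uleg F) (uleg G).
Proof. by move=> x y; rewrite uleg.unlock; apply: FG. Qed.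

End CommutingLegs.

Section WeakHexagons.
Variables (k : fieldType) (T : finZmodType) (U W : falgType k).
Variables (c : hopfData U) (R : tens U U) (iota : {linear Map k T -> U}).
Variables (J D : T -> tens U U).
Hypotheses (cH : is_hopf c) (RH : is_quasitriangular c R).
Hypotheses (iotaH : is_hopf_embedding c iota).
Hypothesis JH : is_dynamical_twist c iota J.
Hypothesis DE : forall l, tswap (J l) * D l = R * J l.
Hypothesis dynRE : forall l, dynR J R l = D l.
Local Notation P := (idem iota).
Local Notation H := (dynH T U).
Local Notation E l m u := (munit k l m \ox (u : U) : H).
Local Notation HJ := (wcoalg (H_J c iota J)).
Local Notation Rm := (dyn_rmatrix iota J R).

Section TwoLegs.
Variables F G : {linear H -> W}.
Hypotheses (FM : GRing.monoid_morphism F) (GM : GRing.monoid_morphism G).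
Hypothesis FG : commuting F G.
Local Notation f := (uleg F).
Local Notation g := (uleg G).

Lemma elegl_comm_tconv l m x : GRing.comm (eleg F l m) (tconv f g x).
Proof.
apply/commr_sym; apply: (@tconv_commuting k U W U unit f g (fun=> eleg F l m) _ _ x tt).
  by move=> u _; apply/commr_sym/eleg_uleg.
by apply/commuting_sym/eleg_uleg_commuting.
Qed.

Lemma elegr_comm_tconv l m x : GRing.comm (eleg G l m) (tconv f g x).
Proof.
apply/commr_sym; apply: (@tconv_commuting k U W U unit f g (fun=> eleg G l m) _ _ x tt).
  by apply/commuting_sym/eleg_uleg_commuting/commuting_sym.
by move=> u _; apply/commr_sym/eleg_uleg.
Qed.

(** The twisted coproduct of a matrix unit times u: in its legs only the twist
    at the row and at the column index of the unit survives. *)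
Lemma dyn_comul_leg b l u : conv HJ F G (E b l u) =
  \sum_x \sum_d eleg F x d * eleg G b l *
   (g (P (x - b)) * tconv f g (J b)^-1 * conv c f g u * tconv f g (J l) * g (P (d - l))).
Proof.
have fM := uleg_monoid FM; have gM := uleg_monoid GM.
have fg : commuting f g by apply: uleg_commuting.
have eFG l1 m l' m' : GRing.comm (eleg F l1 m) (eleg G l' m') by apply: eleg_commuting.
have eFg l1 m u1 : GRing.comm (eleg F l1 m) (g u1).
  exact: (eleg_uleg_commuting FG l1 m tt).
have eGg l1 m u1 : GRing.comm (eleg G l1 m) (g u1) by apply: eleg_uleg.
have tM := tconv_monoid FM GM FG.
have tM3 x y z : tconv F G (x * y * z) = tconv F G x * tconv F G y * tconv F G z.
  by rewrite !tM.2.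
transitivity (tconv F G (dynFbar iota J) *
  tconv F G (comul (dynH_hopf T c) (E b l u)) * tconv F G (dynF iota J)).
  exact: tM3.
rewrite comul_leg // dynF_leg // dynFbar_leg //.
have -> : (\sum_y \sum_s eleg F s y * eleg G y y *
      (g (P (s - y)) * tconv f g (J y)^-1)) * (eleg F b l * eleg G b l * conv c f g u)
    = \sum_x eleg F x l * eleg G b l *
        (g (P (x - b)) * tconv f g (J b)^-1 * conv c f g u).
  rewrite mulr_suml (bigD1 b) //= [X in _ + X]big1 ?addr0 => [|y yb].
    rewrite mulr_suml; apply: eq_bigr => s _; rewrite mulr_reorder; first 1 last.
    - exact: eFG.
    - by apply: commrM; [apply: eFg|apply: elegl_comm_tconv].
    - by apply: commrM; [apply: eGg|apply: elegr_comm_tconv].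
    by rewrite !elegM // eqxx.
  rewrite mulr_suml big1 // => s _; rewrite mulr_reorder; first 1 last.
  - exact: eFG.
  - by apply: commrM; [apply: eFg|apply: elegl_comm_tconv].
  - by apply: commrM; [apply: eGg|apply: elegr_comm_tconv].
  by rewrite !elegM // (negPf yb) !mul0r.
rewrite mulr_suml; apply: eq_bigr => x _.
have zE l1 m : GRing.comm (eleg F l1 m)
    (g (P (x - b)) * tconv f g (J b)^-1 * conv c f g u).
  by apply: commrM; [apply: commrM; [apply: eFg|]|]; apply: elegl_comm_tconv.
have zE' l1 m : GRing.comm (eleg G l1 m)
    (g (P (x - b)) * tconv f g (J b)^-1 * conv c f g u).
  by apply: commrM; [apply: commrM; [apply: eGg|]|]; apply: elegr_comm_tconv.
rewrite mulr_sumr (bigD1 l) //= [X in _ + X]big1 ?addr0 => [|y yl].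
  rewrite mulr_sumr; apply: eq_bigr => d _; rewrite mulr_reorder; first 1 last.
  - exact: eFG.
  - exact: zE.
  - exact: zE'.
  by rewrite !elegM // eqxx !mulrA.
rewrite mulr_sumr big1 // => d _; rewrite mulr_reorder; first 1 last.
- exact: eFG.
- exact: zE.
- exact: zE'.
by rewrite !elegM // eq_sym (negPf yl) !mul0r.
Qed.

End TwoLegs.

Lemma rmatrix_tconv (F G : {linear H -> W}) : tconv F G Rm =
  \sum_l \sum_b \sum_a tlift (fun x y => F (E l a (P (b - l) * x)) *
     G (E b l (y * P (a - l)))) (D l).
Proof.
rewrite /dyn_rmatrix linear_sum; apply: eq_bigr => l _; rewrite dynRE.
rewrite linear_sum (reindex_inj (addIr (- l))); apply: eq_bigr => b _ /=.
rewrite linear_sum (reindex_inj (addIr (- l))); apply: eq_bigr => a _ /=.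
rewrite addrCA subrr addr0 [l + _]addrC subrK linear_tlift.
by apply: eq_tlift => x y; rewrite /= tconvE.
Qed.

Section ThreeLegs.
Variables F1 F2 F3 : {linear H -> W}.
Hypotheses (FM1 : GRing.monoid_morphism F1) (FM2 : GRing.monoid_morphism F2).
Hypotheses (FM3 : GRing.monoid_morphism F3).
Hypotheses (F12 : commuting F1 F2) (F13 : commuting F1 F3) (F23 : commuting F2 F3).
Local Notation u1 := (uleg F1).
Local Notation u2 := (uleg F2).
Local Notation u3 := (uleg F3).

Let L : legs3 u1 u2 u3.
Proof. by split; split; try exact: uleg_monoid; apply: uleg_commuting. Qed.

(** Expanded in matrix units, both sides are sums over the same five indices, and
    the coefficients agree by the weight components of the dynamical hexagon. *)
Lemma dyn_hexr : tconv F1 (conv HJ F2 F3) Rm = tconv F1 F3 Rm * tconv F1 F2 Rm.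
Proof.
have [[M1 M2 M3] [c12 c13 c23]] := L.
rewrite (rmatrix_leg iota FM1 FM3 F13 dynRE) (rmatrix_leg iota FM1 FM2 F12 dynRE) rmatrix_tconv.
transitivity (\sum_l \sum_b \sum_a \sum_x \sum_d
   eleg F1 l a * (eleg F3 b l * eleg F2 x d) *
   (u1 (P (b - l)) * tconv u1 u3 (D l) * u3 (P (d - l)) *
   (u1 (P (x - d)) * tconv u1 u2 (D d) * u2 (P (a - d))))).
  apply: eq_bigr => l _; apply: eq_bigr => b _; apply: eq_bigr => a _.
  rewrite (eq_tlift (b' := fun y z => \sum_x \sum_d
     F1 (E l a (P (b - l) * y)) * (eleg F2 x d * eleg F3 b l *
     (u3 (P (x - b)) * tconv u2 u3 (J b)^-1 * conv c u2 u3 (z * P (a - l)) *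
      tconv u2 u3 (J l) * u3 (P (d - l)))))); last first.
    move=> y z.
    transitivity (F1 (E l a (P (b - l) * y)) * conv HJ F2 F3 (E b l (z * P (a - l)))) => //.
    rewrite (dyn_comul_leg FM2 FM3 F23) mulr_sumr; apply: eq_bigr => x _.
    by rewrite mulr_sumr.
  rewrite tlift_sum; apply: eq_bigr => x _.
  rewrite tlift_sum; apply: eq_bigr => d _.
  rewrite -(dynR_hexr_coef cH RH iotaH JH DE x l a b d L).
  pose K : {linear W -> W} := GRing.mull_fun (eleg F1 l a * (eleg F3 b l * eleg F2 x d)
     * (u3 (P (x - b)) * tconv u2 u3 (J b)^-1 * u1 (P (b - l))))
     (GRing.mulr_fun (conv c u2 u3 (P (a - l)) * tconv u2 u3 (J l) * u3 (P (d - l))) idfun).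
  transitivity (K (tconv u1 (conv c u2 u3) (D l))); last by rewrite /K /= !mulrA.
  rewrite -[tconv u1 _ (D l)]/(tlift (fun y z => u1 y * conv c u2 u3 z) (D l)).
  rewrite linear_tlift; apply: eq_tlift => y z; rewrite /K /= legE //.
  have [_ m23] := conv_monoid cH M2 M3 c23; have [_ m1] := M1.
  have e23 : eleg F2 x d * eleg F3 b l = eleg F3 b l * eleg F2 x d by apply: eleg_commuting.
  have u1C z' : GRing.comm (u1 z') (eleg F3 b l * eleg F2 x d *
       (u3 (P (x - b)) * tconv u2 u3 (J b)^-1)).
    apply: commrM; apply: commrM.
    - exact/commr_sym/(eleg_uleg_commuting (commuting_sym F13) _ _ tt).
    - exact/commr_sym/(eleg_uleg_commuting (commuting_sym F12) _ _ tt).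
    - exact: c13.
    - by apply/commr_sym; apply: tconv_commuting; apply: commuting_sym.
  rewrite e23 -!mulrA; congr (_ * _); move: (u1C (P (b - l) * y)).
  by rewrite /GRing.comm !mulrA => ->; rewrite m1 m23 !mulrA.
rewrite mulr_suml; apply: eq_bigr => l _; rewrite mulr_suml; apply: eq_bigr => b _.
rewrite [LHS]exchange_big3 mulr_suml; apply: eq_bigr => d _.
have Yc i j : GRing.comm (eleg F1 i j) (u1 (P (b - l)) * tconv u1 u3 (D l) * u3 (P (d - l))).
  apply: commrM; [apply: commrM|]; [exact: eleg_uleg|exact: elegl_comm_tconv|].
  exact: (eleg_uleg_commuting F13 _ _ tt).
have Yc' i j : GRing.comm (eleg F2 i j) (u1 (P (b - l)) * tconv u1 u3 (D l) * u3 (P (d - l))).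
  apply: commrM; [apply: commrM|].
  - exact: (eleg_uleg_commuting (commuting_sym F12) _ _ tt).
  - apply/commr_sym; apply: (@tconv_commuting k U W U unit u1 u3 (fun=> eleg F2 i j) _ _ _ tt).
      exact/commuting_sym/eleg_uleg_commuting/commuting_sym.
    exact/commuting_sym/eleg_uleg_commuting.
  - exact: (eleg_uleg_commuting F23 _ _ tt).
rewrite [RHS]mulr_sumr [RHS](bigD1 d) //= [X in _ = _ + X]big1 ?addr0 => [|d' d'd].
  rewrite [RHS]mulr_sumr; apply: eq_bigr => x _; rewrite [RHS]mulr_sumr; apply: eq_bigr => a _.
  rewrite [RHS]mulr_reorder; [|exact: (eleg_commuting F13)|exact: Yc|exact: Yc'].
  by rewrite elegM // eqxx.
rewrite [LHS]mulr_sumr big1 // => x _; rewrite [LHS]mulr_sumr big1 // => a _.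
rewrite [LHS]mulr_reorder; [|exact: (eleg_commuting F13)|exact: Yc|exact: Yc'].
by rewrite elegM // eq_sym (negPf d'd) !mul0r.
Qed.

(** Again both sides are sums over five indices, with coefficients compared by the
    weight components of the dynamical hexagon; only the order of summation differs. *)
Lemma dyn_hexl : tconv (conv HJ F1 F2) F3 Rm = tconv F1 F3 Rm * tconv F2 F3 Rm.
Proof.
have [[M1 M2 M3] [c12 c13 c23]] := L.
rewrite (rmatrix_leg iota FM1 FM3 F13 dynRE) (rmatrix_leg iota FM2 FM3 F23 dynRE).
rewrite rmatrix_tconv.
transitivity (\sum_l \sum_b \sum_a \sum_x \sum_d
   eleg F1 x d * eleg F2 l a * eleg F3 b l *
   (u1 (P (b - x)) * tconv u1 u3 (D x) * u3 (P (d - x)) *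
   (u2 (P (x - l)) * tconv u2 u3 (D l) * u3 (P (a - l))))).
  apply: eq_bigr => l _; apply: eq_bigr => b _; apply: eq_bigr => a _.
  rewrite (eq_tlift (b' := fun y z => \sum_x \sum_d
     eleg F1 x d * eleg F2 l a *
     (u2 (P (x - l)) * tconv u1 u2 (J l)^-1 * conv c u1 u2 (P (b - l) * y) *
      tconv u1 u2 (J a) * u2 (P (d - a))) * F3 (E b l (z * P (a - l))))); last first.
    move=> y z.
    transitivity (conv HJ F1 F2 (E l a (P (b - l) * y)) * F3 (E b l (z * P (a - l)))) => //.
    rewrite (dyn_comul_leg FM1 FM2 F12) mulr_suml; apply: eq_bigr => x _.
    by rewrite mulr_suml.
  rewrite tlift_sum; apply: eq_bigr => x _.
  rewrite tlift_sum; apply: eq_bigr => d _.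
  rewrite -(dynR_hexl_coef cH RH iotaH JH DE x l a b d L).
  pose K : {linear W -> W} := GRing.mull_fun (eleg F1 x d * eleg F2 l a * eleg F3 b l
     * (u2 (P (x - l)) * tconv u1 u2 (J l)^-1 * conv c u1 u2 (P (b - l))))
     (GRing.mulr_fun (u3 (P (a - l)) * tconv u1 u2 (J a) * u2 (P (d - a))) idfun).
  transitivity (K (tconv (conv c u1 u2) u3 (D l))); last by rewrite /K /= !mulrA.
  rewrite -[tconv _ u3 (D l)]/(tlift (fun y z => conv c u1 u2 y * u3 z) (D l)).
  rewrite linear_tlift; apply: eq_tlift => y z; rewrite /K /= legE //.
  have [_ m12] := conv_monoid cH M1 M2 c12; have [_ m3] := M3.
  have e3C i j : GRing.comm (eleg F3 i j)
     (u2 (P (x - l)) * tconv u1 u2 (J l)^-1 * conv c u1 u2 (P (b - l) * y) *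
      tconv u1 u2 (J a) * u2 (P (d - a))).
    have e3t z' : GRing.comm (eleg F3 i j) (tconv u1 u2 z').
      apply/commr_sym; apply: (@tconv_commuting k U W U unit u1 u2 (fun=> eleg F3 i j) _ _ _ tt);
      exact/commuting_sym/eleg_uleg_commuting/commuting_sym.
    have e3u z' : GRing.comm (eleg F3 i j) (u2 z').
      exact: (eleg_uleg_commuting (commuting_sym F23) _ _ tt).
    by do !apply: commrM; first [exact: e3t | exact: e3u].
  have u3C : GRing.comm (tconv u1 u2 (J a) * u2 (P (d - a))) (u3 (z * P (a - l))).
    apply/commr_sym/commrM; apply/commr_sym; last exact: c23.
    exact: tconv_commuting.
  rewrite [LHS]mulrA -[_ * _ * eleg F3 _ _]mulrA -e3C.
  rewrite -!mulrA; do 3!congr (_ * _).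
  rewrite [tconv u1 u2 (J a) * _]mulrA u3C m12 m3 -!mulrA.
  by [].
transitivity (\sum_x \sum_b \sum_d \sum_l \sum_a
   eleg F1 x d * eleg F2 l a * eleg F3 b l *
   (u1 (P (b - x)) * tconv u1 u3 (D x) * u3 (P (d - x)) *
   (u2 (P (x - l)) * tconv u2 u3 (D l) * u3 (P (a - l))))).
  rewrite exchange_big [RHS]exchange_big; apply: eq_bigr => b _.
  exact: exchange_big22.
rewrite [RHS]mulr_suml; apply: eq_bigr => x _.
rewrite [RHS]mulr_suml; apply: eq_bigr => b _.
rewrite [RHS]mulr_suml; apply: eq_bigr => d _.
have Yc i j : GRing.comm (eleg F2 i j) (u1 (P (b - x)) * tconv u1 u3 (D x) * u3 (P (d - x))).
  apply: commrM; [apply: commrM|].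
  - exact: (eleg_uleg_commuting (commuting_sym F12) _ _ tt).
  - apply/commr_sym; apply: (@tconv_commuting k U W U unit u1 u3 (fun=> eleg F2 i j) _ _ _ tt).
      exact/commuting_sym/eleg_uleg_commuting/commuting_sym.
    exact/commuting_sym/eleg_uleg_commuting.
  - exact: (eleg_uleg_commuting F23 _ _ tt).
have Yc' i j : GRing.comm (eleg F3 i j) (u1 (P (b - x)) * tconv u1 u3 (D x) * u3 (P (d - x))).
  apply: commrM; [apply: commrM|]; [|exact: elegr_comm_tconv|exact: eleg_uleg].
  exact: (eleg_uleg_commuting (commuting_sym F13) _ _ tt).
rewrite [RHS]mulr_sumr; apply: eq_bigr => l _.
rewrite [RHS]mulr_sumr [RHS](bigD1 x) //= [X in _ = _ + X]big1 ?addr0 => [|b' b'x].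
  rewrite [RHS]mulr_sumr; apply: eq_bigr => a _.
  rewrite [RHS]mulr_reorder; [|exact: (eleg_commuting F23)|exact: Yc|exact: Yc'].
  by rewrite !elegM // eqxx.
rewrite [LHS]mulr_sumr big1 // => a _.
rewrite [LHS]mulr_reorder; [|exact: (eleg_commuting F23)|exact: Yc|exact: Yc'].
by rewrite !elegM // eq_sym (negPf b'x) mulr0 mul0r.
Qed.

End ThreeLegs.
End WeakHexagons.

(** * The twist elements *)

Section Sandwich.
Variables (k : fieldType) (A : falgType k) (S : {linear A -> A}).
Hypothesis SM : forall x y, S (x * y) = S y * S x.

(** As S reverses products, a (x) b acts on A from the right by S(a) z b and
    from the left by a z S(b). *)
Definition sandl (z : A) : tens A A -> A := tconv (GRing.mulr_fun z S) idfun.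
Definition sandr (z : A) : tens A A -> A := tconv (GRing.mulr_fun z idfun) S.
HB.instance Definition _ z := GRing.Linear.copy (sandl z) (tlift _).
HB.instance Definition _ z := GRing.Linear.copy (sandr z) (tlift _).

Lemma sandlE z a b : sandl z (a \ox b) = S a * z * b.
Proof. by rewrite /sandl tconvE. Qed.

Lemma sandrE z a b : sandr z (a \ox b) = a * z * S b.
Proof. by rewrite /sandr tconvE. Qed.

Lemma sandl_linear x : linear (sandl^~ x).
Proof.
move=> a z z'; rewrite -tlift_lin; apply: eq_tlift => u v /=.
by rewrite mulrDr mulrDl -scalerAr -scalerAl.
Qed.

Lemma sandr_linear x : linear (sandr^~ x).
Proof.
move=> a z z'; rewrite -tlift_lin; apply: eq_tlift => u v /=.
by rewrite mulrDr mulrDl -scalerAr -scalerAl.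
Qed.

Lemma sandlM z x y : sandl z (x * y) = sandl (sandl z x) y.
Proof.
elim/tensor_ind: x => [a x x' Hx Hx'|u v].
  by rewrite mulrDl -scalerAl !linearP /= Hx Hx' (sandl_linear y).
elim/tensor_ind: y => [a y y' Hy Hy'|u' v'].
  by rewrite mulrDr -scalerAr !linearP /= Hy Hy'.
by rewrite tpureM !sandlE SM !mulrA.
Qed.

Lemma sandrM z x y : sandr z (x * y) = sandr (sandr z y) x.
Proof.
elim/tensor_ind: y => [a y y' Hy Hy'|u' v'].
  by rewrite mulrDr -scalerAr !linearP /= Hy Hy' (sandr_linear x).
elim/tensor_ind: x => [a x x' Hx Hx'|u v].
  by rewrite mulrDl -scalerAl !linearP /= Hx Hx'.
by rewrite tpureM !sandrE SM !mulrA.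
Qed.

Lemma sandl1 x : sandl 1 x = tconv S idfun x.
Proof. by apply: eq_tlift => u v /=; rewrite mulr1. Qed.

Lemma sandr1 x : sandr 1 x = tconv idfun S x.
Proof. by apply: eq_tlift => u v /=; rewrite mulr1. Qed.

End Sandwich.

(** The elements m(S (x) id) J(l) and m(id (x) S) J^-1(l). *)
HB.lock Definition twistQ (k : fieldType) (T : finZmodType) (U : falgType k)
  (c : hopfData U) (J : T -> tens U U) (l : T) : U := sandl (antipode c) 1 (J l).
HB.lock Definition twistQ' (k : fieldType) (T : finZmodType) (U : falgType k)
  (c : hopfData U) (J : T -> tens U U) (l : T) : U := sandr (antipode c) 1 (J l)^-1.
Arguments twistQ {k T U}.
Arguments twistQ' {k T U}.

Section TwistElements.
Variables (k : fieldType) (T : finZmodType) (U : falgType k).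
Variables (c : hopfData U) (iota : {linear Map k T -> U}) (J : T -> tens U U).
Hypotheses (cH : is_hopf c) (iotaH : is_hopf_embedding c iota).
Hypothesis JH : is_dynamical_twist c iota J.
Local Notation P := (idem iota).
Local Notation S := (antipode c).
Local Notation SM := (antipodeM cH).


Local Notation Q := (twistQ c J).
Local Notation Q' := (twistQ' c J).

(** Compare the action of Delta(P_n) J with that of J Delta(P_n), for n = b - a:
    the former is 0 as S(x_1) x_2 = eps(x), the latter is the sum of the
    P_(-s) Q P_(n - s). *)
Lemma idem_twistQ l a b : a != b -> P a * Q l * P b = 0.
Proof.
move=> ab; rewrite twistQ.unlock; pose n := b - a.
have n0 : n != 0 by rewrite subr_eq0 eq_sym.
have : sandl S 1 (comul c (P n) * J l) = sandl S 1 (J l * comul c (P n)).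
  by rewrite (twist_zero_weight JH).
rewrite !sandlM; try exact: SM.
rewrite sandl1 (hopf_antipodel cH) (counit_idem iotaH) (negPf n0) scale0r.
have -> : sandl S 0 (J l) = 0.
  by rewrite -[RHS](tlift0 U (J l)); apply: eq_tlift => u v; rewrite /= mulr0 mul0r.
rewrite (comul_idem iotaH) linear_sum =>  /(congr1 (GRing.mul (P a))).
rewrite mulr0 mulr_sumr (bigD1 (- a)) //= big1 ?addr0 => [|b' b'a].
  rewrite sandlE (antipode_idem iotaH) opprK !mulrA (idem_id iotaH).
  by rewrite /n subrK.
rewrite sandlE (antipode_idem iotaH) !mulrA (idemM iotaH).
by rewrite -eqr_oppLR eq_sym (negPf b'a) !mul0r.
Qed.

Lemma twistQ_idem l n : Q l * P n = P n * Q l.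
Proof.
transitivity (P n * Q l * P n).
  rewrite -[in LHS](mul1r (Q l)) -(sum_idem iotaH) !mulr_suml.
  rewrite (bigD1 n) //= big1 ?addr0 // => a an.
  exact: idem_twistQ.
rewrite -[in RHS](mulr1 (Q l)) -(sum_idem iotaH) !mulr_sumr.
rewrite [RHS](bigD1 n) //= big1 ?addr0 ?mulrA // => a an; rewrite mulrA.
by apply: idem_twistQ; rewrite eq_sym.
Qed.

Lemma slicer_twistV l : slicer (counit c) (J l)^-1 = 1.
Proof.
have M := conv_one_monoid cH U.
have := monoid_mulV (tconv_monoid (f := idfun) (g := conv_one U c)
  (conj erefl (fun _ _ => erefl)) M (commuting_sym (conv_one_commuting c (V := U) idfun)))
  (twist_unit JH l).
by rewrite !tconv_counitr /= (twist_counitr JH) mulr1.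
Qed.


Section Contraction.
Variables (W : falgType k) (i1 i2 i3 : {linear U -> W}) (Th : {linear W -> U}).
Hypothesis L : legs3 i1 i2 i3.
Hypothesis ThE : forall x y z, Th (i1 x * i2 y * i3 z) = x * S y * z.

(** The map Th stands for a (x) b (x) c |-> a S(b) c; S reverses the two factors
    meeting in the middle leg, which separates x from y. *)
Lemma contract_middle x y a d : Th (i1 a * (tconv i2 i3 x * tconv i1 i2 y) * i3 d) =
  a * (tconv idfun S y * tconv S idfun x) * d.
Proof.
have [[M1 M2 M3] [c12 c13 c23]] := L.
pose Lx : {linear tens U U -> U} := Th \o (GRing.mulr_fun (i3 d) (GRing.mull_fun (i1 a)
  (GRing.mulr_fun (tconv i1 i2 y) (tconv i2 i3)))).
pose Rx : {linear tens U U -> U} := GRing.mulr_fun d (GRing.mull_fun a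
  (GRing.mull_fun (tconv idfun S y) (tconv S idfun))).
apply: (tensor_linear_ext (f := Lx) (g := Rx)) => p q; rewrite /Lx /Rx /=.
pose Ly : {linear tens U U -> U} := Th \o (GRing.mulr_fun (i3 d) (GRing.mull_fun (i1 a)
  (GRing.mull_fun (tconv i2 i3 (p \ox q)) (tconv i1 i2)))).
pose Ry : {linear tens U U -> U} := GRing.mulr_fun d (GRing.mull_fun a
  (GRing.mulr_fun (tconv S idfun (p \ox q)) (tconv idfun S))).
apply: (tensor_linear_ext (f := Ly) (g := Ry)) => r s; rewrite /Ly /Ry /= !tconvE /=.
have -> : i1 a * (i2 p * i3 q * (i1 r * i2 s)) * i3 d =
    i1 (a * r) * i2 (p * s) * i3 (q * d).
  rewrite M1.2 M2.2 M3.2 -!mulrA; congr (_ * _).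
  rewrite [i3 q * _]mulrA -c13 !mulrA -c12 -!mulrA; congr (_ * (_ * _)).
  by rewrite [i3 q * _]mulrA -c23 !mulrA.
by rewrite ThE antipodeM // !mulrA.
Qed.

(** The middle leg becomes c_1 S(c_2) and S(b_1) b_2. *)
Lemma contract_comul x y d :
  Th (tconv i1 (conv c i2 i3) x * tconv (conv c i1 i2) i3 y * i3 d) =
  slicer (counit c) x * slicel (counit c) y * d.
Proof.
have [[M1 M2 M3] [c12 c13 c23]] := L.
pose Lx : {linear tens U U -> U} := Th \o (GRing.mulr_fun (i3 d)
  (GRing.mulr_fun (tconv (conv c i1 i2) i3 y) (tconv i1 (conv c i2 i3)))).
pose Rx : {linear tens U U -> U} := GRing.mulr_fun d
  (GRing.mulr_fun (slicel (counit c) y) (slicer (counit c))).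
apply: (tensor_linear_ext (f := Lx) (g := Rx)) => a b; rewrite /Lx /Rx /=.
pose Ly : {linear tens U U -> U} := Th \o (GRing.mulr_fun (i3 d)
  (GRing.mull_fun (tconv i1 (conv c i2 i3) (a \ox b)) (tconv (conv c i1 i2) i3))).
pose Ry : {linear tens U U -> U} := GRing.mulr_fun d
  (GRing.mull_fun (slicer (counit c) (a \ox b)) (slicel (counit c))).
apply: (tensor_linear_ext (f := Ly) (g := Ry)) => r s; rewrite /Ly /Ry /=.
rewrite !tconvE /= slicerE slicelE.
have -> : i1 a * conv c i2 i3 b * (conv c i1 i2 r * i3 s) * i3 d =
    i1 a * (tconv i2 i3 (comul c b) * tconv i1 i2 (comul c r)) * i3 (s * d).
  by rewrite M3.2 /conv !mulrA.
rewrite contract_middle (hopf_antipodel cH) (hopf_antipoder cH).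
rewrite -!scalerAl -!scalerAr -!scalerAl !scalerA !mul1r ?mulr1.
by congr (_ *: _); [exact: mulrC | exact: mulrA].
Qed.

(** Contracting the middle leg of the cocycle identity, solved for
    (id (x) Delta)(J^-1) (Delta (x) id)(J), collapses that side to 1 and leaves
    Q' Q on the other. *)
Lemma twistQ'_Q_contract l n : Q' (l + n) * Q l * P n = P n.
Proof.
have [[M1 M2 M3] [c12 c13 c23]] := L.
have M23 := conv_monoid cH M2 M3 c23.
have c1_23 : commuting i1 (conv c i2 i3).
  by apply: commuting_sym; apply: conv_commuting; apply: commuting_sym.
have := leg_cocycle_idem iotaH JH l n L.
move=> /(congr1 (fun z => tconv i1 (conv c i2 i3) (J l)^-1 * z)); rewrite !mulrA.
rewrite (twist_legV JH l M1 M23 c1_23) mul1r.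
move=> /(congr1 (fun z => z * tconv i1 i2 (J (l + n))^-1)).
have c12_3 z : GRing.comm (tconv i1 i2 z) (i3 (P n)) by apply: tconv_commuting.
have [t1 tM] := tconv_monoid M1 M2 c12.
rewrite -!mulrA -c12_3 [X in _ * (_ * X)]mulrA -tM mulrV ?(twist_unit JH) // t1 mul1r.
rewrite !mulrA => /(congr1 Th); rewrite contract_comul slicer_twistV.
rewrite (twist_counitl JH) !mul1r => E; rewrite [RHS]E.
have := contract_middle (J l) (J (l + n))^-1 1 (P n).
rewrite M1.1 !mul1r => ->.
by rewrite twistQ.unlock twistQ'.unlock sandl1 sandr1.
Qed.

End Contraction.

Lemma twistQ'_Q l n : Q' (l + n) * Q l * P n = P n.
Proof.
pose i1 : {linear U -> tens U (tens U U)} := @inl_tens k U (tens U U).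
pose ir : {linear tens U U -> tens U (tens U U)} := @inr_tens k U (tens U U).
pose i2 : {linear U -> tens U (tens U U)} := ir \o @inl_tens k U U.
pose i3 : {linear U -> tens U (tens U U)} := ir \o @inr_tens k U U.
have [ir1 irM] : GRing.monoid_morphism ir by apply: inr_tens_monoid.
have M1 : GRing.monoid_morphism i1 by apply: inl_tens_monoid.
have M2 : GRing.monoid_morphism i2.
  by split=> [|x y]; rewrite /i2 /= ?(inl_tens_monoid _ _).1 // (inl_tens_monoid _ _).2 irM.
have M3 : GRing.monoid_morphism i3.
  by split=> [|x y]; rewrite /i3 /= ?(inr_tens_monoid _ _).1 // (inr_tens_monoid _ _).2 irM.
have c12 : commuting i1 i2 by move=> x y; apply: inl_inr_comm.
have c13 : commuting i1 i3 by move=> x y; apply: inl_inr_comm.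
have c23 : commuting i2 i3.
  by move=> x y; rewrite /GRing.comm /i2 /i3 /= -!irM inl_inr_comm.
have L : legs3 i1 i2 i3 := conj (And3 M1 M2 M3) (And3 c12 c13 c23).
pose Th : {linear tens U (tens U U) -> U} := tconv idfun (tconv S idfun).
apply: (twistQ'_Q_contract (Th := Th) L) => x y z.
have -> : i1 x * i2 y * i3 z = x \ox (y \ox z).
  rewrite /i1 /i2 /i3 /= -mulrA -irM -tpure_inl_inr.
  by rewrite /ir /= -tpure_inl_inr.
by rewrite /Th /= tconvE /= tconvE mulrA.
Qed.

End TwistElements.

(** * The antipode of the weak Hopf algebra *)

Section TwistedAntipode.
Variables (k : fieldType) (T : finZmodType) (U : falgType k).
Variables (c : hopfData U) (iota : {linear Map k T -> U}) (J : T -> tens U U).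
Hypotheses (cH : is_hopf c) (iotaH : is_hopf_embedding c iota).
Hypothesis JH : is_dynamical_twist c iota J.
Local Notation P := (idem iota).
Local Notation S := (antipode c).
Local Notation Q := (twistQ c J).
Local Notation Q' := (twistQ' c J).
Local Notation H := (dynH T U).
Local Notation E l m u := (munit k l m \ox (u : U) : H).
Local Notation SH := (antipode (dynH_hopf T c)).
Local Notation HJ := (wcoalg (H_J c iota J)).
Local Notation SJ := (dyn_antipode c iota J).
Local Notation v := (dyn_v c iota J).

Lemma antipode_dynHM x y : SH (x * y) = SH y * SH x.
Proof.
elim/dynH_ind: x => [a x x' Hx Hx'|l m u].
  by rewrite mulrDl -scalerAl !linearP Hx Hx' mulrDr scalerAr.
elim/dynH_ind: y => [a y y' Hy Hy'|l' m' u'].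
  by rewrite mulrDr -scalerAr !linearP Hy Hy' mulrDl scalerAl.
rewrite munit_tpureM !antipode_dynH munit_tpureM eq_sym; case: ifP => _; last exact: linear0.
by rewrite antipode_dynH antipodeM.
Qed.

Definition munit_mul (l m : T) (u : U) : H := E l m u.
HB.instance Definition _ l m := GRing.isLinear.Build k U H *:%R (munit_mul l m)
  (tpurePr (munit k l m)).

Lemma sum_munit_mul l m (I : finType) (x : I -> U) : 
  \sum_i E l m (x i) = E l m (\sum_i x i) :> H.
Proof. by symmetry; exact: (linear_sum (munit_mul l m)). Qed.

Lemma munit_mul0 l m : E l m 0 = 0. Proof. exact: (linear0 (munit_mul l m)). Qed.

Lemma mul_sum_mul (I : finType) (x y : H) (z : I -> H) :
  x * (\sum_i z i) * y = \sum_i x * z i * y.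
Proof. by rewrite mulr_sumr mulr_suml. Qed.

Lemma mul_sum_diag (x y : H) : x * y = \sum_l x * E l l 1 * y.
Proof. by rewrite -mul_sum_mul -(one_dynH T U) mulr1. Qed.

Lemma dyn_vE : v = \sum_l \sum_s E s l (Q l * P (s - l)).
Proof.
rewrite [LHS](dynF_map iota J (tconv SH idfun)).
apply: eq_bigr => l _; apply: eq_bigr => s _; rewrite twistQ.unlock sandl1.
pose L : {linear U -> H} := munit_mul s l \o GRing.mulr_fun (P (s - l)) idfun.
rewrite -[RHS]/(L _) /tconv linear_tlift; apply: eq_tlift => a b.
rewrite -[LHS]/(tconv SH idfun (E l s a \ox E l l (b * P (s - l)))) tconvE /=.
rewrite -[tmap _ _ _]/(SH (E l s a)) antipode_dynH munit_tpureM eqxx.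
by rewrite /L /= /munit_mul mulrA.
Qed.

Definition dyn_v_inv : H := sandr SH 1 (dynFbar iota J).

Lemma sandr_Fbar z : sandr SH z (dynFbar iota J) =
  \sum_l \sum_s tlift (fun a b => E s l a * z * E l l (S b * P (l - s))) (J l)^-1.
Proof.
rewrite (dynFbar_map iota J (sandr SH z)).
apply: eq_bigr => l _; apply: eq_bigr => s _; apply: eq_tlift => a b.
rewrite -[LHS]/(sandr SH z (E s l a \ox E l l (P (s - l) * b))) sandrE antipode_dynH.
by rewrite antipodeM // (antipode_idem iotaH) opprB.
Qed.

Lemma dyn_v_invE : dyn_v_inv = \sum_l \sum_s E s l (Q' l * P (l - s)).
Proof.
rewrite /dyn_v_inv sandr_Fbar; apply: eq_bigr => l _; apply: eq_bigr => s _.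
rewrite twistQ'.unlock sandr1.
pose L : {linear U -> H} := munit_mul s l \o GRing.mulr_fun (P (l - s)) idfun.
rewrite -[RHS]/(L _) /tconv linear_tlift; apply: eq_tlift => a b.
by rewrite mulr1 munit_tpureM eqxx /L /= /munit_mul mulrA.
Qed.

Lemma dyn_v_inv_munit l u : dyn_v_inv * E l l u = \sum_s E s l (Q' l * P (l - s) * u).
Proof.
rewrite dyn_v_invE mulr_suml (bigD1 l) //= [X in _ + X]big1 ?addr0 => [|l' l'l].
  by rewrite mulr_suml; apply: eq_bigr => s _; rewrite munit_tpureM eqxx.
by rewrite mulr_suml big1 // => s _; rewrite munit_tpureM (negPf l'l).
Qed.

Lemma Ev l n u : E l n u * v = \sum_y E l y (u * (Q y * P (n - y))).
Proof.
rewrite dyn_vE mulr_sumr; apply: eq_bigr => y _.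
rewrite mulr_sumr (bigD1 n) //= [X in _ + X]big1 ?addr0 => [|s sn].
  by rewrite munit_tpureM eqxx.
by rewrite munit_tpureM eq_sym (negPf sn).
Qed.

(** The key computation with the twist elements: conjugation by v moves a
    diagonal matrix unit by the weight it is paired with. *)
Lemma dyn_v_inv_idem l n : dyn_v_inv * E l l (P n) * v = E (l - n) (l - n) (P n).
Proof.
have -> : dyn_v_inv * E l l (P n) = E (l - n) l (Q' l * P n).
  rewrite dyn_v_inv_munit (bigD1 (l - n)) //= big1 ?addr0 => [|s sn].
    by rewrite subKr -mulrA (idem_id iotaH).
  rewrite -mulrA (idemM iotaH); case: eqP => [sln|_]; last by rewrite mulr0 munit_mul0.
  by rewrite -sln subKr eqxx in sn.
rewrite Ev (bigD1 (l - n)) //= big1 ?addr0 => [|y yn].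
  rewrite subKr -mulrA [P n * _]mulrA -(twistQ_idem cH iotaH JH) -mulrA (idem_id iotaH).
  by have := twistQ'_Q cH iotaH JH (l - n) n; rewrite subrK mulrA => ->.
rewrite -mulrA [P n * _]mulrA -(twistQ_idem cH iotaH JH) -mulrA (idemM iotaH).
case: eqP => [nly|_]; last by rewrite !mulr0 munit_mul0.
by rewrite nly subKr eqxx in yn.
Qed.

(** Summing the diagonal blocks w E_ll P_n v = E_(l-n,l-n) P_n over l and n. *)
Lemma dyn_v_inv_mul : dyn_v_inv * v = 1.
Proof.
rewrite mul_sum_diag.
transitivity (\sum_l \sum_n E (l - n) (l - n) (P n)).
  apply: eq_bigr => l _; rewrite -(sum_idem iotaH) -sum_munit_mul mul_sum_mul.
  by apply: eq_bigr => n _; rewrite dyn_v_inv_idem.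
rewrite exchange_big /=.
transitivity (\sum_n \sum_(l : T) E l l (P n)).
  apply: eq_bigr => n _; rewrite (reindex_inj (addIr n)) /=.
  by apply: eq_bigr => l _; rewrite addrK.
rewrite (one_dynH T U) exchange_big; apply: eq_bigr => l _.
by rewrite sum_munit_mul (sum_idem iotaH).
Qed.

Lemma dyn_v_unit : v \is a GRing.unit.
Proof. exact: (falg_left_inverse dyn_v_inv_mul).1. Qed.

Lemma dyn_vV : v^-1 = dyn_v_inv.
Proof. exact: (falg_left_inverse dyn_v_inv_mul).2. Qed.

Lemma dyn_antipodeM x y : SJ (x * y) = SJ y * SJ x.
Proof.
rewrite /dyn_antipode antipode_dynHM !mulrA; congr (_ * _ * _).
by rewrite mulrK // dyn_v_unit.
Qed.

Lemma dyn_antipode_idem l n : SJ (E l l (P n)) = E (l + n) (l + n) (P (- n)).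
Proof.
by rewrite /dyn_antipode antipode_dynH (antipode_idem iotaH) dyn_vV dyn_v_inv_idem opprK.
Qed.

Lemma dyn_antipodeE l : SJ (E l l 1) = \sum_n E (l + n) (l + n) (P (- n)).
Proof.
rewrite -(sum_idem iotaH) -sum_munit_mul linear_sum.
by apply: eq_bigr => n _; exact: dyn_antipode_idem.
Qed.

(** This is f v^-1 S(g) = 1 for F = f (x) g: the shifts by weights cancel, leaving
    m(id (x) S)(J J^-1) in each diagonal block. *)
Lemma sandr_F : sandr SH dyn_v_inv (dynF iota J) = 1.
Proof.
rewrite (one_dynH T U) (dynF_map iota J (sandr SH dyn_v_inv)); apply: eq_bigr => l _.
transitivity (\sum_s E l l (tlift (fun a b => a * Q' l * P (l - s) * S b) (J l))).
  apply: eq_bigr => s _; rewrite -[RHS]/(munit_mul l l _) linear_tlift.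
  apply: eq_tlift => a b; rewrite /munit_mul.
  rewrite -[LHS]/(sandr SH dyn_v_inv (E l s a \ox E l l (b * P (s - l)))) sandrE antipode_dynH.
  rewrite -mulrA dyn_v_inv_munit mulr_sumr (bigD1 s) //= big1 ?addr0 => [|s' s's].
    rewrite munit_tpureM eqxx antipodeM // (antipode_idem iotaH) opprB.
    by rewrite -[Q' l * _ * _]mulrA [P _ * (P _ * _)]mulrA (idem_id iotaH) !mulrA.
  by rewrite munit_tpureM eq_sym (negPf s's).
rewrite sum_munit_mul -tlift_sum; congr (_ \ox _).
transitivity (sandr S (Q' l) (J l)).
  apply: eq_tlift => a b /=.
  rewrite -mulr_suml -mulr_sumr; congr (_ * _).
  rewrite -[RHS]mulr1 -(sum_idem iotaH); congr (_ * _).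
  rewrite (reindex_inj (inv_inj (subKr l))) /=.
  by apply: eq_bigr => s _; rewrite subKr.
rewrite twistQ'.unlock -sandrM; last exact: antipodeM.
rewrite mulrV ?(twist_unit JH) // tens1E sandrE mulr1 mul1r.
exact: antipode1.
Qed.

(** The target map x_1 S_J(x_2) is z |-> a z S(b) iterated over Fbar, Delta(x) and
    F, applied to v^-1 and multiplied by v; F turns v^-1 into 1, Delta(x) turns 1
    into eps(u) E_ll, and Fbar turns E_ll into v^-1 E_ll. *)
Lemma dyn_target l m u : tconv idfun SJ (dyn_comul c iota J (E l m u)) =
  (counit c u : k) *: SJ (E l l 1).
Proof.
have SJE y : tconv idfun SJ y = sandr SH dyn_v_inv y * v.
  rewrite -[RHS]/(GRing.mulr_fun v idfun _) linear_tlift.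
  by apply: eq_tlift => a b /=; rewrite /dyn_antipode dyn_vV !mulrA.
rewrite SJE /dyn_comul !sandrM; try exact: antipode_dynHM.
rewrite sandr_F comul_dynH.
have -> : sandr SH 1 (tlift (fun u1 u2 => E l m u1 \ox E l m u2) (comul c u)) =
    (counit c u : k) *: E l l 1.
  transitivity (munit_mul l l ((counit c u : k) *: 1)); last by rewrite linearZ.
  rewrite -(hopf_antipoder cH) [LHS]linear_tlift [RHS]linear_tlift.
  apply: eq_tlift => a b; rewrite -[LHS]/(sandr SH 1 (E l m a \ox E l m b)).
  by rewrite sandrE antipode_dynH mulr1 munit_tpureM eqxx.
have -> : sandr SH ((counit c u : k) *: E l l 1) (dynFbar iota J) =
     (counit c u : k) *: (dyn_v_inv * E l l 1).
  rewrite sandr_Fbar dyn_v_inv_munit scaler_sumr (bigD1 l) //= [X in _ + X]big1 ?addr0.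
    apply: eq_bigr => s _; rewrite mulr1 twistQ'.unlock sandr1.
    pose L : {linear U -> H} := GRing.scale_fun (counit c u : k)
      (munit_mul s l \o GRing.mulr_fun (P (l - s)) idfun).
    rewrite -[RHS]/(L _) /tconv linear_tlift; apply: eq_tlift => a b.
    by rewrite -scalerAr -scalerAl !munit_tpureM eqxx munit_tpureM eqxx mulr1
          /L /= /munit_mul mulrA.
  move=> l' l'l; rewrite big1 // => s _.
  rewrite -[RHS](tlift0 H (J l')^-1); apply: eq_tlift => a b.
  by rewrite -scalerAr munit_tpureM (negPf l'l) scaler0 mul0r.
by rewrite /dyn_antipode antipode_dynH (antipode1 cH) dyn_vV -!scalerAl.
Qed.

End TwistedAntipode.

(** * R-matrices and their slices *)

Section WeakQuasitriangular.
Variables (k : fieldType) (A : falgType k) (c : hopfData A) (S : {linear A -> A}).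
Variable Rm : tens A A.

Local Notation L1 := (@inl_tens k (tens A A) A \o @inl_tens k A A).
Local Notation L2 := (@inl_tens k (tens A A) A \o @inr_tens k A A).
Local Notation L3 := (@inr_tens k (tens A A) A).
Local Notation R1 := (@inl_tens k A (tens A A)).
Local Notation R2 := (@inr_tens k A (tens A A) \o @inl_tens k A A).
Local Notation R3 := (@inr_tens k A (tens A A) \o @inr_tens k A A).

Lemma left_legs a b a' b' : tconv L1 L3 (a \ox b) * tconv L2 L3 (a' \ox b') =
  (a \ox a') \ox (b * b').
Proof.
rewrite !tconvE /= -!tpure_inl_inr tpureM; congr (_ \ox _).
by rewrite /inl_tens /inr_tens tpureM mulr1 mul1r.
Qed.

Lemma right_legs a b a' b' : tconv R1 R3 (a \ox b) * tconv R1 R2 (a' \ox b') =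
  (a * a') \ox (b' \ox b).
Proof.
rewrite !tconvE /= -!tpure_inl_inr tpureM; congr (_ \ox _).
by rewrite /inl_tens /inr_tens tpureM mulr1 mul1r.
Qed.

Lemma bilinear_tensor_ext (V : vectType k) (B : falgType k)
    (p q : {linear tens A A -> B}) (F : {linear B -> V}) (G : tens A A -> tens A A -> V) :
    (forall y, linear (G^~ y)) -> (forall x, linear (G x)) ->
    (forall a b a' b', F (p (a \ox b) * q (a' \ox b')) = G (a \ox b) (a' \ox b')) ->
  forall x y, F (p x * q y) = G x y.
Proof.
move=> Gl Gr E x y; elim/tensor_ind: x => [a x x' Hx Hx'|u v].
  by rewrite Gl -Hx -Hx' linearP mulrDl -scalerAl linearP.
elim/tensor_ind: y => [a y y' Hy Hy'|u' v'].
  by rewrite Gr -Hy -Hy' linearP mulrDr -scalerAr linearP.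
exact: E.
Qed.

Lemma left_legs_comul x : tconv (conv c L1 L2) L3 x = tmap (comul c) idfun x.
Proof.
apply: (tensor_linear_ext (f := tconv (conv c L1 L2) L3) (g := tmap (comul c) idfun)) => a b /=.
rewrite tconvE tmapE /= tpure_inl_inr; congr (_ * _).
rewrite /conv -[in RHS](tconv_inl_inr (comul c a)).
rewrite -[RHS]/((@inl_tens k (tens A A) A : {linear _ -> _}) _) linear_tlift.
by apply: eq_tlift => u v; rewrite /= (inl_tens_monoid _ _).2.
Qed.

Lemma right_legs_comul x : tconv R1 (conv c R2 R3) x = tmap idfun (comul c) x.
Proof.
apply: (tensor_linear_ext (f := tconv R1 (conv c R2 R3)) (g := tmap idfun (comul c))) => a b /=.
rewrite tconvE tmapE /= tpure_inl_inr; congr (_ * _).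
rewrite /conv -[in RHS](tconv_inl_inr (comul c b)).
rewrite -[RHS]/((@inr_tens k A (tens A A) : {linear _ -> _}) _) linear_tlift.
by apply: eq_tlift => u v; rewrite /= (inr_tens_monoid _ _).2.
Qed.

Lemma left_legs3 : legs3 L1 L2 L3.
Proof.
have [ir1 irM] := inl_tens_monoid (tens A A) A.
have M1 : GRing.monoid_morphism L1.
  by split=> [|x y] /=; rewrite ?(inl_tens_monoid _ _).1 // (inl_tens_monoid _ _).2 irM.
have M2 : GRing.monoid_morphism L2.
  by split=> [|x y] /=; rewrite ?(inr_tens_monoid _ _).1 // (inr_tens_monoid _ _).2 irM.
have M3 : GRing.monoid_morphism L3 := inr_tens_monoid _ _.
have c12 : commuting L1 L2.
  by move=> x y; rewrite /GRing.comm /= -!irM inl_inr_comm.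
have c13 : commuting L1 L3 by move=> x y; apply: inl_inr_comm.
have c23 : commuting L2 L3 by move=> x y; apply: inl_inr_comm.
exact: (conj (And3 M1 M2 M3) (And3 c12 c13 c23)).
Qed.

Lemma right_legs3 : legs3 R1 R2 R3.
Proof.
have [ir1 irM] := inr_tens_monoid A (tens A A).
have M1 : GRing.monoid_morphism R1 := inl_tens_monoid _ _.
have M2 : GRing.monoid_morphism R2.
  by split=> [|x y] /=; rewrite ?(inl_tens_monoid _ _).1 // (inl_tens_monoid _ _).2 irM.
have M3 : GRing.monoid_morphism R3.
  by split=> [|x y] /=; rewrite ?(inr_tens_monoid _ _).1 // (inr_tens_monoid _ _).2 irM.
have c23 : commuting R2 R3.
  by move=> x y; rewrite /GRing.comm /= -!irM inl_inr_comm.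
have c12 : commuting R1 R2 by move=> x y; apply: inl_inr_comm.
have c13 : commuting R1 R3 by move=> x y; apply: inl_inr_comm.
exact: (conj (And3 M1 M2 M3) (And3 c12 c13 c23)).
Qed.

Hypothesis hexagonl : forall (W : falgType k) (f g h : {linear A -> W}),
  legs3 f g h -> tconv (conv c f g) h Rm = tconv f h Rm * tconv g h Rm.
Hypothesis hexagonr : forall (W : falgType k) (f g h : {linear A -> W}),
  legs3 f g h -> tconv f (conv c g h) Rm = tconv f h Rm * tconv f g Rm.

Lemma comul_hexl : tmap (comul c) idfun Rm = tconv L1 L3 Rm * tconv L2 L3 Rm.
Proof. exact: (etrans (esym (left_legs_comul Rm)) (hexagonl left_legs3)). Qed.

Lemma comul_hexr : tmap idfun (comul c) Rm = tconv R1 R3 Rm * tconv R1 R2 Rm.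
Proof. exact: (etrans (esym (right_legs_comul Rm)) (hexagonr right_legs3)). Qed.

Lemma slicer_mul (f g : {linear A -> k^o}) :
  slicer (fun y => tlift (fun a b => (f a : k) * (g b : k) : k^o) (comul c y)) Rm =
  slicer g Rm * slicer f Rm.
Proof.
pose fg : {linear tens A A -> k^o} := tlift (fun a b => (f a : k) * (g b : k) : k^o).
have fgE a b : fg (a \ox b) = (f a : k) * (g b : k).
  rewrite /fg /= tlift_tpure // => [y|x] s t t'; rewrite linearP.
    by rewrite mulrDl; congr (_ + _); apply/esym/mulrA.
  by rewrite mulrDr; congr (_ + _); apply: mulrCA.
transitivity (slicer fg (tmap idfun (comul c) Rm)).
  by rewrite /tmap linear_tlift; apply: eq_tlift => a b; rewrite /= slicerE.
rewrite comul_hexr.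
apply: (bilinear_tensor_ext (p := tconv R1 R3) (q := tconv R1 R2) (F := slicer fg)
  (G := fun x y => slicer g x * slicer f y)).
- by move=> y a x x'; rewrite linearP mulrDl scalerAl.
- by move=> x a y y'; rewrite linearP mulrDr scalerAr.
move=> a b a' b'; rewrite right_legs /= !slicerE /= fgE -scalerAl -scalerAr scalerA.
by congr (_ *: _); apply: mulrC.
Qed.

Lemma comul_slicer (f : {linear A -> k^o}) :
  comul c (slicer f Rm) = \sum_(i < \dim {:A}) \sum_(j < \dim {:A})
    (f ((vbasis {:A})`_i * (vbasis {:A})`_j) : k) *:
    (slicer (coord (vbasis {:A}) i : A -> k^o) Rm \ox
     slicer (coord (vbasis {:A}) j : A -> k^o) Rm).
Proof.
transitivity (slicer f (tmap (comul c) idfun Rm)).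
  rewrite /tmap linear_tlift -[slicer f]/(tlift _) linear_tlift.
  apply: eq_tlift => a b; rewrite linearZ /=.
  exact/esym/slicerE.
rewrite comul_hexl.
apply: (bilinear_tensor_ext (p := tconv L1 L3) (q := tconv L2 L3) (F := slicer f)
  (G := fun x y => \sum_(i < \dim {:A}) \sum_(j < \dim {:A})
    (f ((vbasis {:A})`_i * (vbasis {:A})`_j) : k) *:
    (slicer (coord (vbasis {:A}) i : A -> k^o) x \ox
     slicer (coord (vbasis {:A}) j : A -> k^o) y))).
- move=> y a x x'; rewrite scaler_sumr -big_split; apply: eq_bigr => i _ /=.
  rewrite scaler_sumr -big_split; apply: eq_bigr => j _ /=.
  by rewrite linearP tpurePl scalerDr !scalerA mulrC.
- move=> x a y y'; rewrite scaler_sumr -big_split; apply: eq_bigr => i _ /=.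
  rewrite scaler_sumr -big_split; apply: eq_bigr => j _ /=.
  by rewrite linearP tpurePr scalerDr !scalerA mulrC.
move=> a b a' b'; rewrite left_legs /= slicerE.
rewrite {1}(coord_vbasis (memvf b)) {1}(coord_vbasis (memvf b')).
rewrite mulr_suml linear_sum scaler_suml; apply: eq_bigr => i _.
rewrite mulr_sumr linear_sum scaler_suml; apply: eq_bigr => j _.
rewrite -scalerAl -scalerAr !linearZ /= !slicerE.
rewrite tpureZ !scalerA; congr (_ *: _).
exact: mulrC.
Qed.

Hypothesis SM : forall x y, S (x * y) = S y * S x.
Local Notation target := (conv c idfun S).

(** Apply m (id (x) S) to the first two legs of R_13 R_23 = (Delta (x) id)(R). *)
Lemma mul_antipodel : Rm * tmap S idfun Rm = tmap target idfun Rm.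
Proof.
transitivity (tmap (tconv idfun S) idfun (tmap (comul c) idfun Rm)); last first.
  by rewrite [X in tmap _ _ X]/tmap linear_tlift; apply: eq_tlift => a b; rewrite /= tmapE.
rewrite comul_hexl; apply/esym.
apply: (bilinear_tensor_ext (p := tconv L1 L3) (q := tconv L2 L3)
  (F := tmap (tconv idfun S) idfun) (G := fun x y => x * tmap S idfun y)).
- by move=> y a x x'; rewrite mulrDl scalerAl.
- by move=> x a y y'; rewrite linearP mulrDr scalerAr.
by move=> a b a' b'; rewrite left_legs /= !tmapE /= tconvE tpureM.
Qed.

(** Apply S to the first leg and m (id (x) S) to the other two of
    R_13 R_12 = (id (x) Delta)(R); S turns the product in the first leg around. *)
Lemma mul_antipoder : tmap S idfun Rm * tmap S S Rm = tmap S target Rm.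
Proof.
transitivity (tmap S (tconv idfun S) (tmap idfun (comul c) Rm)); last first.
  by rewrite [X in tmap _ _ X]/tmap linear_tlift; apply: eq_tlift => a b; rewrite /= tmapE.
rewrite comul_hexr; apply/esym.
apply: (bilinear_tensor_ext (p := tconv R1 R3) (q := tconv R1 R2)
  (F := tmap S (tconv idfun S)) (G := fun x y => tmap S idfun y * tmap S S x)).
- by move=> y a x x'; rewrite linearP mulrDr scalerAr.
- by move=> x a y y'; rewrite linearP mulrDl scalerAl.
by move=> a b a' b'; rewrite right_legs /= !tmapE /= tconvE tpureM SM.
Qed.

(** With sigma = (S (x) id) R and tau = (S (x) S) R, the two identities above
    read R sigma = e' and sigma tau = e, so that sigma is a quasi-inverse of both
    R and tau, whence tau = e' tau = R sigma tau = R e = R. *)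
Lemma antipode_rmatrix (I : finType) (E : I -> A) :
    (forall (W : falgType k) (f g : {linear A -> W}),
      tconv (f \o target) g Rm = \sum_i f (S (E i)) * g (E i)) ->
    (forall (W : falgType k) (f g : {linear A -> W}),
      tconv (f \o S) (g \o target) Rm = \sum_i f (E i) * g (S (E i))) ->
    (forall (W : falgType k) (f g : {linear A -> W}),
      GRing.monoid_morphism f -> GRing.monoid_morphism g -> commuting f g ->
      tconv f g Rm * (\sum_i f (E i) * g (S (E i))) = tconv f g Rm) ->
    (forall (W : falgType k) (f g : {linear A -> W}),
      GRing.monoid_morphism f -> GRing.monoid_morphism g -> commuting f g ->
      (\sum_i f (S (E i)) * g (E i)) * tconv (f \o S) (g \o S) Rm =
      tconv (f \o S) (g \o S) Rm) ->
  tmap S S Rm = Rm.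
Proof.
move=> tl tr Re fr.
have fM := inl_tens_monoid A A; have gM := inr_tens_monoid A A.
have fg : commuting (@inl_tens k A A) (@inr_tens k A A) := @inl_inr_comm k A A.
have Re' := Re _ _ _ fM gM fg; rewrite tconv_inl_inr in Re'.
have fr' := fr _ _ _ fM gM fg; rewrite -tmap_legs in fr'.
have El := etrans (tmap_legs target idfun Rm) (tl _ (@inl_tens k A A) (@inr_tens k A A)).
have Er := etrans (tmap_legs S target Rm) (tr _ (@inl_tens k A A) (@inr_tens k A A)).
by rewrite -fr' -El -mul_antipodel -mulrA mul_antipoder Er Re'.
Qed.

End WeakQuasitriangular.


(** * Counital identities of the R-matrix *)

Section DynamicalQuasitriangular.
Variables (k : fieldType) (T : finZmodType) (U : falgType k).
Variables (c : hopfData U) (R : tens U U) (iota : {linear Map k T -> U}).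
Variables (J D : T -> tens U U).
Hypotheses (cH : is_hopf c) (RH : is_quasitriangular c R).
Hypotheses (iotaH : is_hopf_embedding c iota).
Hypothesis JH : is_dynamical_twist c iota J.
Hypothesis DE : forall l, tswap (J l) * D l = R * J l.
Hypothesis dynRE : forall l, dynR J R l = D l.
Local Notation P := (idem iota).
Local Notation H := (dynH T U).
Local Notation E l m u := (munit k l m \ox (u : U) : H).
Local Notation HJ := (wcoalg (H_J c iota J)).
Local Notation SJ := (dyn_antipode c iota J).
Local Notation Rm := (dyn_rmatrix iota J R).
Local Notation target := (conv HJ idfun SJ).

Lemma slicel_dynR l : slicel (counit c) (D l) = 1.
Proof.
have := dynR_counitl cH RH JH DE (h := idfun) l (conj erefl (fun _ _ => erefl)).
by rewrite tconv_counitl.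
Qed.

Lemma slicer_dynR l : slicer (counit c) (D l) = 1.
Proof.
have := dynR_counitr cH RH JH DE (h := idfun) l (conj erefl (fun _ _ => erefl)).
by rewrite tconv_counitr.
Qed.

Lemma tlift_counitl (V : vectType k) (g : {linear U -> V}) z :
  tlift (fun x y => (counit c x : k) *: g y) z = g (slicel (counit c) z).
Proof.
by rewrite /slicel linear_tlift; apply: eq_tlift => x y; rewrite linearZ.
Qed.

Lemma tlift_counitr (V : vectType k) (g : {linear U -> V}) z :
  tlift (fun x y => (counit c y : k) *: g x) z = g (slicer (counit c) z).
Proof.
by rewrite /slicer linear_tlift; apply: eq_tlift => x y; rewrite linearZ.
Qed.

Lemma counit_idem_mul n x : counit c (P n * x) = if n == 0 then counit c x else 0.
Proof.
rewrite hopf_counitM // (counit_idem iotaH).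
by case: eqP => _; [exact: mul1r | exact: mul0r].
Qed.

Lemma counit_mul_idem n x : counit c (x * P n) = if n == 0 then counit c x else 0.
Proof.
rewrite hopf_counitM // (counit_idem iotaH).
by case: eqP => _; [exact: mulr1 | exact: mulr0].
Qed.

Lemma counit_idem_mulZ (V : vectType k) n x (v : V) : 
  ((counit c (P n * x) : k) *: v) = (n == 0)%:R *: ((counit c x : k) *: v).
Proof. by rewrite counit_idem_mul; case: eqP => _; rewrite ?scale1r ?scale0r. Qed.

Lemma counit_mul_idemZ (V : vectType k) n x (v : V) : 
  ((counit c (x * P n) : k) *: v) = (n == 0)%:R *: ((counit c x : k) *: v).
Proof. by rewrite counit_mul_idem; case: eqP => _; rewrite ?scale1r ?scale0r. Qed.

Lemma sum_idem_sub l : \sum_a P (a - l) = 1.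
Proof.
by rewrite (reindex_inj (addIr l)) -(sum_idem iotaH); apply: eq_bigr => a _; rewrite /= addrK.
Qed.

(** When the image of one leg depends on u only through eps(u), the idempotent of
    that leg must have weight 0, and the counit turns D(l) into 1. *)
Section CounitalLegs.
Variables (W : falgType k) (f g : {linear H -> W}).

Lemma rmatrix_counitall (X : T -> W) :
    (forall l a u, f (E l a u) = (counit c u : k) *: X l) ->
  tconv f g Rm = \sum_l X l * g (E l l 1).
Proof.
move=> fE; rewrite (rmatrix_tconv iota dynRE); apply: eq_bigr => l _.
rewrite (bigD1 l) //= [X in _ + X]big1 ?addr0 => [|b bl].
  rewrite -(sum_idem_sub l) -sum_munit_mul linear_sum mulr_sumr; apply: eq_bigr => a _.
  pose h : {linear U -> W} := GRing.mull_fun (X l)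
    (g \o (munit_mul l l \o GRing.mulr_fun (P (a - l)) idfun)).
  rewrite -[P (a - l) in RHS]mul1r -(slicel_dynR l) -[RHS]/(h _) -tlift_counitl.
  apply: eq_tlift => x y; rewrite fE -scalerAl.
  by rewrite subrr counit_idem_mulZ eqxx scale1r.
rewrite big1 // => a _; rewrite -[RHS](tlift0 W (D l)); apply: eq_tlift => x y.
by rewrite fE -scalerAl counit_idem_mulZ subr_eq0 (negPf bl) scale0r.
Qed.

Lemma rmatrix_counitalr (Y : T -> W) :
    (forall b l u, g (E b l u) = (counit c u : k) *: Y b) ->
  tconv f g Rm = \sum_l \sum_b f (E l l (P (b - l))) * Y b.
Proof.
move=> gE; rewrite (rmatrix_tconv iota dynRE); apply: eq_bigr => l _.
apply: eq_bigr => b _; rewrite (bigD1 l) //= [X in _ + X]big1 ?addr0 => [|a al].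
  pose h : {linear U -> W} := GRing.mulr_fun (Y b)
    (f \o (munit_mul l l \o GRing.mull_fun (P (b - l)) idfun)).
  rewrite -[P (b - l) in RHS]mulr1 -(slicer_dynR l) -[RHS]/(h _) -tlift_counitr.
  apply: eq_tlift => x y; rewrite gE -scalerAr.
  by rewrite subrr counit_mul_idemZ eqxx scale1r.
rewrite -[RHS](tlift0 W (D l)); apply: eq_tlift => x y.
by rewrite gE -scalerAr counit_mul_idemZ subr_eq0 (negPf al) scale0r.
Qed.

End CounitalLegs.

Lemma slicer_counitE (A : falgType k) (d : hopfData A) x :
  slicer (counit d) x = tconv idfun (conv_one A d) x.
Proof. by rewrite tconv_counitr. Qed.

Lemma slicel_counitE (A : falgType k) (d : hopfData A) x :
  slicel (counit d) x = tconv (conv_one A d) idfun x.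
Proof. by rewrite tconv_counitl. Qed.

Lemma dyn_rmatrix_counitr : slicer (counit HJ) Rm = 1.
Proof.
pose g : {linear H -> H} := conv_one H (dynH_hopf T c).
transitivity (tconv idfun g Rm).
  exact: (slicer_counitE (dynH_hopf T c)).
have gE (b l : T) u : g (E b l u) = (counit c u : k) *: 1.
  by rewrite /g /= /conv_one counit_dynH.
rewrite (rmatrix_counitalr idfun gE).
rewrite (one_dynH T U); apply: eq_bigr => l _.
transitivity (\sum_b E l l (P (b - l))); last by rewrite sum_munit_mul sum_idem_sub.
by apply: eq_bigr => b _; rewrite -(one_dynH T U) mulr1.
Qed.

Lemma dyn_rmatrix_counitl : slicel (counit HJ) Rm = 1.
Proof.
pose f : {linear H -> H} := conv_one H (dynH_hopf T c).
transitivity (tconv f idfun Rm).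
  exact: (slicel_counitE (dynH_hopf T c)).
have fE (b l : T) u : f (E b l u) = (counit c u : k) *: 1.
  by rewrite /f /= /conv_one counit_dynH.
rewrite (rmatrix_counitall idfun fE).
by rewrite {2}(one_dynH T U); apply: eq_bigr => l _; rewrite mul1r.
Qed.

Section Legs.
Variables (W : falgType k) (f g : {linear H -> W}).
Hypotheses (fM : GRing.monoid_morphism f) (gM : GRing.monoid_morphism g).
Hypothesis fg : commuting f g.

Lemma leg_target l a u : (f \o target) (E l a u) = (counit c u : k) *: f (SJ (E l l 1)).
Proof.
rewrite -linearZ /=; congr (f _).
exact: (dyn_target cH iotaH JH).
Qed.

Lemma rmatrix_targetl :
  tconv (f \o target) g Rm = \sum_l f (SJ (E l l 1)) * g (E l l 1).
Proof. exact: (rmatrix_counitall g leg_target). Qed.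

End Legs.

Section SourceLegs.
Variables (W : falgType k) (f g : {linear H -> W}).
Hypotheses (fM : GRing.monoid_morphism f) (gM : GRing.monoid_morphism g).
Hypothesis fg : commuting f g.
Local Notation e := (\sum_b f (E b b 1) * g (SJ (E b b 1))).

Lemma rmatrix_targetr : tconv (f \o SJ) (g \o target) Rm = e.
Proof.
rewrite (rmatrix_counitalr (f \o SJ) (leg_target g)).
rewrite exchange_big; apply: eq_bigr => b _; rewrite -mulr_suml; congr (_ * _).
transitivity (f (\sum_l E b b (P (l - b)))); last first.
  by rewrite sum_munit_mul sum_idem_sub.
rewrite linear_sum; apply: eq_bigr => l _; rewrite /= (dyn_antipode_idem cH iotaH JH).
by rewrite [l + _]addrC subrK opprB.
Qed.

(** Right multiplication by E_aa (x) S_J(E_aa) fixes the terms with column index a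
    in the first leg, since S_J(E_aa) is the sum of the E_(a+n,a+n) P_(-n), and
    kills the others. *)
Lemma rmatrix_mul_source : tconv f g Rm * e = tconv f g Rm.
Proof.
rewrite -[LHS]/(GRing.mulr_fun e (tconv f g) Rm) (rmatrix_map iota _ dynRE)
    [RHS](rmatrix_map iota (tconv f g) dynRE).
apply: eq_bigr => l _; apply: eq_bigr => b _; apply: eq_bigr => a _; apply: eq_tlift => x y.
rewrite /= tconvE.
have Ea : f (E l a (P (b - l) * x)) * f (E a a 1) = f (E l a (P (b - l) * x)).
  by rewrite -fM.2 munit_tpureM eqxx mulr1.
have Eb : g (E b l (y * P (a - l))) * g (SJ (E a a 1)) = g (E b l (y * P (a - l))).
  rewrite -gM.2 (dyn_antipodeE cH iotaH JH) mulr_sumr (bigD1 (l - a)) //= big1 ?addr0.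
    by rewrite [a + (l - a)]addrC subrK munit_tpureM eqxx opprB -mulrA (idem_id iotaH).
  move=> n nla; rewrite munit_tpureM; case: eqP => // lan.
  by rewrite lan [a + n]addrC addrK eqxx in nla.
rewrite mulr_sumr (bigD1 a) //= [X in _ + X]big1 ?addr0 => [|p pa].
  by rewrite mulrA -[_ * g _ * f _]mulrA -fg mulrA Ea -mulrA Eb.
rewrite mulrA -[_ * g _ * f _]mulrA -fg mulrA -fM.2 munit_tpureM eq_sym (negPf pa).
by rewrite linear0 !mul0r.
Qed.

(** S_J turns E_(l,a) into an element fixed by S_J(E_aa) on the left, and
    P_(a-l) E_ll on the right of the second leg into E_aa P_(l-a) on its left. *)
Lemma target_mul_rmatrix :
  (\sum_q f (SJ (E q q 1)) * g (E q q 1)) * tconv (f \o SJ) (g \o SJ) Rm =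
  tconv (f \o SJ) (g \o SJ) Rm.
Proof.
pose e' : W := \sum_q f (SJ (E q q 1)) * g (E q q 1).
rewrite -[LHS]/(GRing.mull_fun e' (tconv (f \o SJ) (g \o SJ)) Rm).
rewrite (rmatrix_map iota _ dynRE) [RHS](rmatrix_map iota (tconv (f \o SJ) (g \o SJ)) dynRE).
apply: eq_bigr => l _; apply: eq_bigr => b _; apply: eq_bigr => a _; apply: eq_tlift => x y.
rewrite /= tconvE /=; set X := E l a _; set Y := E b l _.
have EX : SJ X = SJ (E a a 1) * SJ X.
  by rewrite -(dyn_antipodeM cH iotaH JH) /X munit_tpureM eqxx mulr1.
have EX2 : SJ (E a a 1) * SJ X = SJ X by rewrite -EX.
have EY p : E p p 1 * SJ Y = if p == a then SJ Y else 0.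
  have -> : SJ Y = E a a (P (l - a)) * SJ (E b l y).
    have <- : SJ (E l l (P (a - l))) = E a a (P (l - a)).
      by rewrite (dyn_antipode_idem cH iotaH JH) [l + (a - l)]addrC subrK opprB.
    by rewrite -(dyn_antipodeM cH iotaH JH) munit_tpureM eqxx.
  by rewrite mulrA munit_tpureM; case: eqP => [->|_]; rewrite ?mul1r ?mul0r.
rewrite /e' mulr_suml (bigD1 a) //= [X in _ + X]big1 ?addr0 => [|p pa].
  rewrite mulrA -[_ * g _ * f _]mulrA -fg mulrA -fM.2 EX2 -mulrA -gM.2.
  by rewrite EY eqxx.
rewrite mulrA -[_ * g _ * f _]mulrA -fg mulrA -fM.2 -mulrA -gM.2 EY (negPf pa).
by rewrite linear0 mulr0.
Qed.

End SourceLegs.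
End DynamicalQuasitriangular.

(** * The homomorphism property of rho *)

Section RhoMorphism.
Variables (k : fieldType) (T : finZmodType) (U : falgType k).
Variables (c : hopfData U) (R : tens U U) (iota : {linear Map k T -> U}).
Variables (J D : T -> tens U U).
Hypotheses (cH : is_hopf c) (RH : is_quasitriangular c R).
Hypotheses (iotaH : is_hopf_embedding c iota).
Hypothesis JH : is_dynamical_twist c iota J.
Hypothesis DE : forall l, tswap (J l) * D l = R * J l.
Hypothesis dynRE : forall l, dynR J R l = D l.
Local Notation H := (dynH T U).
Local Notation HJ := (wcoalg (H_J c iota J)).
Local Notation SJ := (dyn_antipode c iota J).
Local Notation Rm := (dyn_rmatrix iota J R).
Local Notation rho := (rho iota J R).

Lemma rmatrix_hexagonl (W : falgType k) (f g h : {linear H -> W}) :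
  legs3 f g h -> tconv (conv HJ f g) h Rm = tconv f h Rm * tconv g h Rm.
Proof.
by case=> -[M1 M2 M3] [c12 c13 c23];
  exact: (dyn_hexl cH RH iotaH JH DE dynRE M1 M2 M3 c12 c13 c23).
Qed.

Lemma rmatrix_hexagonr (W : falgType k) (f g h : {linear H -> W}) :
  legs3 f g h -> tconv f (conv HJ g h) Rm = tconv f h Rm * tconv f g Rm.
Proof.
by case=> -[M1 M2 M3] [c12 c13 c23];
  exact: (dyn_hexr cH RH iotaH JH DE dynRE M1 M2 M3 c12 c13 c23).
Qed.

Lemma antipode_dyn_rmatrix : tmap SJ SJ Rm = Rm.
Proof.
apply: (antipode_rmatrix rmatrix_hexagonl rmatrix_hexagonr (dyn_antipodeM cH iotaH JH)
  (E := fun l => munit k l l \ox 1 : H)) => W f g.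
- exact: (rmatrix_targetl cH RH iotaH JH DE dynRE f g).
- exact: (rmatrix_targetr cH RH iotaH JH DE dynRE f g).
- exact: (rmatrix_mul_source cH iotaH JH dynRE).
- exact: (target_mul_rmatrix cH iotaH JH dynRE).
Qed.

(** This is the invariance of the R-matrix under S_J (x) S_J, read through slices. *)
Lemma rho_antipode (f g : dual H) : (forall x, g x = f (SJ x)) ->
  SJ (rho g) = rho f.
Proof.
move=> gE; rewrite -[RHS]/(slicer f Rm) -antipode_dyn_rmatrix.
exact: (@slicer_tmap k H SJ SJ f g Rm gE).
Qed.

Lemma rho_mul f g : rho (dual_mul (H_J c iota J) f g) = rho g * rho f.
Proof.
rewrite -[RHS](slicer_mul rmatrix_hexagonr f g).
by apply: eq_tlift => u v; rewrite lfunE.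
Qed.

Lemma rho_one : rho (linfun (counit HJ)) = 1.
Proof.
rewrite -(dyn_rmatrix_counitr cH RH iotaH JH DE dynRE).
by apply: eq_tlift => u v; rewrite lfunE.
Qed.

Lemma rho_counit f : counit HJ (rho f) = f 1.
Proof.
rewrite -(dyn_rmatrix_counitl cH RH iotaH JH DE dynRE) [RHS]linear_tlift.
rewrite [LHS]linear_tlift; apply: eq_tlift => u v; rewrite !linearZ /=.
exact: mulrC.
Qed.

Lemma rho_comul f : comul HJ (rho f) = tmap rho rho (dual_comul (H_J c iota J) f).
Proof.
have dE i : rho (dual_vbasis i) = slicer (coord (vbasis {:H}) i : H -> k^o) Rm.
  by apply: eq_tlift => u v; rewrite lfunE.
exact: etrans (comul_slicer rmatrix_hexagonl f) (esym (tmap_sum _ dE)).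
Qed.

(** As S rho S^* = rho, a surjective rho forces S, hence its transpose, to be
    bijective. *)
Lemma rho_morphism : (forall y, exists f, rho f = y) ->
  weak_hopf_morphism (D_J c iota J) (H_J c iota J) rho.
Proof.
move=> rho_surj; split.
- by move=> f g; exact: rho_mul.
- exact: rho_one.
- exact: rho_comul.
- by move=> f; exact: rho_counit.
move=> f.
have Sinj : lker (linfun (dual_antipode (H_J c iota J))) == 0%VS.
  apply/lker0P => g h; rewrite !lfunE /= => gh; apply/lfunP => y.
  have [f' <-] := rho_surj y.
  have <- := rho_antipode (f := f') (g := (f' \o linfun SJ)%VF)
    (fun x => etrans (comp_lfunE _ _ _) (congr1 f' (lfunE _ _))).
  by have := congr1 (fun q : dual H => q (rho (f' \o linfun SJ)%VF)) gh; rewrite !comp_lfunE !lfunE.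
apply: rho_antipode => x.
have := lker0_lfunVK Sinj f; rewrite lfunE => E.
by rewrite -[in LHS]E comp_lfunE lfunE.
Qed.

End RhoMorphism.

(** * Tensor rank and dimensions of weight spaces *)

Section TensorRank.
Variable k : fieldType.

(** Coordinates act on rows from the right, as elements of U (x) V are matrices with
    rows indexed by the basis of U. *)
Definition mxlin (U V : vectType k) (f : U -> V) : 'M[k]_(\dim {:U}, \dim {:V}) :=
  \matrix_(i, j) coord (vbasis {:V}) j (f (vbasis {:U})`_i).

Lemma mxlin_comp (U V W : vectType k) (f : {linear U -> V}) (g : {linear V -> W}) :
  mxlin (g \o f) = mxlin f *m mxlin g.
Proof.
apply/matrixP=> i j; rewrite !mxE /=.
rewrite {1}(coord_vbasis (memvf (f (vbasis {:U})`_i))) !linear_sum.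
by apply: eq_bigr => l _; rewrite !linearZ !mxE.
Qed.

Lemma mxlin_id (U : vectType k) : mxlin (@idfun U) = 1%:M.
Proof.
apply/matrixP=> i j; rewrite !mxE /= coord_free; first by rewrite eq_sym.
exact: basis_free (vbasisP _).
Qed.

Lemma eq_mxlin (U V : vectType k) (f g : U -> V) : f =1 g -> mxlin f = mxlin g.
Proof. by move=> fg; apply/matrixP=> i j; rewrite !mxE fg. Qed.

Lemma mxlin0 (U V : vectType k) : mxlin (fun _ : U => 0 : V) = 0.
Proof. by apply/matrixP=> i j; rewrite !mxE linear0. Qed.

Lemma tmap_mx (U V U' V' : vectType k) (f : {linear U -> U'}) (g : {linear V -> V'})
  (x : tens U V) : tmap f g x = (mxlin f)^T *m x *m mxlin g.
Proof.
apply/matrixP=> a b; rewrite /tmap /tlift summxE mxE.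
under [RHS]eq_bigr do rewrite mxE mulr_suml.
rewrite exchange_big; apply: eq_bigr => i _; rewrite summxE; apply: eq_bigr => j _.
by rewrite !mxE mulrA [_ * x i j]mulrC.
Qed.

Lemma tensor_rank_leP (U V : vectType k) (x : tens U V) r :
  tensor_rank_le x r <-> (\rank (x : 'M_(_, _)) <= r)%N.
Proof.
split=> [[a [b ->]]|rx].
  have -> : \sum_i a i \ox b i =
      (\matrix_(i, l) coord (vbasis {:U}) i (a l)) *m
      (\matrix_(l, j) coord (vbasis {:V}) j (b l)) :> 'M_(_, _).
    by apply/matrixP=> i j; rewrite summxE mxE; apply: eq_bigr => l _; rewrite !mxE.
  exact: leq_trans (mxrankM_maxr _ _) (rank_leq_row _).
pose A : 'M[k]_(\dim {:U}, r) := col_base x *m pid_mx (\rank x).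
pose B : 'M[k]_(r, \dim {:V}) := pid_mx (\rank x) *m row_base x.
have xAB : x = A *m B :> 'M_(_, _).
  rewrite /A /B mulmxA -[_ *m pid_mx _ *m pid_mx _]mulmxA pid_mx_id // pid_mx_1 mulmx1.
  by rewrite mulmx_base.
exists (fun l => \sum_i A i l *: (vbasis {:U})`_i), (fun l => \sum_j B l j *: (vbasis {:V})`_j).
have fr (W : vectType k) : free (vbasis {:W}) := basis_free (vbasisP _).
apply/matrixP=> i j; rewrite {1}xAB summxE mxE; apply: eq_bigr => l _.
by rewrite [in RHS]mxE !coord_sum_free.
Qed.

Lemma tensor_rankP (U V : vectType k) (x : tens U V) r :
  tensor_rank x r <-> \rank (x : 'M_(_, _)) = r.
Proof.
split=> [[/tensor_rank_leP xr rmin]|<-].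
  by apply/eqP; rewrite eqn_leq xr rmin //; apply/tensor_rank_leP.
by split=> [|s /tensor_rank_leP //]; apply/tensor_rank_leP.
Qed.

End TensorRank.

(** At an index where d is maximal the inequality must be an equality, and all
    d(a) occur in it with a nonzero weight. *)
Lemma constant_of_convolution (T : finZmodType) (d : T -> nat) D :
    (\sum_a d a)%N = D -> (forall a, 0 < d a)%N ->
    (forall n, D * d n <= \sum_a d a * d (n - a)%R)%N ->
  forall n, d n = (D %/ #|T|)%N.
Proof.
move=> sum_d d_gt0 conv_d n.
have [m _ dmax'] := @arg_maxnP T 0 xpredT d isT.
have dmax a : (d a <= d m)%N := dmax' a isT.
have deq a : d a = d m.
  apply/eqP; rewrite eqn_leq dmax //= leqNgt; apply/negP => da.
  have := conv_d m; apply/negP; rewrite -ltnNge -sum_d big_distrl /=.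
  rewrite (bigD1 (m - a)) //= [X in (_ < X)%N](bigD1 (m - a)) //= subKr.
  rewrite -addSn leq_add // ?ltn_pmul2l ?d_gt0 //.
  by apply: leq_sum => b _; rewrite leq_mul2l dmax orbT.
rewrite -sum_d (eq_bigr (fun=> d m)) => [|a _]; last exact: deq.
by rewrite sum_nat_const mulKn ?deq //; apply/card_gt0P; exists 0.
Qed.

Section Freeness.
Variables (k : fieldType) (T : finZmodType) (U : vectType k).
Variable p : T -> {linear U -> U}.
Hypothesis pM : forall a b x, p a (p b x) = if a == b then p a x else 0.
Hypothesis p_sum : forall x, \sum_a p a x = x.
Hypothesis p_neq0 : forall a, exists x, p a x != 0.
Variable psi : {linear tens U U -> tens U U}.
Hypothesis psi_inj : forall x, psi x = 0 -> x = 0.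
Hypothesis psi_p : forall n x,
  psi (tmap (p n) idfun x) = \sum_a tmap (p a) (p (n - a)) (psi x).

Local Notation N a := (mxlin (p a)).
Local Notation d a := (\rank (N a)).
Local Notation D := (\dim {:U}).

Lemma mxlin_idem a b : N a *m N b = if a == b then N a else 0.
Proof.
rewrite -mxlin_comp; have [<-|ab] := eqVneq a b.
  by apply: eq_mxlin => x; rewrite /= pM eqxx.
by rewrite -[RHS](mxlin0 U U); apply: eq_mxlin => x; rewrite /= pM eq_sym (negPf ab).
Qed.

Lemma sum_mxlin : \sum_a N a = 1%:M.
Proof.
rewrite -(mxlin_id U); apply/matrixP=> i j; rewrite summxE mxE /=.
by rewrite -[in RHS](p_sum (vbasis {:U})`_i) linear_sum; apply: eq_bigr => a _; rewrite mxE.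
Qed.

Lemma sum_rank : (\sum_a d a)%N = D.
Proof.
have dir : mxdirect (\sum_a N a).
  apply/mxdirect_sumsP => i _; apply/eqP/rowV0P => u; rewrite sub_capmx => /andP[ui uj].
  have [u' uE] := submxP ui; have uNi : u *m N i = u by rewrite uE -mulmxA mxlin_idem eqxx.
  have [w wE] := sub_sumsmxP uj.
  rewrite -uNi wE mulmx_suml big1 // => j ji.
  by rewrite -mulmxA mxlin_idem (negPf ji) mulmx0.
have <- := mxdirectP dir; rewrite /=; apply/eqP; rewrite eqn_leq rank_leq_col /=.
rewrite -[X in (X <= _)%N](mxrank1 k); apply: mxrankS; rewrite -sum_mxlin.
by apply: summx_sub => a _; apply: (sumsmx_sup a).
Qed.

Lemma rank_gt0 a : (0 < d a)%N.
Proof.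
rewrite lt0n mxrank_eq0; apply/eqP => Na0; have [x /eqP[]] := p_neq0 a.
rewrite (coord_vbasis (memvf x)) linear_sum big1 // => i _; rewrite linearZ /=.
rewrite (coord_vbasis (memvf (p a _))) big1 ?scaler0 // => j _.
by have /matrixP/(_ i j) := Na0; rewrite !mxE => ->; rewrite scale0r.
Qed.

(** psi carries the subspace of weight n in the first tensor factor into the
    subspace of total weight n, which is a sum of products of weight spaces. *)
Lemma rank_convolution n : (D * d n <= \sum_a d a * d (n - a)%R)%N.
Proof.
pose B a := row_base (N a); pose C a := col_base (N a).
have BN : B n *m N n = B n.
  have [K BK] : exists K, B n = K *m N n by apply/submxP; rewrite eq_row_base.
  by rewrite {1}BK -mulmxA mxlin_idem eqxx.
pose f0 (Y : 'M[k]_(d n, D)) : tens U U := psi ((B n)^T *m Y : tens U U).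
have f0l : linear f0 by move=> a X Y; rewrite /f0 mulmxDr -scalemxAr linearP.
pose f : 'Hom('M[k]_(d n, D), tens U U) :=
  linfun (HB.pack f0 (GRing.isLinear.Build k _ _ *:%R f0 f0l) : {linear _ -> _}).
pose g0 a (Y : 'M[k]_(d a, d (n - a))) : tens U U := (B a)^T *m Y *m B (n - a).
have g0l a : linear (@g0 a).
  by move=> s X Y; rewrite /g0 mulmxDr mulmxDl -scalemxAr -scalemxAl.
pose g a : 'Hom('M[k]_(d a, d (n - a)), tens U U) :=
  linfun (HB.pack (@g0 a) (GRing.isLinear.Build k _ _ *:%R (@g0 a) (@g0l a)) : {linear _ -> _}).
have f_inj : lker f == 0%VS.
  apply/lker0P => X Y; rewrite !lfunE /= => /eqP; rewrite -subr_eq0 -linearB /=.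
  move=> /eqP/psi_inj/(congr1 trmx); rewrite trmx0 -mulmxBr trmx_mul trmxK.
  move=> XY0; apply/eqP; rewrite -subr_eq0 -trmx_eq0; apply/eqP.
  by apply: (row_free_inj (row_base_free (N n))); rewrite XY0 mul0mx.
have sub : (limg f <= \sum_a limg (g a))%VS.
  apply/subvP => z /memv_imgP[Y _ ->]; rewrite lfunE /= /f0.
  have -> : (B n)^T *m Y = tmap (p n) idfun ((B n)^T *m Y : tens U U).
    by rewrite tmap_mx mxlin_id mulmx1 mulmxA -trmx_mul BN.
  rewrite psi_p; apply: memv_suml => a _; rewrite tmap_mx; set z' := psi _.
  suff -> : (N a)^T *m z' *m N (n - a) = g a ((C a)^T *m z' *m C (n - a)).
    by apply: subvP (memv_img _ (memvf _)); apply: (sumv_sup a).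
  rewrite lfunE /= /g0 -[in LHS](mulmx_base (N a)) -[in LHS](mulmx_base (N (n - a))).
  by rewrite trmx_mul !mulmxA.
have := leq_trans (dimvS sub) (dimv_leq_sum _ _ _).
rewrite limg_dim_eq; last by rewrite (eqP f_inj) capv0.
rewrite dimvf dim_matrix mulnC => /leq_trans; apply; apply: leq_sum => a _.
have E : \dim {:'M[k]_(d a, d (n - a))} = (d a * d (n - a)%R)%N.
  by rewrite dimvf dim_matrix.
by rewrite -E -(limg_ker_dim (g a) fullv) leq_addl.
Qed.

Lemma weight_rank n : d n = (D %/ #|T|)%N.
Proof.
apply: (constant_of_convolution (d := fun a => d a) sum_rank rank_gt0).
exact: rank_convolution.
Qed.

End Freeness.

(** * Ranks of corners *)

Section WeightSpaces.
Variables (k : fieldType) (T : finZmodType) (U : falgType k).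
Variables (c : hopfData U) (iota : {linear Map k T -> U}).
Hypotheses (cH : is_hopf c) (iotaH : is_hopf_embedding c iota).
Local Notation P := (idem iota).
Local Notation S := (antipode c).
Local Notation inl := (@inl_tens k U U).
Local Notation inr := (@inr_tens k U U).

Definition mull_idem n : U -> U := GRing.mull_fun (P n) idfun.
HB.instance Definition _ n := GRing.Linear.copy (mull_idem n) (GRing.mull_fun (P n) idfun).
Definition mulr_idem n : U -> U := GRing.mulr_fun (P n) idfun.
HB.instance Definition _ n := GRing.Linear.copy (mulr_idem n) (GRing.mulr_fun (P n) idfun).

Lemma tmap_mull a b x : tmap (mull_idem a) (mull_idem b) x = (P a \ox P b) * x.
Proof.
apply: (tensor_linear_ext (f := tmap (mull_idem a) (mull_idem b))
  (g := GRing.mull_fun (P a \ox P b) idfun)) => u v /=.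
by rewrite tmapE tpureM.
Qed.

Lemma tmap_mulr a b x : tmap (mulr_idem a) (mulr_idem b) x = x * (P a \ox P b).
Proof.
apply: (tensor_linear_ext (f := tmap (mulr_idem a) (mulr_idem b))
  (g := GRing.mulr_fun (P a \ox P b) idfun)) => u v /=.
by rewrite tmapE tpureM.
Qed.

(** The map x (x) y |-> x_1 (x) x_2 y is invertible, with inverse built from the
    antipode, and turns multiplication by P_n on the first factor into
    multiplication by Delta(P_n). *)
Lemma rank_mull_idem n : \rank (mxlin (mull_idem n)) = (\dim {:U} %/ #|T|)%N.
Proof.
pose psi : {linear tens U U -> tens U U} := tconv (comul c) inr.
apply: (@weight_rank k T U (fun n => mull_idem n : {linear U -> U}) _ _ _ psi)
  => [a b x|x|a|x|{}n x].
- by rewrite /= /mull_idem /= mulrA (idemM iotaH); case: eqP; rewrite ?mul0r.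
- by rewrite /= /mull_idem /= -mulr_suml (sum_idem iotaH) mul1r.
- by exists 1; rewrite /= /mull_idem /= mulr1 (idem_neq0 iotaH).
- pose th : {linear tens U U -> tens U U} := tconv (conv c inl (inr \o S)) inr.
  have thE a b : th (a \ox b) = conv c inl (inr \o S) a * inr b by apply: tconvE.
  have thM w y : th (w * inr y) = th w * inr y.
    pose th1 : {linear tens U U -> tens U U} := th \o GRing.mulr_fun (inr y) idfun.
    apply: (tensor_linear_ext (f := th1) (g := GRing.mulr_fun (inr y) th)) => a b.
    rewrite /th1 /= {1}/inr_tens tpureM mulr1 !thE -mulrA.
    by rewrite -(inr_tens_monoid _ _).2.
  have thD u : th (comul c u) = inl u.
    rewrite -[LHS]/(conv c (conv c inl (inr \o S)) inr u) (convA cH).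
    rewrite -[RHS](conv1r cH inl u); apply: eq_conv => // v.
    transitivity (inr ((counit c v : k) *: 1)); last by rewrite linearZ.
    rewrite -(hopf_antipodel cH) [RHS]linear_tlift.
    by apply: eq_tlift => a b; rewrite /= (inr_tens_monoid _ _).2.
  suff thK : th (psi x) = x by move=> px; rewrite -thK px linear0.
  apply: (tensor_linear_ext (f := th \o psi) (g := idfun)) => a b.
  by rewrite /psi /= tconvE /= thM thD -tpure_inl_inr.
rewrite /psi; under [RHS]eq_bigr do rewrite tmap_mull.
rewrite -mulr_suml -(comul_idem iotaH).
pose psi1 : {linear tens U U -> tens U U} := psi \o tmap (mull_idem n) idfun.
apply: (tensor_linear_ext (f := psi1) (g := GRing.mull_fun (comul c (P n)) psi)) => a b.
by rewrite /psi1 /psi /= tmapE !tconvE /= hopf_comulM // mulrA.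
Qed.

(** Here x (x) y |-> y x_1 (x) x_2 turns right multiplication by P_n on x into right
    multiplication by Delta(P_n); up to the order of the factors it is inverted by
    a (x) b |-> a S(b_1) (x) b_2. *)
Lemma rank_mulr_idem n : \rank (mxlin (mulr_idem n)) = (\dim {:U} %/ #|T|)%N.
Proof.
pose psi : {linear tens U U -> tens U U} := tconv inl (comul c) \o @tswap k U U.
apply: (@weight_rank k T U (fun n => mulr_idem n : {linear U -> U}) _ _ _ psi)
  => [a b x|x|a|x|{}n x].
- by rewrite /= /mulr_idem /= -mulrA (idemM iotaH) eq_sym; case: eqP => [->|]; rewrite ?mulr0.
- by rewrite /= /mulr_idem /= -mulr_sumr (sum_idem iotaH) mulr1.
- by exists 1; rewrite /= /mulr_idem /= mul1r (idem_neq0 iotaH).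
- pose th : {linear tens U U -> tens U U} := tconv inl (conv c (inl \o S) inr).
  have thE a b : th (a \ox b) = inl a * conv c (inl \o S) inr b by apply: tconvE.
  have thM w y : th (inl y * w) = inl y * th w.
    pose th1 : {linear tens U U -> tens U U} := th \o GRing.mull_fun (inl y) idfun.
    apply: (tensor_linear_ext (f := th1) (g := GRing.mull_fun (inl y) th)) => a b.
    rewrite /th1 /= {1}/inl_tens tpureM mul1r !thE mulrA.
    by rewrite -(inl_tens_monoid _ _).2.
  have thD u : th (comul c u) = inr u.
    rewrite -[LHS]/(conv c inl (conv c (inl \o S) inr) u) -(convA cH).
    rewrite -[RHS](conv1l cH inr u); apply: eq_conv => // v.
    transitivity (inl ((counit c v : k) *: 1)); last by rewrite linearZ.
    rewrite -(hopf_antipoder cH) [RHS]linear_tlift.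
    by apply: eq_tlift => a b; rewrite /= (inl_tens_monoid _ _).2.
  suff thK : th (psi x) = tswap x.
    move=> px; have := thK; rewrite px linear0 => /esym /(congr1 (@tswap k U U)).
    rewrite linear0 => <-; symmetry.
    apply: (tensor_linear_ext (f := @tswap k U U \o @tswap k U U) (g := idfun)) => a b.
    by rewrite /= !tswapE.
  apply: (tensor_linear_ext (f := th \o psi) (g := @tswap k U U)) => a b.
  by rewrite /psi /= tswapE tconvE /= thM thD -tpure_inl_inr.
rewrite /psi; under [RHS]eq_bigr do rewrite tmap_mulr.
rewrite -mulr_sumr -(comul_idem iotaH).
pose psi1 : {linear tens U U -> tens U U} := psi \o tmap (mulr_idem n) idfun.
apply: (tensor_linear_ext (f := psi1) (g := GRing.mulr_fun (comul c (P n)) psi)) => a b.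
by rewrite /psi1 /psi /= tmapE !tswapE !tconvE /= hopf_comulM // mulrA.
Qed.

Lemma corner_mx m n (x : tens U U) :
  corner iota m n x = (mxlin (mull_idem m))^T *m x *m mxlin (mulr_idem n).
Proof. exact: (tmap_mx (mull_idem m) (mulr_idem n) x). Qed.

Lemma mxlin_mull_idem m : mxlin (mull_idem m) *m mxlin (mull_idem m) = mxlin (mull_idem m).
Proof.
rewrite -mxlin_comp; apply: eq_mxlin => x.
by rewrite /= /mull_idem /= mulrA (idem_id iotaH).
Qed.

Lemma mxlin_mulr_idem m : mxlin (mulr_idem m) *m mxlin (mulr_idem m) = mxlin (mulr_idem m).
Proof.
rewrite -mxlin_comp; apply: eq_mxlin => x.
by rewrite /= /mulr_idem /= -mulrA (idem_id iotaH).
Qed.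

(** A corner is A^T x B with A and B idempotent of rank dim U / |T|; pairing bases of
    their row spaces attains that rank. *)
Lemma max_corner_rankE m n : max_corner_rank iota m n (\dim {:U} %/ #|T|).
Proof.
split; last first.
  move=> x r /tensor_rankP <-; rewrite corner_mx -(rank_mulr_idem n).
  exact: mxrankM_maxr.
set A := mxlin (mull_idem m); set B := mxlin (mulr_idem n).
have base_idem (C : 'M[k]_(\dim {:U})) : C *m C = C -> row_base C *m C = row_base C.
  move=> CC; have [K KE] : exists K, row_base C = K *m C by apply/submxP; rewrite eq_row_base.
  by rewrite KE -mulmxA CC.
pose x := (row_base A)^T *m (pid_mx (\rank A) : 'M_(\rank A, \rank B)) *m row_base B.
exists (x : tens U U); apply/tensor_rankP; rewrite corner_mx -/A -/B.
have -> : A^T *m x *m B = x.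
  have regroup r s (a : 'M_(r, _)) (q : 'M[k]_(r, s)) b :
      A^T *m (a^T *m q *m b) *m B = (a *m A)^T *m q *m (b *m B).
    by rewrite trmx_mul !mulmxA.
  by rewrite /x regroup !base_idem ?mxlin_mull_idem ?mxlin_mulr_idem.
rewrite /x mxrankMfree ?row_base_free // -mxrank_tr trmx_mul trmxK.
rewrite mxrankMfree ?row_base_free // mxrank_tr rank_pid_mx ?rank_mull_idem //.
by rewrite rank_mulr_idem.
Qed.

(** The row space of a corner lies in that of right multiplication by P_n, whose
    rank is dim U / |T|: the ranks agree when the two spaces do, that is, when every
    functional vanishing on the first vanishes on the second. *)
Lemma corner_rankP m n (x : tens U U) :
  tensor_rank (corner iota m n x) (\dim {:U} %/ #|T|) <->
  forall g : {linear U -> k^o},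
    slicer g (corner iota m n x) = 0 -> forall y, g (y * P n) = 0.
Proof.
set B := mxlin (mulr_idem n); pose X : 'M[k]_(\dim {:U}) := corner iota m n x.
have XB : (X <= B)%MS by rewrite /X corner_mx submxMl.
have slE (g : {linear U -> k^o}) (z : tens U U) i :
    coord (vbasis {:U}) i (slicer g z) =
     ((z : 'M[k]_(\dim {:U})) *m \col_j (g (vbasis {:U})`_j : k)) i 0.
  rewrite [RHS]mxE /slicer /tlift [LHS]linear_sum [LHS](bigD1 i) //= [X in _ + X]big1.
    rewrite addr0 linear_sum; apply: eq_bigr => j _; rewrite !linearZ mxE /=.
    by rewrite coord_free ?(basis_free (vbasisP _)) // eqxx mulr1.
  move=> i' i'i; rewrite linear_sum big1 // => j _; rewrite !linearZ /=.
  by rewrite coord_free ?(basis_free (vbasisP _)) // (negPf i'i) !mulr0.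
split.
  move/tensor_rankP; rewrite -(rank_mulr_idem n) => rX g Xg y.
  have BX : (B <= X)%MS by rewrite -(mxrank_leqif_sup XB) rX.
  have [K BK] := submxP BX.
  pose gc : 'cV[k]_(\dim {:U}) := \col_j (g (vbasis {:U})`_j : k).
  have Xg0 : X *m gc = 0.
    by apply/matrixP=> i j; rewrite ord1 -slE Xg linear0 mxE.
  have Bg0 : B *m gc = 0 by rewrite BK -mulmxA Xg0 mulmx0.
  rewrite (coord_vbasis (memvf y)) mulr_suml linear_sum big1 // => i _.
  rewrite -scalerAl linearZ /=; have /matrixP/(_ i 0) := Bg0; rewrite !mxE.
  rewrite {1}(coord_vbasis (memvf ((vbasis {:U})`_i * P n))) linear_sum /= => E.
  suff -> : \sum_j g (coord (vbasis {:U}) j ((vbasis {:U})`_i * P n) *: (vbasis {:U})`_j) = 0.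
    by rewrite scaler0.
  by rewrite -[RHS]E; apply: eq_bigr => j _; rewrite linearZ !mxE.
move=> nd; apply/tensor_rankP; rewrite -(rank_mulr_idem n).
apply/eqP; rewrite (mxrank_leqif_sup XB) submxE; apply/eqP/matrixP => i j.
pose w := col j (cokermx X).
pose g0 (u : U) : k^o := \sum_l coord (vbasis {:U}) l u * w l 0.
have g0l : linear g0.
  move=> s u v; rewrite /g0 scaler_sumr -big_split; apply: eq_bigr => l _ /=.
  by rewrite linearP mulrDl; congr (_ + _); apply/esym/mulrA.
pose g : {linear U -> k^o} := HB.pack g0 (GRing.isLinear.Build k U k^o *:%R g0 g0l).
have gb (l : 'I_(\dim {:U})) : g (vbasis {:U})`_l = w l 0.
  rewrite /g /= /g0 (bigD1 l) //= big1 ?addr0 => [|l' l'l].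
    by rewrite coord_free ?(basis_free (vbasisP _)) // eqxx mul1r.
  by rewrite coord_free ?(basis_free (vbasisP _)) // eq_sym (negPf l'l) mul0r.
have gw : \col_l (g (vbasis {:U})`_l : k) = w by apply/matrixP=> l z; rewrite mxE gb ord1.
have Xg : slicer g (X : tens U U) = 0.
  rewrite (coord_vbasis (memvf (slicer g (X : tens U U)))) big1 // => l _.
  by rewrite slE gw /w colE mulmxA mulmx_coker mul0mx mxE scale0r.
have := nd g Xg (vbasis {:U})`_i; rewrite /g /= /g0 => E.
rewrite [RHS]mxE -[RHS]E mxE; apply: eq_bigr => l _.
by rewrite /w !mxE.
Qed.

End WeightSpaces.

(** * Nondegeneracy *)

Section Nondegeneracy.
Variables (k : fieldType) (T : finZmodType) (U : falgType k).
Variables (c : hopfData U) (R : tens U U) (iota : {linear Map k T -> U}).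
Variables (J D : T -> tens U U).
Hypotheses (cH : is_hopf c) (iotaH : is_hopf_embedding c iota).
Hypothesis dynRE : forall l, dynR J R l = D l.
Local Notation P := (idem iota).
Local Notation H := (dynH T U).
Local Notation E l m u := (munit k l m \ox (u : U) : H).
Local Notation rho := (rho iota J R).

Definition dynH_coef (l m : T) : {linear H -> U} :=
  tlift (fun (M : EndMap k T) (u : U) => M (row_of l) (row_of m) *: u).

Lemma dynH_coefE l m l' m' u :
  dynH_coef l m (E l' m' u) = if (l == l') && (m == m') then u else 0.
Proof.
rewrite /dynH_coef /= tlift_tpure => [|v|M] /=.
- by rewrite munitE; case: ifP => _; rewrite ?scale1r ?scale0r.
- by move=> a M N; rewrite !mxE scalerDl scalerA.
- by move=> a v w; rewrite scalerDr !scalerA mulrC.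
Qed.

(** Every corner of the dynamical R-matrix occurs in exactly one block of the
    R-matrix of H_J, and rho acts block by block. *)
Lemma rho_blocks (f : dual H) : rho f =
  \sum_l \sum_b \sum_a
    E l a (slicer (f \o munit_mul b l) (corner iota (b - l) (a - l) (D l))).
Proof.
rewrite [LHS](rmatrix_map iota (slicer f) dynRE).
apply: eq_bigr => l _; apply: eq_bigr => b _; apply: eq_bigr => a _.
rewrite -[RHS]/(munit_mul l a _).
pose L : {linear tens U U -> H} := munit_mul l a \o slicer (f \o munit_mul b l).
rewrite -[RHS]/(L _) /corner linear_tlift; apply: eq_tlift => x y.
by rewrite /L /= !slicerE /= linearZ.
Qed.

Lemma slicer_corner (g : {linear U -> k^o}) m n z :
  slicer g (corner iota m n z) =
  tlift (fun x y => (g (y * P n) : k) *: (P m * x)) z.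
Proof. by rewrite /corner linear_tlift; apply: eq_tlift => x y; rewrite /= slicerE. Qed.

Lemma idem_slicer_corner (g : {linear U -> k^o}) m m' n z :
  P m' * slicer g (corner iota m n z) =
  if m' == m then slicer g (corner iota m n z) else 0.
Proof.
rewrite !slicer_corner -[LHS]/(GRing.mull_fun (P m') idfun _) linear_tlift.
case: eqP => [->|/eqP mm'].
  by apply: eq_tlift => x y; rewrite /= -scalerAr mulrA (idem_id iotaH).
rewrite -[RHS](tlift0 U z); apply: eq_tlift => x y.
by rewrite /= -scalerAr mulrA (idemM iotaH) (negPf mm') mul0r scaler0.
Qed.

Local Notation nondegenerate := (forall l m n (g : {linear U -> k^o}),
  slicer g (corner iota m n (D l)) = 0 -> forall y, g (y * P n) = 0).

(** The summands of rho(f) are independent: the matrix unit separates l and a, and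
    the weight b - l of the left leg separates b. *)
Lemma rho_injective_of_nondegenerate : nondegenerate -> injective rho.
Proof.
move=> nd; apply: linear_injective => f f0.
have block l b a : slicer (f \o munit_mul b l) (corner iota (b - l) (a - l) (D l)) = 0.
  have := congr1 (fun z => P (b - l) * dynH_coef l a z) (etrans (esym (rho_blocks f)) f0).
  rewrite linear0 mulr0 linear_sum (bigD1 l) //= [X in _ * (_ + X)]big1 ?addr0 => [|l' l'l].
    rewrite linear_sum mulr_sumr (bigD1 b) //= [X in _ + X = _]big1 ?addr0 => [|b' b'b].
      rewrite linear_sum (bigD1 a) //= [X in _ * (_ + X)]big1 ?addr0 => [|a' a'a].
        by rewrite dynH_coefE !eqxx /= idem_slicer_corner eqxx.
      by rewrite dynH_coefE [a == a']eq_sym (negPf a'a) andbF.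
    rewrite linear_sum mulr_sumr big1 // => a' _.
    rewrite dynH_coefE; case: ifP => [_|]; last by rewrite mulr0.
    by rewrite idem_slicer_corner (inj_eq (addIr _)) [b == b']eq_sym (negPf b'b).
  rewrite linear_sum big1 // => b' _; rewrite linear_sum big1 // => a' _.
  by rewrite dynH_coefE [l == l']eq_sym (negPf l'l).
apply/lfunP => h; rewrite zero_lfunE; elim/dynH_ind: h => [s x y fx fy|b l u].
  by rewrite linearP /= fx fy scaler0 addr0.
rewrite -[u]mulr1 -(sum_idem_sub iotaH l) mulr_sumr -sum_munit_mul linear_sum big1 // => a _.
exact: (nd _ _ _ _ (block l b a)).
Qed.

(** A functional g on U P_n, placed on the matrix unit with indices m + l and l,
    meets a single block of the R-matrix, the corner (m, n) of D(l). *)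
Lemma nondegenerate_of_rho_injective : injective rho -> nondegenerate.
Proof.
move=> rho_inj l m n g gc y.
pose f0 : {linear H -> k^o} := g \o (mulr_idem iota n \o dynH_coef (m + l) l).
pose f : dual H := linfun f0.
have fE b l' u : f (E b l' u) = if (m + l == b) && (l == l') then g (u * P n) else 0.
  by rewrite /f lfunE /f0 /= dynH_coefE; case: ifP => // _; rewrite linear0 linear0.
suff f_0 : f = 0.
  by have := fE (m + l) l y; rewrite !eqxx f_0 zero_lfunE /= => <-.
apply: rho_inj; rewrite linear0 rho_blocks.
rewrite big1 // => l' _; rewrite big1 // => b _; rewrite big1 // => a _.
suff -> : slicer (f \o munit_mul b l') (corner iota (b - l') (a - l') (D l')) = 0.
  exact: munit_mul0.
rewrite (slicer_corner (f \o munit_mul b l')).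
case lb: ((m + l == b) && (l == l')); last first.
  rewrite -[RHS](tlift0 U (D l')); apply: eq_tlift => x z.
  by rewrite /= fE lb scale0r.
case/andP: lb => /eqP <- /eqP <-; rewrite addrK.
case: (eqVneq n (a - l)) => [<-|nal].
  rewrite -[RHS]gc slicer_corner; apply: eq_tlift => x z.
  by rewrite /= fE !eqxx /= -mulrA (idem_id iotaH).
rewrite -[RHS](tlift0 U (D l)); apply: eq_tlift => x z.
rewrite /= fE !eqxx /= -mulrA (idemM iotaH) eq_sym (negPf nal).
by rewrite mulr0 linear0 scale0r.
Qed.

End Nondegeneracy.

(** V and its dual have the same dimension. *)
Lemma injective_dual_cancel (k : fieldType) (V : vectType k) (f : {linear dual V -> V}) :
  injective f -> exists2 g : {linear V -> dual V}, cancel f g & cancel g f.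
Proof.
move=> fI; pose F := linfun f.
have kF : lker F == 0%VS by apply/lker0P => x y; rewrite !lfunE; exact: fI.
have FK := lker0_lfunK kF.
have limF : limg F = fullv.
  apply/eqP; rewrite eqEdim subvf limg_dim_eq ?(eqP kF) ?capv0 //.
  by rewrite !dimvf leq_eqVlt; apply/orP; left; rewrite eq_sym; apply/eqP; exact: muln1.
exists (F^-1)%VF => x; first by have := FK x; rewrite lfunE.
have xF : x \in limg F by rewrite limF memvf.
by have := limg_lfunVK xF; rewrite lfunE.
Qed.

Lemma weak_hopf_isomorphism_of_cancel (k : fieldType) (V W : vectType k)
    (c : weakHopfData V) (d : weakHopfData W) (f : {linear V -> W}) (g : {linear W -> V}) :
    cancel f g -> cancel g f -> weak_hopf_morphism c d f ->
  weak_hopf_isomorphism c d f.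
Proof.
move=> fK gK fm; split=> //; exists g; split=> //.
have [fM f1 fD fE fS] := fm; split.
- by move=> x y; rewrite -{1}(gK x) -{1}(gK y) -fM fK.
- by rewrite -f1 fK.
- move=> y; rewrite -[in RHS](gK y) fD; set z := comul c _.
  apply: (tensor_linear_ext (f := idfun) (g := tmap g g \o tmap f f)) => u v /=.
  by rewrite !tmapE !fK.
- by move=> y; rewrite -[in RHS](gK y) fE.
- by move=> y; rewrite -[in RHS](gK y) fS fK.
Qed.

Theorem proposition4p4p2 (k : closedFieldType) (T : finZmodType)
    (U : falgType k) (c : hopfData U) (R : tens U U)
    (iota : {linear Map k T -> U}) (J : T -> tens U U)
    (U_hopf : is_hopf c)
    (U_quasitriangular : is_quasitriangular c R)
    (A_sub_U : is_hopf_embedding c iota)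
    (J_twist : is_dynamical_twist c iota J) :
  (forall m n, max_corner_rank iota m n (\dim {:U} %/ #|T|)) /\
  (weak_hopf_isomorphism (D_J c iota J) (H_J c iota J) (rho iota J R) <->
   forall l m n, tensor_rank (corner iota m n (dynR J R l)) (\dim {:U} %/ #|T|)).
Proof.
split=> [m n|]; first exact: max_corner_rankE U_hopf A_sub_U m n.
have rankP l m n := corner_rankP U_hopf A_sub_U m n (dynR J R l).
split=> [[_ [g [_ fK _]]] l m n|ranks].
  apply/rankP; apply: (nondegenerate_of_rho_injective A_sub_U (fun _ => erefl)).
  exact: can_inj fK.
have inj : injective (rho iota J R).
  apply: (rho_injective_of_nondegenerate A_sub_U (D := dynR J R) (fun _ => erefl)) => l m n.
  exact/rankP.
have [g fK gK] := injective_dual_cancel inj.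
apply: (weak_hopf_isomorphism_of_cancel fK gK).
apply: (rho_morphism U_hopf U_quasitriangular A_sub_U J_twist (D := dynR J R)) => //.
  by move=> l; exact: (tswap_dynR R J_twist).
by move=> y; exists (g y); exact: gK.
Qed.
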